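(* Let $b_1,\dots,b_N$ be real constants, set $c_k=(-1)^k(2\pi)^{2k+1}b_k$ for $1\le k\le N$, assume $c_k\le 0$ for all $1\le k\le N$, and let $P(\xi)=\sum_{k=1}^N c_k\xi^{2k+1}$. Then for functions $u,v:\mathbb{T}\times[0,T]\to\mathbb{R}$ we have the bilinear estimate $$\|uv\|_{L^2_xL^2_t}\lesssim\|u\|_{X^{0,\frac{N+1}{4N+2}}}\,\|v\|_{X^{0,\frac{N+1}{4N+2}}},$$ where the $X^{s,b}$ norm is the one associated with $P$, and $\lesssim$ means inequality up to a constant factor independent of $u$ and $v$.
   Context: $N\ge 1$ is an integer, $T>0$, and $\mathbb{T}=\mathbb{R}/\mathbb{Z}$ is the one-dimensional torus. The polynomial $P$ arises from the linear operator $\mathcal{L}=\sum_{k=1}^N b_k\partial_x^{2k+1}$, whose Fourier symbol is $\sum_{k=1}^N b_k(2\pi i\xi)^{2k+1}=iP(\xi)$. A function $u$ on $\mathbb{T}\times[0,T]$ is regarded as a function on $\mathbb{T}\times\mathbb{R}$ by extending it by zero in $t$, and its space-time Fourier transform is $$\hat u(n,\lambda)=\int_{\mathbb{R}}\int_{\mathbb{T}}u(x,t)e^{-2\pi i(nx+\lambda t)}\,dx\,dt,\qquad n\in\mathbb{Z},\ \lambda\in\mathbb{R}.$$ For $s,b\in\mathbb{R}$, the Bourgain space norm associated with $P$ is $$\|u\|_{X^{s,b}}^2=\sum_{n\in\mathbb{Z}}\int_{\mathbb{R}}(1+|\lambda+P(n)|)^{2b}(1+|n|)^{2s}|\hat u(n,\lambda)|^2\,d\lambda.$$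 The norm $\|\cdot\|_{L^2_xL^2_t}$ is the $L^2$ norm in space and time.
   Formalization: The formal theorem additionally assumes b_N ≠ 0 (so P has degree exactly 2N+1), since the estimate is false when b_N = 0 (for instance when all b_k = 0); u and v are taken integrable so that their Fourier transforms are defined. *)

(* Defs.v *)
From HB Require Import structures.
From mathcomp Require Import all_boot all_order all_algebra.
From mathcomp Require Import all_classical all_reals all_analysis.
From mathcomp Require Import complex.

Set Implicit Arguments.
Unset Strict Implicit.
Unset Printing Implicit Defensive.

Import Order.TTheory GRing.Theory Num.Theory.
Import numFieldNormedType.Exports.

Local Open Scope classical_set_scope.
Local Open Scope ring_scope.

Section Defs.
Context {R : realType}.

Definition leb1 : {measure set (measurableTypeR R) -> \bar R} :=
  @lebesgue_measure R.

Definition leb2 : {measure set (measurableTypeR R * measurableTypeR R)%type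
    -> \bar R} :=
  (@lebesgue_measure R \x @lebesgue_measure R)%E.

(* The torus R/Z is represented by its fundamental domain [0, 1[. *)
Definition torus : set R := `[0, 1[.

(* A point (x, t) has the space variable x first. *)
Definition slab (T : R) : set (R * R) := torus `*` `[0, T].

(* A function on (R/Z) x [0, T] is a function of (x, t) that is 1-periodic in x;
   its values for t outside [0, T] are irrelevant.  Integrability is what makes
   the Fourier transform a convergent integral. *)
Definition torus_fun (T : R) (u : R * R -> R) : Prop :=
  (forall x t, t \in `[0, T] -> u (x + 1, t) = u (x, t)) /\
  leb2.-integrable (slab T) (EFin \o u).

Definition zero_ext (T : R) (u : R * R -> R) : R * R -> R :=
  fun z => if z.2 \in `[0, T] then u z else 0.

Definition expi (theta : R) : R[i] := Complex (cos theta) (sin theta).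

Definition cintegral (D : set (R * R)) (f : R * R -> R[i]) : R[i] :=
  Complex (Rintegral leb2 D (fun z => complex.Re (f z)))
          (Rintegral leb2 D (fun z => complex.Im (f z))).

(* Space-time Fourier transform of a function on (R/Z) x R. *)
Definition fourier (u : R * R -> R) (n : int) (lambda : R) : R[i] :=
  cintegral (torus `*` setT)
    (fun z => real_complex R (u z)
              * expi (- (2 * pi * (n%:~R * z.1 + lambda * z.2)))).

(* Bourgain norm, with values in [0, +oo]. *)
Definition Xnorm (P : {poly R}) (s b T : R) (u : R * R -> R) : \bar R :=
  ((\esum_(n in [set: int])
     \int[leb1]_(lambda in [set: R])
       ((1 + `|lambda + P.[n%:~R]|) `^ (2 * b)
        * (1 + `|n%:~R : R|) `^ (2 * s)
        * ComplexField.Normc.normc (fourier (zero_ext T u) n lambda) ^+ 2)%:E)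
   `^ 2^-1)%E.

Definition L2norm (T : R) (f : R * R -> R) : \bar R :=
  ('N[leb2]_2%:E[(EFin \o f) \_ (slab T)])%E.

Definition symb_coef (b : nat -> R) (k : nat) : R :=
  (-1) ^+ k * (2 * pi) ^+ (2 * k + 1) * b k.

Definition symbol (N : nat) (b : nat -> R) : {poly R} :=
  \sum_(1 <= k < N.+1) symb_coef b k *: 'X^(2 * k + 1).

End Defs.

(* Main.v *)
(** Both factors are controlled by one estimate, [\int u^4 <= C E(u)^2], where
    [E(u)] is the square of the Bourgain norm; the product follows from
    [u^2 v^2 <= p u^4 + q v^4].

    Write [theta = 1/(2N+1)] and [beta = (N+1)/(2N+1)], so that
    [1 - 2 beta = - theta].  For a trigonometric sum
    [S(x, t) = \sum_n U_n(t) e(n x)], [U_n(t) = \int a_n(l) e(l t) dl],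
    Parseval in [x] and a local Plancherel inequality in [t] bound the L^4 norm
    of [S] by the l^2 L^2 norm of [\sum_n f_n * f_(m-n)], [f_n = |a_n|].
    With the weights [w_n(l) = 1 + |l + P(n)|], split according to whether both
    weights are at most [|m|^(2N+1)] or not.  If they are, use Cauchy-Schwarz with
    [\sum_n w_n^(-beta) * w_(m-n)^(-beta)], which is at most
    [\sum_n (1 + |l + P(n) + P(m-n)|)^(-theta)].  Since all coefficients of [P]
    have the same sign, [P(n) + P(m-n)] is spread out: its values at [n], [n'] on
    the same side of [m/2] differ by at least [c |m| |n - n'|^(2N)].  When the
    larger weight [W] exceeds [|m|^(2N+1)], at most [O(W^theta)] values of [m]
    are possible, and integrating [w^(-beta)] over [w <= W] for the smaller
    weight costs [O(W^(1 - beta))], in total [O(W^beta)].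

    No Plancherel theorem is used to pass to a general [u]: the sums [S_j] with
    coefficients [Fejer_j(n) exp(- |l| / j) u^(n, l)] are the Fejer (in [x]) and
    Poisson (in [t]) means of [u].  They converge to [u] weakly on rays, hence
    on all measurable sets by Dynkin's lemma, and a uniform L^4 bound passes to
    weak limits by duality with simple functions. *)
From HB Require Import structures.
Require Import Defs.
From mathcomp Require Import all_boot all_order all_algebra.
From mathcomp Require Import all_classical all_reals all_analysis.
From mathcomp Require Import complex measurable_realfun zify ring lra.

Set Implicit Arguments.
Unset Strict Implicit.
Unset Printing Implicit Defensive.

Import Order.TTheory GRing.Theory Num.Theory.
Import numFieldNormedType.Exports.
Local Open Scope classical_set_scope.
Local Open Scope ring_scope.
Import ComplexField.Normc.

(** * Integrals on the line *)

(** The threshold [|m|^(2N+1)] and the exponent come from one balance. If both weights stay below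
    the threshold, the resonance function [x + P(n) + P(m-n)] is at most [2 |m|^(2N+1)] in modulus.
    By the gap, the admissible [n] on one side of [m/2] then lie at distance [j = O(|m|)] from one
    of them, and the sum of [(|m| j^(2N))^(-theta)] over such [j] is bounded because
    [(2N+1) theta = 1]. At [m = 0] there is no gap, but the threshold is then [0] while weights are
    at least [1], so this case is empty. In the other case the power [W^beta] is exactly the weight
    that the energy attaches to the factor carrying [W], so nothing is lost.

    The Fejer and Poisson multipliers lie in [[0, 1]], so they do not increase the energy; they also
    leave finitely many frequencies with exponentially decaying coefficients, which makes every
    exchange of integrals absolutely convergent.

    The estimate is stated in extended reals, so a factor of zero energy has to be treated apart: it
    must kill the product even when the other energy is infinite. *)

Section ge0_integral_combinations.
Context d (X : measurableType d) (R : realType) (nu : {measure set X -> \bar R}).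
Variables (D : set X) (mD : measurable D).
Implicit Types f g h : X -> R.

Lemma ge0_integral_comb (a c : R) g h : 0 <= a -> 0 <= c ->
  measurable_fun D g -> measurable_fun D h -> (forall x, 0 <= g x) -> (forall x, 0 <= h x) ->
  (\int[nu]_(x in D) (a * g x + c * h x)%:E =
   a%:E * \int[nu]_(x in D) (g x)%:E + c%:E * \int[nu]_(x in D) (h x)%:E)%E.
Proof.
move=> a0 c0 mg mh g0 h0.
have Z k f : 0 <= k -> measurable_fun D f -> (forall x, 0 <= f x) ->
    (\int[nu]_(x in D) (k * f x)%:E = k%:E * \int[nu]_(x in D) (f x)%:E)%E.
  move=> k0 mf f0; rewrite -ge0_integralZl//; first exact/measurable_EFinP.
  by move=> x _; rewrite lee_fin.
rewrite -(Z a)// -(Z c)// -ge0_integralD//.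
- by move=> x _; rewrite lee_fin mulr_ge0.
- by apply/measurable_EFinP; exact: measurable_funM.
- by move=> x _; rewrite lee_fin mulr_ge0.
- by apply/measurable_EFinP; exact: measurable_funM.
Qed.

(** Carries a pointwise arithmetic-geometric mean inequality under the integral. Only nonnegativity
    is asked, so the integrals may be infinite. *)
Lemma ge0_integral_le_comb (k a c : R) f g h : 0 <= k -> 0 <= a -> 0 <= c ->
  measurable_fun D f -> measurable_fun D g -> measurable_fun D h ->
  (forall x, 0 <= f x) -> (forall x, 0 <= g x) -> (forall x, 0 <= h x) ->
  (forall x, k * f x <= a * g x + c * h x) ->
  (k%:E * \int[nu]_(x in D) (f x)%:E <=
   a%:E * \int[nu]_(x in D) (g x)%:E + c%:E * \int[nu]_(x in D) (h x)%:E)%E.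
Proof.
move=> k0 a0 c0 mf mg mh f0 g0 h0 H; rewrite -ge0_integral_comb// -ge0_integralZl//; last 2 first.
- exact/measurable_EFinP.
- by move=> x _; rewrite lee_fin.
apply: ge0_le_integral => //.
- by move=> x _; rewrite -EFinM lee_fin mulr_ge0.
- by apply/measurable_EFinP; exact: measurable_funM.
- by apply/measurable_EFinP; apply: measurable_funD; exact: measurable_funM.
- by move=> x _; rewrite -EFinM lee_fin.
Qed.

Lemma ge0_integral_leD f g h :
  measurable_fun D f -> measurable_fun D g -> measurable_fun D h ->
  (forall x, 0 <= f x) -> (forall x, 0 <= g x) -> (forall x, 0 <= h x) ->
  (forall x, f x <= g x + h x) ->
  (\int[nu]_(x in D) (f x)%:E <=
   \int[nu]_(x in D) (g x)%:E + \int[nu]_(x in D) (h x)%:E)%E.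
Proof.
move=> mf mg mh f0 g0 h0 H.
rewrite -[leLHS]mul1e -[X in (_ <= X + _)%E]mul1e -[X in (_ <= _ + X)%E]mul1e.
by apply: ge0_integral_le_comb => // x; rewrite !mul1r.
Qed.

End ge0_integral_combinations.

(** * Reflections and translations of Lebesgue measure *)

Section lebesgue_invariance.
Context {R : realType}.
Local Notation mu := (@lebesgue_measure R).
Local Open Scope ereal_scope.

Lemma measurable_subr (c : R) : measurable_fun [set: R] (fun x : R => c - x)%R.
Proof. exact: (@measurable_funB _ _ _ _ (cst c) id). Qed.

(** By uniqueness of Lebesgue measure it suffices to test intervals []a, b]]. The preimage has its
    closed end on the other side, which does not affect the length. *)
Lemma lebesgue_measureB (c : R) (A : set R) : measurable A ->
  pushforward mu ((fun x => c - x)%R : _ -> measurableTypeR R) A = mu A.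
Proof.
move=> mA; apply/esym/lebesgue_measure_unique => //=; first exact: measurable_subr.
move=> mf _ [[a b]] _ <-; rewrite /pushforward.
have -> : (fun x : R => (c - x)%R) @^-1` `]a, b] = `[(c - b)%R, (c - a)%R[%classic.
  by apply/seteqP; split => x /=; rewrite !in_itv/= => /andP[? ?]; apply/andP; split; lra.
rewrite !lebesgue_measure_itv/= !lte_fin.
have -> : (c - b < c - a)%R = (a < b)%R by apply/idP/idP; lra.
by case: ifPn => // _; rewrite -!EFinD; congr EFin; lra.
Qed.

Lemma ge0_integral_subr (c : R) (f : R -> \bar R) :
  measurable_fun [set: R] f -> (forall x, 0 <= f x) ->
  \int[mu]_x f (c - x)%R = \int[mu]_x f x.
Proof.
move=> mf f0; transitivity (\int[pushforward mu ((fun x => c - x)%R : _ -> measurableTypeR R)]_x f x).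
  by rewrite ge0_integral_pushforward//=; exact: measurable_subr.
apply: eq_measure_integral => [|mf0 A mA _]; first exact: measurable_subr.
exact: lebesgue_measureB.
Qed.

(** A translation is the composition of the two reflections [x -> - x] and [x -> c - x]. *)
Lemma ge0_integral_addr (c : R) (f : R -> \bar R) :
  measurable_fun [set: R] f -> (forall x, 0 <= f x) ->
  \int[mu]_x f (x + c)%R = \int[mu]_x f x.
Proof.
move=> mf f0; rewrite -[RHS](ge0_integral_subr c)//.
rewrite -[LHS](ge0_integral_subr 0)//; last first.
  by apply: measurableT_comp => //; exact: measurable_funD.
by apply: eq_integral => x _; congr f; lra.
Qed.

Lemma integral_subr (c : R) (f : R -> \bar R) :
  measurable_fun [set: R] f ->
  \int[mu]_x f (c - x)%R = \int[mu]_x f x.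
Proof.
move=> mf; rewrite integralE [RHS]integralE.
rewrite -(ge0_integral_subr c (measurable_funepos mf))//.
rewrite -(ge0_integral_subr c (measurable_funeneg mf))//.
by congr (_ - _); apply: eq_integral => x _; rewrite ?(funeposE, funenegE).
Qed.

Lemma integral_addr (c : R) (f : R -> \bar R) :
  measurable_fun [set: R] f ->
  \int[mu]_x f (x + c)%R = \int[mu]_x f x.
Proof.
move=> mf; rewrite integralE [RHS]integralE.
rewrite -(ge0_integral_addr c (measurable_funepos mf))//.
rewrite -(ge0_integral_addr c (measurable_funeneg mf))//.
by congr (_ - _); apply: eq_integral => x _; rewrite ?(funeposE, funenegE).
Qed.

Lemma ge0_integral_halves (f : R -> \bar R) :
  measurable_fun [set: R] f -> (forall x, 0 <= f x) ->
  \int[mu]_x f x = \int[mu]_(x in `[0%R, +oo[) (f x + f (- x)%R).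
Proof.
move=> mf f0.
have mfN : measurable_fun [set: R] (fun x => f (- x)%R).
  by apply: measurableT_comp.
have mS (D : set R) (g : R -> \bar R) : measurable_fun [set: R] g -> measurable_fun D g.
  by move=> mg; apply: measurable_funTS.
rewrite ge0_integralD//; [|exact: mS|exact: mS].
rewrite [X in _ + X]ge0_integration_by_substitution0//.
under [X in _ + X]eq_integral do rewrite opprK.
rewrite -[in LHS]setC0 -(set_itvoc0 0%R) setCitv/=.
rewrite ge0_integral_setU//=; first last.
- rewrite disj_set2E; apply/eqP; rewrite -subset0 => x []/= /[!in_itv]/=.
  by rewrite leNgt andbT => /negP x0 /x0.
- exact: mS.
rewrite addeC; congr (_ + _).
by rewrite integral_itv_obnd_cbnd//; exact: mS.
Qed.

End lebesgue_invariance.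

Section ftc_pointwise.
Context {R : realType}.
Local Notation mu := (@lebesgue_measure R).
Implicit Types f F : R -> R.

Lemma integral_itv_is_derive f F (a b : R) : a <= b ->
  (forall x, a <= x -> is_derive x 1 F (f x)) ->
  (forall x, a <= x -> {for x, continuous f}) ->
  (\int[mu]_(x in `[a, b]) (f x)%:E = (F b - F a)%:E)%E.
Proof.
rewrite le_eqVlt => /predU1P[<- _ _|ab dF cf].
  by rewrite set_itv1 integral_set1 subrr.
have cF x : a <= x -> {for x, continuous F}.
  by move=> ax; apply/differentiable_continuous/derivable1_diffP; have [] := dF _ ax.
rewrite (@continuous_FTC2 _ f F)//.
- apply/continuous_within_itvP => //; split.
  + by move=> x; rewrite in_itv/= => /andP[/ltW ax _]; exact: cf.
  + by apply: cvg_at_right_filter; exact: cf.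
  + by apply: cvg_at_left_filter; exact/cf/ltW.
- split.
  + by move=> x; rewrite in_itv/= => /andP[/ltW ax _]; have [] := dF _ ax.
  + by apply: cvg_at_right_filter; exact: cF.
  + by apply: cvg_at_left_filter; exact/cF/ltW.
- move=> x; rewrite in_itv/= => /andP[/ltW ax _].
  by have dFx := dF _ ax; rewrite derive1E; exact: derive_val.
Qed.

Lemma integral_itvy_is_derive f F (a l : R) :
  (forall x, a <= x -> 0 <= f x) ->
  (forall x, a <= x -> is_derive x 1 F (f x)) ->
  (forall x, a <= x -> {for x, continuous f}) ->
  F x @[x --> +oo] --> l ->
  (\int[mu]_(x in `[a, +oo[) (f x)%:E = (l - F a)%:E)%E.
Proof.
move=> f0 dF cf Fl.
have cF x : a <= x -> {for x, continuous F}.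
  by move=> ax; apply/differentiable_continuous/derivable1_diffP; have [] := dF _ ax.
rewrite (@ge0_continuous_FTC2y _ f F a l)//.
- apply/continuous_within_itvcyP; split.
  + by move=> x; rewrite in_itv/= andbT => /ltW ax; exact: cf.
  + by apply: cvg_at_right_filter; exact: cf.
- by move=> x /ltW ax; have [] := dF _ ax.
- by apply: cvg_at_right_filter; exact: cF.
- move=> x; rewrite in_itv/= andbT => /ltW ax.
  by have dFx := dF _ ax; rewrite derive1E; exact: derive_val.
Qed.

Lemma cvgy_powRN (r : R) : 0 < r -> (1 + x) `^ (- r) @[x --> +oo] --> (0 : R).
Proof.
move=> r0; apply/cvgrPdist_le => /= e e0.
near=> x; rewrite sub0r normrN ger0_norm ?powR_ge0//.
have x1 : (e^-1) `^ r^-1 <= 1 + x.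
  by apply: (@le_trans _ _ x); [near: x; exact: nbhs_pinfty_ge|lra].
rewrite powRN -[leRHS]invrK lef_pV2 ?posrE ?invr_gt0//; last first.
  by rewrite powR_gt0// (lt_le_trans _ x1)// powR_gt0// invr_gt0.
rewrite -[leLHS]powRr1 ?invr_ge0 ?(ltW e0)// -[X in _ `^ X](@mulVf _ r) ?gt_eqF//.
rewrite powRrM ge0_ler_powR// ?ltW// ?nnegrE ?powR_ge0//.
by rewrite (le_trans _ x1)// powR_ge0.
Unshelve. all: by end_near. Qed.

Lemma is_derive_powR1D (p x : R) : 0 <= x ->
  is_derive x 1 (fun y => (1 + y) `^ p) (p * (1 + x) `^ (p - 1)).
Proof.
move=> x0.
have d1 : is_derive x 1 (fun y : R => 1 + y) 1.
  by rewrite -[X in is_derive _ _ _ X]add0r; apply: is_deriveD.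
rewrite -[X in is_derive _ _ _ X]mulr1.
have x1 : 0 < 1 + x by lra.
have := is_derive1_comp (@is_derive1_powR R p (1 + x) x1) d1.
exact.
Qed.

Lemma continuous_powR1D (p x : R) : 0 <= x ->
  {for x, continuous (fun y : R => (1 + y) `^ p)}.
Proof.
move=> x0; apply/differentiable_continuous/derivable1_diffP.
by have [] := is_derive_powR1D p x0.
Qed.

Lemma continuous_cstM (c : R) f x : {for x, continuous f} ->
  {for x, continuous (fun y => c * f y)}.
Proof. by move=> cf; apply: cvgM => //; exact: cvg_cst. Qed.

End ftc_pointwise.

Section measurable_combinators.
Context d (T : measurableType d) (R : realType).

Lemma measurable_fun_powR (f : T -> R) (p : R) :
  measurable_fun [set: T] f -> measurable_fun [set: T] (fun x => f x `^ p).
Proof. exact: (measurableT_comp (measurable_powR p)). Qed.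

Lemma measurable_natr_bool (b : T -> bool) :
  measurable_fun [set: T] b -> measurable_fun [set: T] (fun x => (b x)%:R : R).
Proof.
move=> mb.
have -> : (fun x => (b x)%:R) = (fun x => if b x then (1 : R) else 0).
  by apply/funext => x; case: (b x).
exact: measurable_fun_ifT.
Qed.

End measurable_combinators.

(** * Integrals and convolutions of power weights *)

Section power_weights.
Context {R : realType}.
Local Notation mu := (@lebesgue_measure R).

Lemma measurable_1Dnorm_powR (p : R) :
  measurable_fun [set: R] (fun x : R => (1 + `|x|) `^ p).
Proof. by apply: measurable_fun_powR; exact: measurable_funD. Qed.

Lemma integral_weight_le (b M : R) : b < 1 -> 1 <= M ->
  (\int[mu]_x ((1 + `|x| <= M)%R%:R * (1 + `|x|) `^ (- b))%:E
   <= (2 / (1 - b) * M `^ (1 - b))%:E)%E.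
Proof.
move=> b1 M1; have b0 : 0 < 1 - b by lra.
have mw : measurable_fun [set: R] (fun x : R => (1 + `|x| <= M)%R%:R * (1 + `|x|) `^ (- b) : R).
  apply: measurable_funM; last exact: measurable_1Dnorm_powR.
  apply: measurable_natr_bool; apply: measurable_fun_ler => //; exact: measurable_funD.
rewrite ge0_integral_halves; last 2 first.
- exact/measurable_EFinP.
- by move=> x; rewrite lee_fin mulr_ge0 ?powR_ge0.
pose f (x : R) := 2 * (1 + x) `^ (- b).
pose F (x : R) := 2 / (1 - b) * (1 + x) `^ (1 - b).
have -> : (\int[mu]_(x in `[0%R, +oo[) (((1 + `|x| <= M)%R%:R * (1 + `|x|) `^ (- b))%:E +
    ((1 + `|- x| <= M)%R%:R * (1 + `|- x|) `^ (- b))%:E))%E =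
   (\int[mu]_(x in `[0%R, (M - 1)%R]) (f x)%:E)%E.
  rewrite [LHS]integral_mkcond [RHS]integral_mkcond; apply: eq_integral => x _.
  rewrite !patchE; case: ifPn; case: ifPn; rewrite ?notin_setE ?inE/= ?in_itv/= ?andbT.
  - move=> /andP[x0 xM] _; rewrite normrN ger0_norm// -EFinD; congr EFin.
    have -> : (1 + x <= M) by lra.
    have -> : true%:R = 1 :> R by [].
    by rewrite /f !mul1r; lra.
  - move=> xM x0; rewrite normrN ger0_norm// -EFinD; congr EFin.
    have -> : (1 + x <= M) = false by apply/negP => ?; apply: xM; rewrite x0/=; lra.
    by rewrite !mul0r addr0.
  - by move=> /andP[-> ].
  - by [].
have dF (x : R) : 0 <= x -> is_derive x 1 F (f x).
  move=> x0; rewrite /f /F.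
  have -> : 2 * (1 + x) `^ (- b) = (2 / (1 - b)) *: ((1 - b) * (1 + x) `^ (1 - b - 1)).
    have -> : 1 - b - 1 = - b by lra.
    rewrite /GRing.scale/=; field; lra.
  by apply: is_deriveZ; exact: is_derive_powR1D.
have cf (x : R) : 0 <= x -> {for x, continuous f}.
  by move=> x0; apply: continuous_cstM; exact: continuous_powR1D.
rewrite (integral_itv_is_derive _ dF cf); last by lra.
rewrite lee_fin /F addr0 powR1 addrCA subrr addr0.
by rewrite lerBlDr lerDl mulr_ge0// divr_ge0// ltW.
Qed.

Lemma integral_weight_gt (b M : R) : 1 < b -> 1 <= M ->
  (\int[mu]_x ((M < 1 + `|x|)%R%:R * (1 + `|x|) `^ (- b))%:E
   <= (2 / (b - 1) * M `^ (1 - b))%:E)%E.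
Proof.
move=> b1 M1; have b0 : 0 < b - 1 by lra.
have mw : measurable_fun [set: R] (fun x : R => (M < 1 + `|x|)%R%:R * (1 + `|x|) `^ (- b) : R).
  apply: measurable_funM; last exact: measurable_1Dnorm_powR.
  apply: measurable_natr_bool; apply: measurable_fun_ltr => //; exact: measurable_funD.
rewrite ge0_integral_halves; last 2 first.
- exact/measurable_EFinP.
- by move=> x; rewrite lee_fin mulr_ge0 ?powR_ge0.
pose f (x : R) := 2 * (1 + x) `^ (- b).
pose F (x : R) := 2 / (1 - b) * (1 + x) `^ (1 - b).
have f0 x : 0 <= f x by rewrite mulr_ge0 ?powR_ge0.
apply: (@le_trans _ _ (\int[mu]_(x in `[(M - 1)%R, +oo[) (f x)%:E)%E).
  rewrite [leLHS]integral_mkcond [leRHS]integral_mkcond.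
  apply: ge0_le_integral => //.
  + move=> x _; rewrite !patchE; case: ifPn => // _.
    by rewrite -EFinD lee_fin addr_ge0// mulr_ge0 ?powR_ge0.
  + apply/measurable_restrict => //; apply: measurable_funTS.
    apply: emeasurable_funD; first exact/measurable_EFinP.
    apply/measurable_EFinP; apply: (measurableT_comp mw); exact: oppr_measurable.
  + apply/measurable_restrict => //; apply/measurable_EFinP/measurable_funTS.
    apply: measurable_funM => //; apply: measurable_fun_powR.
    exact: measurable_funD.
  + move=> x _; rewrite !patchE; case: ifPn; case: ifPn; rewrite ?notin_setE ?inE/= ?in_itv/= ?andbT.
    * move=> Mx x0; rewrite normrN ger0_norm// -EFinD lee_fin /f.
      rewrite -mulr2n -[leLHS]mulr_natl ler_pM2l//.
      by case: (M < 1 + x); rewrite ?mul1r// mul0r powR_ge0.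
    * move=> xM x0; rewrite normrN ger0_norm// -EFinD lee_fin.
      have -> : (M < 1 + x) = false by apply/negP => ?; apply: xM; lra.
      by rewrite !mul0r addr0.
    * by rewrite lee_fin.
    * by [].
have dF x : M - 1 <= x -> is_derive x 1 F (f x).
  move=> x0; rewrite /f /F.
  have -> : 2 * (1 + x) `^ (- b) = (2 / (1 - b)) *: ((1 - b) * (1 + x) `^ (1 - b - 1)).
    have -> : 1 - b - 1 = - b by lra.
    rewrite /GRing.scale/=; field; lra.
  by apply: is_deriveZ; apply: is_derive_powR1D; lra.
have cf x : M - 1 <= x -> {for x, continuous f}.
  by move=> x0; apply: continuous_cstM; apply: continuous_powR1D; lra.
have Fl : F x @[x --> +oo] --> 0.
  rewrite /F -[X in _ --> X](mulr0 (2 / (1 - b))); apply: cvgM; first exact: cvg_cst.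
  rewrite -(opprB b 1); exact: cvgy_powRN.
rewrite (integral_itvy_is_derive (fun x _ => f0 x) dF cf Fl).
rewrite lee_fin /F addrCA subrr addr0 sub0r -mulNr -mulrN -invrN opprB.
exact: lexx.
Qed.

Lemma ler_powRN (a c b : R) : 0 <= b -> 0 < a -> a <= c -> c `^ (- b) <= a `^ (- b).
Proof.
move=> b0 a0 ac; have c0 : 0 < c by exact: lt_le_trans ac.
by rewrite !powRN lef_pV2 ?posrE ?powR_gt0// ge0_ler_powR// nnegrE ltW.
Qed.

(** The outer factor 2 counts the two halves, by which of the weights is smaller. Inside, the first
    term comes from the smaller weight being at most [1 + |t|] ([integral_weight_le]), the second
    from the tail ([integral_weight_gt] at exponent [2 * b]). *)
Definition conv_const (b : R) : R := 2 * (2 `^ b * (2 / (1 - b)) + 2 / (2 * b - 1)).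

(* The integrand is split according to which of [|x|], [|t - x|] is smaller; the
   larger one is at least [|t| / 2]. *)
Lemma integral_weight_conv (b t : R) : 2^-1 < b -> b < 1 ->
  (\int[mu]_x ((1 + `|x|) `^ (- b) * (1 + `|t - x|) `^ (- b))%:E
   <= (conv_const b * (1 + `|t|) `^ (1 - 2 * b))%:E)%E.
Proof.
move=> b12 b1; set M := 1 + `|t|.
have M1 : 1 <= M by rewrite lerDl.
(* Where the smaller weight is at most [M], the larger one is pulled out as the constant
   [(M / 2) ^ (- b)]. Beyond [M] the larger weight is replaced by the smaller one, which doubles the
   exponent and makes the tail integrable since [2 * b > 1]. *)
pose k1 (x : R) := (1 + `|x| <= M)%R%:R * (1 + `|x|) `^ (- b).
pose k2 (x : R) := (M < 1 + `|x|)%R%:R * (1 + `|x|) `^ (- (2 * b)).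
pose k x := (2 `^ b * M `^ (- b)) * k1 x + k2 x.
have k10 x : 0 <= k1 x by rewrite mulr_ge0 ?powR_ge0.
have k20 x : 0 <= k2 x by rewrite mulr_ge0 ?powR_ge0.
have c0 : 0 <= 2 `^ b * M `^ (- b) by rewrite mulr_ge0 ?powR_ge0.
have k0 x : 0 <= k x by rewrite addr_ge0 ?mulr_ge0 ?powR_ge0.
have mk1 : measurable_fun [set: R] k1.
  apply: measurable_funM; last exact: measurable_1Dnorm_powR.
  by apply: measurable_natr_bool; apply: measurable_fun_ler => //; exact: measurable_funD.
have mk2 : measurable_fun [set: R] k2.
  apply: measurable_funM; last exact: measurable_1Dnorm_powR.
  by apply: measurable_natr_bool; apply: measurable_fun_ltr => //; exact: measurable_funD.
have mck1 : measurable_fun [set: R] (fun x => (2 `^ b * M `^ (- b)) * k1 x).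
  exact: measurable_funM.
have mk : measurable_fun [set: R] k by exact: measurable_funD.
have kle (x y : R) : y = t - x -> `|x| <= `|y| ->
    (1 + `|x|) `^ (- b) * (1 + `|y|) `^ (- b) <= k x.
  move=> yE xy; rewrite /k /k1 /k2.
  have x0 : 0 < 1 + `|x| by rewrite ltr_pwDl.
  have Mxy : M <= (1 + `|x|) + (1 + `|y|).
    have : `|t| <= `|x| + `|y| by rewrite yE; apply: le_trans (ler_normD _ _); rewrite addrC subrK.
    by rewrite /M; lra.
  have [xM|xM] := leP (1 + `|x|) M.
    rewrite mul1r mul0r addr0 mulrC ler_wpM2r ?powR_ge0//.
    have -> : 2 `^ b * M `^ (- b) = (M / 2) `^ (- b).
      rewrite powRM ?invr_ge0//; last by lra.
      by rewrite mulrC -[in RHS]powR_inv1// -powRrM mulN1r opprK.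
    by apply: ler_powRN; lra.
  rewrite mul0r mulr0 add0r mul1r.
  have -> : - (2 * b) = - b + - b by lra.
  rewrite powRD; last by apply/implyP => _; rewrite gt_eqF.
  by rewrite ler_wpM2l ?powR_ge0//; apply: ler_powRN; lra.
have mkt : measurable_fun [set: R] (fun x => k (t - x)).
  by apply: (measurableT_comp mk); exact: measurable_subr.
pose K x := (1 + `|x|) `^ (- b) * (1 + `|t - x|) `^ (- b).
have K0 x : 0 <= K x by rewrite mulr_ge0 ?powR_ge0.
have mK : measurable_fun [set: R] K.
  apply: measurable_funM; first exact: measurable_1Dnorm_powR.
  apply: measurable_fun_powR; apply: measurable_funD => //.
  by apply: measurableT_comp => //; exact: measurable_subr.
have Kk x : K x <= k x + k (t - x).
  rewrite /K; have [xy|/ltW xy] := leP `|x| `|t - x|.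
    by apply: (le_trans (kle _ _ erefl xy)); rewrite lerDl.
  rewrite mulrC; apply: (le_trans (kle _ _ _ xy)); first by lra.
  by rewrite lerDr.
apply: (le_trans (ge0_integral_leD mu measurableT mK mk mkt K0 k0 (fun x => k0 _) Kk)).
have Ik : (\int[mu]_x (k x)%:E <=
    ((2 `^ b * (2 / (1 - b)) + 2 / (2 * b - 1)) * M `^ (1 - 2 * b))%:E)%E.
  under eq_integral do rewrite /k -[k2 _]mul1r.
  rewrite ge0_integral_comb// mul1e.
  rewrite mulrDl EFinD; apply: leeD.
    have -> : 2 `^ b * (2 / (1 - b)) * M `^ (1 - 2 * b) =
        2 `^ b * M `^ (- b) * (2 / (1 - b) * M `^ (1 - b)).
      have -> : 1 - 2 * b = - b + (1 - b) by lra.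
      rewrite powRD; first by ring.
      by apply/implyP => _; rewrite gt_eqF// (lt_le_trans _ M1).
    rewrite [leRHS]EFinM; apply: lee_wpmul2l; first by rewrite lee_fin.
    exact: integral_weight_le.
  by apply: integral_weight_gt => //; lra.
rewrite (ge0_integral_subr t (f := EFin \o k))//; last exact/measurable_EFinP.
apply: (le_trans (leeD Ik Ik)); rewrite -EFinD lee_fin /conv_const.
by rewrite -mulrA; set z := (_ + _) * _; lra.
Qed.

End power_weights.

(** * The Fourier transform of a two-sided exponential *)

Section poisson.
Context {R : realType}.
Local Notation mu := (@lebesgue_measure R).

(* [expR (- (c * x)) * cos (w * x)] changes sign; adding [expR (- (c * x))]
   makes the fundamental theorem for nonnegative integrands applicable. *)
Lemma integral_exp_1Dcos (c w : R) : 0 < c ->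
  (\int[mu]_(x in `[0%R, +oo[) (expR (- (c * x)) * (1 + cos (w * x)))%:E
   = (c^-1 + c / (c ^+ 2 + w ^+ 2))%:E)%E.
Proof.
move=> c0; have cw : c ^+ 2 + w ^+ 2 != 0.
  by rewrite gt_eqF// ltr_pwDl ?exprn_gt0 ?sqr_ge0.
(* The oscillating part is the real part of [exp((- c + i w) x) / (- c + i w)]; the term [- c^-1]
   integrates the added exponential. *)
pose F (x : R) := expR (- (c * x)) *
  (- c^-1 + (w * sin (w * x) - c * cos (w * x)) / (c ^+ 2 + w ^+ 2)).
pose f (x : R) := expR (- (c * x)) * (1 + cos (w * x)).
have dF (x : R) : 0 <= x -> is_derive x 1 F (f x).
  move=> _; apply: is_derive_eq.
  rewrite /f /GRing.scale/=; field; rewrite cw gt_eqF//.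
have cf (x : R) : 0 <= x -> {for x, continuous f}.
  move=> _; apply: cvgM.
    apply: continuous_comp; last exact: continuous_expR.
    by apply: cvgN; apply: cvgM => //; exact: cvg_cst.
  apply: cvgD; first exact: cvg_cst.
  apply: continuous_comp; last exact: continuous_cos.
  by apply: cvgM => //; exact: cvg_cst.
have f0 (x : R) : 0 <= x -> 0 <= f x.
  by move=> _; rewrite mulr_ge0 ?expR_ge0//; have := cos_geN1 (w * x); lra.
have Fl : F x @[x --> +oo] --> (0 : R).
  pose B := c^-1 + (`|w| + c) / (c ^+ 2 + w ^+ 2).
  have FB x : `|F x| <= expR (- (c * x)) * B.
    rewrite normrM ger0_norm ?expR_ge0// ler_wpM2l ?expR_ge0//.
    apply: (le_trans (ler_normD _ _)); rewrite normrN ger0_norm ?invr_ge0; last exact: ltW.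
    rewrite lerD2l normrM normfV [X in _ / X]ger0_norm; last first.
      by rewrite addr_ge0 ?sqr_ge0.
    rewrite ler_wpM2r ?invr_ge0 ?addr_ge0 ?sqr_ge0//.
    apply: (le_trans (ler_normB _ _)); rewrite !normrM (ger0_norm (ltW c0)).
    have c0' := ltW c0; apply: lerD; rewrite ler_piMr ?normr_ge0//.
      by rewrite ler_norml sin_geN1 sin_le1.
    by rewrite ler_norml cos_geN1 cos_le1.
  have eB : expR (- (c * x)) * B @[x --> +oo] --> (0 : R).
    rewrite -[X in _ --> X](mul0r B); apply: cvgM; last exact: cvg_cst.
    have cy : c * x @[x --> +oo] --> +oo by apply: gt0_cvgMry => //; exact: cvg_cst.
    exact: (cvg_comp _ _ cy (@cvgr_expR R)).
  apply: norm_cvg0; apply: (squeeze_cvgr _ (cvg_cst 0) eB).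
  by apply: nearW => x; rewrite normr_ge0 FB.
rewrite (integral_itvy_is_derive f0 dF cf Fl) /F.
rewrite !mulr0 oppr0 expR0 sin0 cos0; congr EFin; field; rewrite cw gt_eqF//.
Qed.

(** The case [w = 0] of the previous formula, where the integrand is twice the exponential. *)
Lemma integral_exp_half (c : R) : 0 < c ->
  (\int[mu]_(x in `[0%R, +oo[) (expR (- (c * x)))%:E = (c^-1)%:E)%E.
Proof.
move=> c0; have := integral_exp_1Dcos 0 c0.
under eq_integral do rewrite mul0r cos0 -[1 + 1]/2%:R mulrC EFinM.
rewrite ge0_integralZl//; last first.
  apply/measurable_EFinP/measurable_funTS/measurableT_comp => //.
  by apply: measurableT_comp => //; exact: measurable_funM.
set I := (\int[mu]_(x in _) _)%E => H.
have -> : I = (2^-1%:E * (2%:E * I))%E by rewrite muleA -EFinM mulVf// mul1e.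
by rewrite H -EFinM; congr EFin; field; rewrite gt_eqF.
Qed.

Definition exp_abs (c x : R) : R := expR (- (c * `|x|)).

Lemma exp_abs_ge0 (c x : R) : 0 <= exp_abs c x. Proof. exact: expR_ge0. Qed.

Lemma measurable_exp_abs (c : R) : measurable_fun [set: R] (exp_abs c).
Proof.
apply: (measurableT_comp (@measurable_expR R)).
by apply: measurableT_comp => //; exact: measurable_funM.
Qed.

Lemma measurable_cosM (w : R) : measurable_fun [set: R] (fun x => cos (w * x)).
Proof.
apply: (measurableT_comp (continuous_measurable_fun (@continuous_cos R))).
exact: measurable_funM.
Qed.

Lemma ge0_integral_even (f : R -> R) : measurable_fun [set: R] f ->
  (forall x, 0 <= f x) -> (forall x, f (- x) = f x) ->
  (\int[mu]_x (f x)%:E = 2%:E * \int[mu]_(x in `[0%R, +oo[) (f x)%:E)%E.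
Proof.
move=> mf f0 fN; rewrite ge0_integral_halves; last 2 first.
- exact/measurable_EFinP.
- by move=> x; rewrite lee_fin.
rewrite -ge0_integralZl//; last 2 first.
- exact/measurable_EFinP/measurable_funTS.
- by move=> x _; rewrite lee_fin.
by apply: eq_integral => x _; rewrite fN -EFinD -EFinM; congr EFin; lra.
Qed.

Lemma integral_exp_abs (c : R) : 0 < c -> (\int[mu]_x (exp_abs c x)%:E = (2 / c)%:E)%E.
Proof.
move=> c0; rewrite ge0_integral_even.
- rewrite EFinM -(integral_exp_half c0); apply: (congr1 (mule 2%:E)).
  apply: eq_integral => x; rewrite inE/= in_itv/= andbT => x0.
  by rewrite /exp_abs ger0_norm.
- exact: measurable_exp_abs.
- exact: exp_abs_ge0.
- by move=> x; rewrite /exp_abs normrN.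
Qed.

Lemma integrable_exp_abs (c : R) : 0 < c -> mu.-integrable [set: R] (EFin \o exp_abs c).
Proof.
move=> c0; apply/integrableP; split; first by apply/measurable_EFinP; exact: measurable_exp_abs.
under eq_integral do rewrite /= ger0_norm ?exp_abs_ge0//.
by rewrite integral_exp_abs// ltry.
Qed.

(** The integral against [1 + cos] is known by evenness from the half line; subtracting the integral
    of [exp_abs c] leaves the cosine transform, a multiple of the Poisson kernel. *)
Lemma integral_exp_cos (c w : R) : 0 < c ->
  (\int[mu]_x (exp_abs c x * cos (w * x))%:E
   = (2 * (c / (c ^+ 2 + w ^+ 2)))%:E)%E.
Proof.
move=> c0.
pose g x := exp_abs c x * (1 + cos (w * x)).
have mg : measurable_fun [set: R] g.
  apply: measurable_funM; first exact: measurable_exp_abs.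
  by apply: measurable_funD => //; exact: measurable_cosM.
have g0 x : 0 <= g x.
  by rewrite mulr_ge0 ?exp_abs_ge0//; have := cos_geN1 (w * x); lra.
have Ig : (\int[mu]_x (g x)%:E = (2 * (c^-1 + c / (c ^+ 2 + w ^+ 2)))%:E)%E.
  rewrite ge0_integral_even//.
    rewrite EFinM -(integral_exp_1Dcos w c0); apply: (congr1 (mule 2%:E)).
    apply: eq_integral => x; rewrite inE/= in_itv/= andbT => x0.
    by rewrite /g /exp_abs ger0_norm.
  by move=> x; rewrite /g /exp_abs normrN mulrN cosN.
have ig : mu.-integrable [set: R] (EFin \o g).
  apply/integrableP; split; first exact/measurable_EFinP.
  under eq_integral do rewrite /= ger0_norm//.
  by rewrite Ig ltry.
transitivity (\int[mu]_x ((EFin \o g) x - (EFin \o exp_abs c) x))%E.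
  by apply: eq_integral => x _; rewrite /g -EFinB; congr EFin; ring.
rewrite integralB//; last exact: integrable_exp_abs.
by rewrite Ig integral_exp_abs// -EFinB; congr EFin; ring.
Qed.

End poisson.

(** * The resonance gap of the symbol *)

Section symmetric_powers.
Context {R : realFieldType}.
Implicit Types (h y z : R) (k : nat).

(** With [h = m / 2] and [y = n - m / 2] this is [n^(2k+1) + (m - n)^(2k+1)], the degree [2k+1] part
    of the resonance function. The companion difference is needed because the two recurrences in [k]
    are coupled. *)
Definition odd_powers_sum k h y : R := (h + y) ^+ (2 * k + 1) + (h - y) ^+ (2 * k + 1).
Definition odd_powers_diff k h y : R := (h + y) ^+ (2 * k + 1) - (h - y) ^+ (2 * k + 1).

(** Raising [k] multiplies the two powers by [(h + y)^2] and [(h - y)^2], that is by [h^2 + y^2]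
    plus or minus [2 h y]. *)
Lemma odd_powers_sumS k h y : odd_powers_sum k.+1 h y =
  (h ^+ 2 + y ^+ 2) * odd_powers_sum k h y + 2 * h * y * odd_powers_diff k h y.
Proof.
rewrite /odd_powers_sum /odd_powers_diff; have -> : (2 * k.+1 + 1 = (2 * k + 1).+2)%N by lia.
by rewrite !exprS; ring.
Qed.

Lemma odd_powers_diffS k h y : odd_powers_diff k.+1 h y =
  (h ^+ 2 + y ^+ 2) * odd_powers_diff k h y + 2 * h * y * odd_powers_sum k h y.
Proof.
rewrite /odd_powers_sum /odd_powers_diff; have -> : (2 * k.+1 + 1 = (2 * k + 1).+2)%N by lia.
by rewrite !exprS; ring.
Qed.

(** Joint induction: the coefficients of both recurrences are nonnegative and nondecreasing in [y],
    so sign and monotonicity propagate together. *)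
Lemma odd_powers_mono k h y z : 0 <= h -> 0 <= y -> y <= z ->
  [/\ 0 <= odd_powers_sum k h y, odd_powers_sum k h y <= odd_powers_sum k h z,
      0 <= odd_powers_diff k h y & odd_powers_diff k h y <= odd_powers_diff k h z].
Proof.
move=> h0 y0 yz; elim: k => [|k [e0 e1 o0 o1]].
  by rewrite /odd_powers_sum /odd_powers_diff !expr1; split; lra.
rewrite !odd_powers_sumS !odd_powers_diffS.
have hy : 0 <= h ^+ 2 + y ^+ 2 by rewrite addr_ge0 ?sqr_ge0.
have hyz : h ^+ 2 + y ^+ 2 <= h ^+ 2 + z ^+ 2.
  by rewrite lerD2l ler_pXn2r ?nnegrE//; lra.
have y2 : 0 <= 2 * h * y by rewrite !mulr_ge0.
have yz2 : 2 * h * y <= 2 * h * z by rewrite ler_wpM2l ?mulr_ge0.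
by split; rewrite ?addr_ge0 ?mulr_ge0// lerD// ler_pM.
Qed.

(** Each step of the recurrence is bounded below by its [y^2] term alone, starting from the value
    [2 h] at [k = 0]. *)
Lemma odd_powers_sum_ge k h y : 0 <= h -> 0 <= y -> 2 * h * y ^+ (2 * k) <= odd_powers_sum k h y.
Proof.
move=> h0 y0; elim: k => [|k IH]; first by rewrite /odd_powers_sum !expr1 expr0; lra.
have [e0 _ o0 _] := odd_powers_mono k h0 y0 (lexx y).
rewrite odd_powers_sumS; have -> : (2 * k.+1 = (2 * k).+2)%N by lia.
rewrite !exprS; apply: (@le_trans _ _ (y ^+ 2 * odd_powers_sum k h y)).
  have -> : 2 * h * (y * (y * y ^+ (2 * k))) = y ^+ 2 * (2 * h * y ^+ (2 * k)) by ring.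
  by rewrite ler_wpM2l ?sqr_ge0.
have A := mulr_ge0 (sqr_ge0 h) e0.
have B : 0 <= 2 * h * y * odd_powers_diff k h y by rewrite !mulr_ge0.
by rewrite !expr0 !mulr1; lra.
Qed.

(** One step of the recurrence, with monotonicity, bounds the difference below by [(z^2 - y^2)]
    times the previous sum at [z]. That sum is at least [2 h z^(2k)], and [z^2 - y^2 >= (z - y)^2],
    [z >= z - y] give the claim. *)
Lemma odd_powers_sum_gap k h y z : (0 < k)%N -> 0 <= h -> 0 <= y -> y <= z ->
  2 * h * (z - y) ^+ (2 * k) <= odd_powers_sum k h z - odd_powers_sum k h y.
Proof.
case: k => // k _ h0 y0 yz; have z0 : 0 <= z by lra.
rewrite !odd_powers_sumS.
have [e0 e1 o0 o1] := odd_powers_mono k h0 y0 yz.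
have := odd_powers_sum_ge k h0 z0.
have zy : (z - y) ^+ (2 * k) <= z ^+ (2 * k).
  by rewrite lerXn2r ?nnegrE//; lra.
have -> : (2 * k.+1 = (2 * k).+2)%N by lia.
rewrite !exprS !expr0; set d := (z - y) ^+ _; set zk := z ^+ _ => evz.
have dz : 2 * h * d <= odd_powers_sum k h z.
  by apply: le_trans evz; rewrite ler_wpM2l// ?mulr_ge0.
have d0 : 0 <= d by rewrite exprn_ge0//; lra.
move: (odd_powers_sum k h y) (odd_powers_sum k h z) (odd_powers_diff k h y)
  (odd_powers_diff k h z) e0 e1 o0 o1 dz => a a' o o' a0 aa o0 oo dz.
have H1 : 2 * h * y * o <= 2 * h * z * o' by rewrite ler_pM ?mulr_ge0// ler_wpM2l ?mulr_ge0.
have H2 : h ^+ 2 * a <= h ^+ 2 * a' by rewrite ler_wpM2l ?sqr_ge0.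
have H3 : y ^+ 2 * a <= y ^+ 2 * a' by rewrite ler_wpM2l ?sqr_ge0.
have H4 : (z - y) ^+ 2 * (2 * h * d) <= (z - y) ^+ 2 * a' by rewrite ler_wpM2l ?sqr_ge0.
have H5 : (z - y) ^+ 2 * a' <= (z ^+ 2 - y ^+ 2) * a'.
  by rewrite ler_wpM2r//; [lra|nra].
nra.
Qed.

End symmetric_powers.

(** * Separation of the values of [P(x) + P(m - x)] *)

Section symbol_gap.
Context {R : realType}.
Variables (N : nat) (b : nat -> R).
Hypotheses (hN : (1 <= N)%N) (hbN : b N != 0).
Hypothesis hc : forall k : nat, (1 <= k <= N)%N -> symb_coef b k <= 0.
Local Notation P := (symbol N b).

Lemma symbolE (x : R) :
  P.[x] = \sum_(1 <= k < N.+1) symb_coef b k * x ^+ (2 * k + 1).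
Proof.
rewrite /symbol horner_sum; apply: eq_bigr => k _.
by rewrite hornerZ hornerXn.
Qed.

Lemma symbolN (x : R) : P.[- x] = - P.[x].
Proof.
rewrite !symbolE -sumrN; apply: eq_bigr => k _.
by rewrite exprNn -signr_odd oddD oddM/= expr1 mulN1r mulrN.
Qed.

Definition lead := - symb_coef b N.

Lemma lead_gt0 : 0 < lead.
Proof.
rewrite oppr_gt0 lt_neqAle hc ?hN ?leqnn// andbT /symb_coef.
rewrite !mulf_neq0// ?signr_eq0// expf_neq0// mulf_neq0//.
by rewrite gt_eqF ?pi_gt0.
Qed.

(* [P x + P (m - x)] is a polynomial in [(x - m / 2) ^ 2] with coefficients of
   constant sign, so it is monotone on either side of [m / 2]. *)
Lemma symbol_sum_gap_right (m x y : R) : 0 < m -> m / 2 <= y -> y <= x ->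
  lead * m * (x - y) ^+ (2 * N) <=
  (P.[y] + P.[m - y]) - (P.[x] + P.[m - x]).
Proof.
move=> m0 my yx.
have E z : P.[z] + P.[m - z] = \sum_(1 <= k < N.+1)
    symb_coef b k * odd_powers_sum k (m / 2) (z - m / 2).
  rewrite !symbolE -big_split/=; apply: eq_bigr => k _.
  rewrite -mulrDr /odd_powers_sum; congr (_ * (_ ^+ _ + _ ^+ _)); lra.
rewrite !E -sumrB big_nat_recr//=.
have H k : (1 <= k <= N)%N -> m * (x - y) ^+ (2 * k) <=
   odd_powers_sum k (m / 2) (x - m / 2) - odd_powers_sum k (m / 2) (y - m / 2).
  move=> /andP[k1 _]; have := @odd_powers_sum_gap _ k (m / 2) (y - m / 2) (x - m / 2) k1.
  have -> : 2 * (m / 2) = m by lra.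
  have -> : x - m / 2 - (y - m / 2) = x - y by lra.
  by apply; lra.
(* Only the top degree supplies the lower bound. The lower degrees are collected in [S], which is
   nonnegative because their coefficients have the same sign as the leading one. *)
rewrite -mulrBr; set S := \sum_(_ <= _ < _) _.
have S0 : 0 <= S.
  rewrite /S big_nat; apply: sumr_ge0 => k /andP[k1 kN].
  have kN' : (1 <= k <= N)%N by rewrite k1 ltnW.
  rewrite -mulrBr -mulrNN mulr_ge0//; first by rewrite oppr_ge0 hc.
  rewrite opprB; apply: le_trans (H k kN').
  by rewrite mulr_ge0 ?exprn_ge0//; lra.
apply: (@le_trans _ _ (lead * (m * (x - y) ^+ (2 * N)))); first by rewrite mulrA.
apply: (le_trans (ler_wpM2l (ltW lead_gt0) (H N _))); first by rewrite hN leqnn.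
rewrite /lead mulNr -mulrN opprB lerDr.
exact: S0.
Qed.

(** Three symmetries reduce to the one-sided case: [m -> - m] since [P] is odd, the exchange of [x]
    and [y], and [x -> m - x], which swaps the two sides of [m / 2] and leaves the sum unchanged. *)
Lemma symbol_sum_gap (m x y : R) : m != 0 ->
  (m / 2 <= x /\ m / 2 <= y) \/ (x <= m / 2 /\ y <= m / 2) ->
  lead * `|m| * `|x - y| ^+ (2 * N) <=
  `|(P.[x] + P.[m - x]) - (P.[y] + P.[m - y])|.
Proof.
wlog : m x y / 0 < m => [hw|m0] m_neq0 side.
  have [m_gt0|m_lt0] := ltP 0 m; first exact: hw.
  have := hw (- m) (- x) (- y).
  rewrite -!opprD !symbolN -!opprD !normrN; apply; first by lra.
  - by rewrite oppr_eq0.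
  - by case: side => -[? ?]; [right|left]; split; lra.
rewrite (gtr0_norm m0); wlog xy : x y side / y <= x => [hw|].
  have [?|/ltW ?] := leP y x; first exact: hw.
  by rewrite distrC (distrC _ (P.[y] + _)); apply: hw => //; case: side => -[? ?]; [left|right].
rewrite (ger0_norm (_ : 0 <= x - y)) ?subr_ge0//; case: side => -[mx my].
  rewrite distrC; apply: (le_trans _ (ler_norm _)); exact: symbol_sum_gap_right.
have := @symbol_sum_gap_right m (m - y) (m - x) m0.
rewrite !subKr (_ : m - y - (m - x) = x - y); last by lra.
rewrite (addrC (P.[m - x])) (addrC (P.[m - y])) => H.
by apply: (le_trans _ (ler_norm _)); apply: H; lra.
Qed.

End symbol_gap.

(** * Summing negative powers of separated values *)

Section gap_sum.
Context {R : realType}.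

(** A discrete comparison with an integral. For [A = (J+1)^(1/p)] and [B = J^(1/p)], factoring
    [A^p - B^p = 1] gives [1 <= (A - B) * p * A^(p-1)], so each new term [A^(1-p)] is at most
    [p * (A - B)] and the bound telescopes. *)
Lemma sum_powR_le (p J : nat) : (0 < p)%N ->
  \sum_(1 <= j < J.+1) (j%:R : R) `^ (p%:R^-1 - 1) <= p%:R * J%:R `^ p%:R^-1.
Proof.
move=> p0; have pR0 : p%:R != 0 :> R by rewrite pnatr_eq0 -lt0n.
have pV0 : 0 < p%:R^-1 :> R by rewrite invr_gt0 ltr0n.
elim: J => [|J IH]; first by rewrite big_geq// mulr_ge0 ?powR_ge0.
rewrite big_nat_recr//=; apply: (le_trans (lerD IH (lexx _))).
rewrite -lerBrDl -mulrBr.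
set A := J.+1%:R `^ p%:R^-1; set B := J%:R `^ p%:R^-1.
have Ap : A ^+ p = J.+1%:R by rewrite -powR_mulrn ?powR_ge0// -powRrM mulVf// powRr1.
have Bp : B ^+ p = J%:R by rewrite -powR_mulrn ?powR_ge0// -powRrM mulVf// powRr1.
have A0 : 0 < A by rewrite powR_gt0.
have B0 : 0 <= B by rewrite powR_ge0.
have AB : B <= A by rewrite /A /B ge0_ler_powR ?nnegrE ?ler_nat// ltW.
have -> : J.+1%:R `^ (p%:R^-1 - 1) = A * (A ^+ p)^-1.
  rewrite powRB; last by apply/implyP => _.
  by rewrite -/A powRr1// Ap.
have Ap1 : A ^+ p = A * A ^+ p.-1 by rewrite -exprS prednK.
rewrite Ap1 invfM mulrA divff ?gt_eqF// mul1r -div1r ler_pdivrMr ?exprn_gt0//.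
have D : A ^+ p - B ^+ p = 1 by rewrite Ap Bp -natrB ?subSnn.
rewrite -[leLHS]D subrXX -mulrA mulrCA ler_wpM2l ?subr_ge0//.
rewrite mulr_natl -[X in _ *+ X]card_ord -sumr_const; apply: ler_sum => i _.
apply: (@le_trans _ _ (A ^+ (p.-1 - i) * A ^+ i)).
  by rewrite ler_wpM2l ?exprn_ge0 ?(ltW A0)// lerXn2r ?nnegrE ?(ltW A0).
by rewrite -exprD subnK// -ltnS prednK.
Qed.

Lemma ler_sum_uniq_sub (I : eqType) (r r' : seq I) (F : I -> R) :
  uniq r -> uniq r' -> {subset r <= r'} -> (forall i, 0 <= F i) ->
  \sum_(i <- r) F i <= \sum_(i <- r') F i.
Proof.
move=> ur ur' rr' F0.
have -> : \sum_(i <- r) F i = \sum_(i <- r' | i \in r) F i.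
  rewrite -[RHS]big_filter; apply: perm_big; apply: uniq_perm => //; first exact: filter_uniq.
  by move=> i; rewrite mem_filter; case: (boolP (i \in r)) => // /rr' ->.
by rewrite [leRHS](bigID (mem r))/= lerDl sumr_ge0.
Qed.

Lemma seq_argmin (I : eqType) (r : seq I) (F : I -> R) : r != [::] ->
  exists2 i, i \in r & forall j, j \in r -> F i <= F j.
Proof.
elim: r => // i [|k r] IH _; first by exists i; rewrite ?mem_head// => j; rewrite inE => /eqP ->.
have [//|j jr jm] := IH; have [ij|/ltW ji] := leP (F i) (F j).
  exists i; rewrite ?mem_head// => l; rewrite inE => /predU1P[->//|/jm]; exact: le_trans.
exists j; first by rewrite inE jr orbT.
by move=> l; rewrite inE => /predU1P[->//|/jm].
Qed.

(** Let [n0] minimize [|tau|]. For any other [n], [|tau n|] is at least half of [|tau n - tau n0|],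
    hence at least [(c / 2) q j^(2N)] with [j = |n - n0|]. Each [j] occurs at most twice, and the
    upper bound on [|tau|] forces [j <= K q]. The sum of [j^(theta - 1)] up to [K q] is of order
    [(K q)^theta], whose factor [q^theta] cancels [q^(-theta)]; the result depends neither on [q]
    nor on [r]. *)
Lemma sum_gap_le (tau : int -> R) (r : seq int) (c : R) (N K q : nat) :
  (0 < N)%N -> 0 < c -> (0 < q)%N -> (0 < K)%N -> 4 / c <= K%:R -> uniq r ->
  (forall n n', n \in r -> n' \in r ->
    c * q%:R * `|n%:~R - n'%:~R| ^+ (2 * N) <= `|tau n - tau n'|) ->
  (forall n, n \in r -> `|tau n| <= 2 * q%:R ^+ (2 * N + 1)) ->
  \sum_(n <- r) (1 + `|tau n|) `^ (- (2 * N + 1)%:R^-1) <=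
  1 + 2 * ((c / 2) `^ (- (2 * N + 1)%:R^-1) *
           ((2 * N + 1)%:R * K%:R `^ (2 * N + 1)%:R^-1)).
Proof.
move=> N0 c0 q0 K0 cK ur gap bnd.
set th : R := (2 * N + 1)%:R^-1.
have th0 : 0 < th by rewrite invr_gt0 ltr0n addn1.
have C0 : 0 <= (c / 2) `^ (- th) * ((2 * N + 1)%:R * K%:R `^ th).
  by rewrite !mulr_ge0 ?powR_ge0.
have [->|r0] := eqVneq r [::]; first by rewrite big_nil addr_ge0// mulr_ge0.
have [n0 n0r n0min] := seq_argmin (fun n => `|tau n|) r0.
rewrite (big_rem n0)//=; apply: lerD.
  apply: (le_trans (ler_powRN (ltW th0) ltr01 _)); first by rewrite lerDl.
  by rewrite powR1.
pose J := (K * q)%N.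
(* This is [(c / 2 * q * j^(2N)) ^ (- th)], rewritten with [2N * th = 1 - th]. *)
pose phi (j : nat) : R := (c / 2) `^ (- th) * q%:R `^ (- th) * j%:R `^ (th - 1).
have phi0 j : 0 <= phi j by rewrite !mulr_ge0 ?powR_ge0.
pose r' := [seq n0 + j%:Z | j <- index_iota 1 J.+1] ++
           [seq n0 - j%:Z | j <- index_iota 1 J.+1].
have key n : n \in rem n0 r ->
    n \in r' /\ (1 + `|tau n|) `^ (- th) <= phi `|n - n0|%N.
  rewrite mem_rem_uniq// inE => /andP[nn0 nr].
  set j := `|n - n0|%N.
  have j0 : (0 < j)%N by rewrite absz_gt0 subr_eq0.
  have jR : `|n%:~R - n0%:~R| = j%:R :> R.
    by rewrite -intrB -intr_norm -abszE.
  have tau_ge : c / 2 * q%:R * j%:R ^+ (2 * N) <= `|tau n|.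
    have := gap _ _ nr n0r; rewrite jR => g.
    have := ler_normB (tau n) (tau n0); have := n0min _ nr.
    move: g; rewrite -!mulrA; lra.
  (* Otherwise [j^(2N) > (K q)^(2N) >= K q^(2N) >= (4 / c) q^(2N)], which contradicts [(c / 2) q
     j^(2N) <= |tau n| <= 2 q^(2N+1)]. *)
  have jJ : (j <= J)%N.
    rewrite leqNgt; apply/negP => Jj.
    have q0R : 0 < q%:R :> R by rewrite ltr0n.
    have A : c / 2 * q%:R * j%:R ^+ (2 * N) <= 2 * q%:R ^+ (2 * N + 1).
      exact: le_trans tau_ge (bnd _ nr).
    have B : (J%:R : R) ^+ (2 * N) < j%:R ^+ (2 * N).
      by rewrite ltr_pXn2r ?muln_gt0 ?N0 ?nnegrE// ltr_nat.
    have D : 4 / c * q%:R ^+ (2 * N) <= J%:R ^+ (2 * N).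
      rewrite natrM exprMn ler_wpM2r ?exprn_ge0//; apply: (le_trans cK).
      by rewrite -natrX ler_nat -[leqLHS]expn1 leq_pexp2l// muln_gt0 N0.
    have E : j%:R ^+ (2 * N) <= 4 / c * q%:R ^+ (2 * N).
      move: A; rewrite addn1 exprS [_ * q%:R * _]mulrAC [2 * (_ * _)]mulrCA.
      rewrite mulrC ler_pM2l// => A.
      rewrite -(@ler_pM2l _ (c / 2)) ?divr_gt0//; apply: (le_trans A).
      by rewrite mulrA (_ : c / 2 * (4 / c) = 2) //; field; rewrite gt_eqF.
    by have := lt_le_trans B (le_trans E D); rewrite ltxx.
  split.
    have nE : n = n0 + j%:Z \/ n = n0 - j%:Z by rewrite /j; clear; lia.
    rewrite mem_cat; apply/orP.
    by case: nE => nE; [left|right]; apply/mapP; exists j; rewrite // mem_index_iota j0 ltnS.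
  have cqj : 0 < c / 2 * q%:R * j%:R ^+ (2 * N).
    by rewrite !mulr_gt0 ?exprn_gt0 ?ltr0n.
  apply: (@le_trans _ _ ((c / 2 * q%:R * j%:R ^+ (2 * N)) `^ (- th))).
    by apply: ler_powRN => //; [exact: ltW|rewrite (le_trans tau_ge)// lerDr].
  have c20 : 0 <= c / 2 by rewrite divr_ge0 ?(ltW c0).
  have cq0 : 0 <= c / 2 * q%:R by rewrite mulr_ge0.
  have jN0 : 0 <= (j%:R : R) ^+ (2 * N) by rewrite exprn_ge0.
  rewrite /phi powRM// powRM//.
  have D0 : (2 * N + 1)%:R != 0 :> R by rewrite pnatr_eq0 addn1.
  rewrite -powR_mulrn// -powRrM (_ : (2 * N)%:R * - th = th - 1)//.
  have -> : (2 * N)%:R = (2 * N + 1)%:R - 1 :> R by rewrite natrD addrK.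
  by rewrite /th; move: D0; set D := (2 * N + 1)%:R => D0; field.
apply: (@le_trans _ _ (\sum_(n <- rem n0 r) phi `|n - n0|%N)).
  rewrite big_seq [leRHS]big_seq; apply: ler_sum => n /key[]//.
apply: (@le_trans _ _ (\sum_(n <- r') phi `|n - n0|%N)).
  apply: (@ler_sum_uniq_sub _ _ _ (fun n => phi `|n - n0|%N)) => //.
  - exact: rem_uniq.
  - rewrite cat_uniq !map_inj_uniq ?iota_uniq ?andbT /=; first last.
    + by move=> x y /addrI[].
    + by move=> x y /addrI/oppr_inj[].
    apply/hasPn => _ /mapP[j + ->]; rewrite mem_index_iota => j1.
    by apply/mapP => -[k]; rewrite mem_index_iota; move: j1; clear; lia.
  - by move=> n /key[].
rewrite big_cat/= !big_map.
rewrite (eq_bigr phi); last by move=> j _; congr phi; clear; lia.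
rewrite [X in _ + X](eq_bigr phi); last by move=> j _; congr phi; clear; lia.
set X := (c / 2) `^ _ * _; suff : \sum_(1 <= j < J.+1) phi j <= X by lra.
rewrite {}/X.
rewrite -mulr_sumr; apply: (le_trans (ler_wpM2l _ (sum_powR_le J _))); first by rewrite mulr_ge0 ?powR_ge0.
  by rewrite addn1.
rewrite -/th -mulrA ler_wpM2l ?powR_ge0// natrM powRM// mulrCA ler_wpM2l//.
rewrite mulrCA -powRD ?addNr ?powRr0 ?mulr1//.
by apply/implyP => _; rewrite pnatr_eq0 -lt0n.
Qed.

End gap_sum.

Section resonance.
Context {R : realType}.
Variables (N : nat) (b : nat -> R).
Hypotheses (hN : (1 <= N)%N) (hbN : b N != 0).
Hypothesis hc : forall k : nat, (1 <= k <= N)%N -> symb_coef b k <= 0.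
Local Notation P := (symbol N b).

(** The gap estimate with [q = |m|], applied separately to the frequencies on each side of [m / 2],
    since the resonance function is symmetric about that point. This is why the constant is
    doubled. *)
Lemma resonance_sum_le : exists2 C : R, 0 < C &
  forall (m : int) (x : R) (r : seq int), m != 0 -> uniq r ->
    (forall n, n \in r ->
       `|x + (P.[n%:~R] + P.[(m - n)%:~R])| <= 2 * (`|m|%:~R : R) ^+ (2 * N + 1)) ->
    \sum_(n <- r) (1 + `|x + (P.[n%:~R] + P.[(m - n)%:~R])|) `^ (- (2 * N + 1)%:R^-1) <= C.
Proof.
pose c := lead N b; have c0 : 0 < c := lead_gt0 hN hbN hc.
pose K := (Num.truncn (4 / c)).+1.
have cK : 4 / c <= K%:R by rewrite ltW// truncnS_gt// divr_ge0// ltW.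
pose C1 := 1 + 2 * ((c / 2) `^ (- (2 * N + 1)%:R^-1) *
           ((2 * N + 1)%:R * K%:R `^ (2 * N + 1)%:R^-1)).
have C10 : 0 < C1.
  by rewrite ltr_pwDl// !mulr_ge0 ?powR_ge0// .
exists (C1 + C1); first exact: addr_gt0.
move=> m x r m0 ur bnd.
pose tau n := x + (P.[n%:~R] + P.[(m - n)%:~R]).
have mR : (m%:~R : R) != 0 by rewrite intr_eq0.
have q0 : (0 < `|m|)%N by rewrite absz_gt0.
have qR : (`|m|%N%:R : R) = `|m|%:~R by rewrite -abszE.
have main (p : pred int) : (forall n n', p n -> p n' ->
    (m%:~R / 2 <= n%:~R :> R /\ m%:~R / 2 <= n'%:~R :> R) \/
    (n%:~R <= m%:~R / 2 :> R /\ n'%:~R <= m%:~R / 2 :> R)) ->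
    \sum_(n <- r | p n) (1 + `|tau n|) `^ (- (2 * N + 1)%:R^-1) <= C1.
  move=> pside; rewrite -big_filter.
  apply: (@sum_gap_le _ _ _ c _ _ `|m|%N) => //.
  - exact: filter_uniq.
  - move=> n n'; rewrite !mem_filter => /andP[pn nr] /andP[pn' nr'].
    rewrite qR /tau opprD addrACA subrr add0r !intrB intr_norm.
    by apply: symbol_sum_gap => //; exact: pside.
  - by move=> n; rewrite mem_filter qR => /andP[_ nr]; exact: bnd.
rewrite (bigID (fun n : int => (m%:~R / 2 <= (n%:~R : R))))/=; apply: lerD; apply: main.
- by move=> n n' ? ?; left.
- by move=> n n'; rewrite -!ltNge => /ltW ? /ltW ?; right.
Qed.

Lemma size_int_ball (r : seq int) (X : R) : 1 <= X -> uniq r ->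
  (forall n, n \in r -> `|n|%:~R <= X) -> (size r)%:R <= 3 * X.
Proof.
move=> X1 ur rX; pose B := Num.truncn X.
have BX : B%:R <= X by rewrite truncn_le// (le_trans ler01).
have : (size r <= (2 * B).+1)%N.
  have -> : ((2 * B).+1 = size [seq (i%:Z - B%:Z)%R | i <- iota 0 (2 * B).+1])%N.
    by rewrite size_map size_iota.
  apply: uniq_leq_size => // n nr.
  have nB : (`|n| <= B)%N.
    by rewrite truncn_ge_nat ?(le_trans ler01)// (le_trans _ (rX _ nr))// -abszE.
  apply/mapP; exists (`|(n + B%:Z)%R|)%N; first by rewrite mem_iota; move: nB; clear; lia.
  by move: nB; clear; lia.
move=> H; have {}H : (size r)%:R <= (2 * B).+1%:R :> R by rewrite ler_nat.
apply: (le_trans H); rewrite -natr1 natrM; lra.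
Qed.

End resonance.

(** * The convolution estimate *)

Section bilinear_kernels.
Context {R : realType}.
Variables (N : nat) (b : nat -> R).
Hypotheses (hN : (1 <= N)%N) (hbN : b N != 0).
Hypothesis hc : forall k : nat, (1 <= k <= N)%N -> symb_coef b k <= 0.
Local Notation P := (symbol N b).
Local Notation mu := (@lebesgue_measure R).

(** Twice the exponent [(N + 1) / (4N + 2)] of the theorem: it is the power of the weight in the
    squared norm. *)
Definition bexp : R := (N%:R + 1) / (2 * N%:R + 1).
Local Notation bt := bexp.
Local Notation th := ((2 * N + 1)%:R^-1 : R).

Lemma natr2D1_gt0 : 0 < 2 * N%:R + 1 :> R.
Proof. by rewrite ltr_pwDr// mulr_ge0. Qed.

Lemma bexpD : 1 - 2 * bt = - th.
Proof.
rewrite /bexp natrD natrM; field; rewrite gt_eqF//; exact: natr2D1_gt0.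
Qed.

Lemma th_gt0 : 0 < th. Proof. by rewrite invr_gt0 ltr0n addn1. Qed.

Lemma th_lt1 : th < 1. Proof. by rewrite invf_lt1 ?ltr0n ?ltr1n ?addn1// ltnS muln_gt0. Qed.

Lemma bexp_bounds : 2^-1 < bt /\ bt < 1.
Proof. by have := bexpD; have := th_gt0; have := th_lt1; split; lra. Qed.

Definition modw (n : int) (x : R) : R := 1 + `|x + P.[n%:~R]|.
Local Notation w := modw.
Definition freqw (m : int) : R := (`|m|%:~R : R) ^+ (2 * N + 1).
Local Notation L := freqw.

Lemma modw_ge1 n x : 1 <= w n x. Proof. by rewrite lerDl. Qed.
Lemma modw_gt0 n x : 0 < w n x. Proof. exact: lt_le_trans (modw_ge1 n x). Qed.

Lemma measurable_modw n : measurable_fun [set: R] (w n).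
Proof.
apply: measurable_funD => //; apply: measurableT_comp => //.
exact: measurable_funD.
Qed.

(** The triangle inequality. If both weights are at most [L m], the resonance function is below
    [2 * L m], which is the range in which [resonance_sum_le] applies. *)
Lemma modwD_ge n k (x y : R) :
  2 + `|x + (P.[n%:~R] + P.[k%:~R])| <= w n y + w k (x - y).
Proof.
rewrite /w addrACA; apply: lerD; first by lra.
apply: le_trans (ler_normD _ _); rewrite le_eqVlt; apply/orP; left.
by apply/eqP; congr `|_|; ring.
Qed.

Lemma measurable_modw_subr (k : int) (x : R) : measurable_fun [set: R] (fun y => w k (x - y)).
Proof. by apply: (measurableT_comp (measurable_modw k)); exact: measurable_subr. Qed.

Lemma kernel_near_le : exists2 C : R, 0 < C &
  forall (s : seq int) (m : int) (x : R), uniq s ->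
  (\sum_(n <- s) \int[mu]_y
     (((w n y <= L m) && (w (m - n) (x - y) <= L m))%:R *
      (w n y `^ (- bt) * w (m - n) (x - y) `^ (- bt)))%:E <= C%:E)%E.
Proof.
have [C1 C10 HC1] := resonance_sum_le hN hbN hc.
have [b12 b1] := bexp_bounds.
have cc0 : 0 < conv_const bt.
  rewrite /conv_const mulr_gt0// addr_gt0 ?mulr_gt0 ?powR_gt0// ?invr_gt0; lra.
exists (conv_const bt * C1); first exact: mulr_gt0.
move=> s m x us.
pose tau n := x + (P.[n%:~R] + P.[(m - n)%:~R]).
pose g n y : R := ((w n y <= L m) && (w (m - n) (x - y) <= L m))%:R *
      (w n y `^ (- bt) * w (m - n) (x - y) `^ (- bt)).
rewrite -/(g _ _).
have g0 n y : 0 <= g n y by rewrite !mulr_ge0 ?powR_ge0.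
(* Nonresonant [n] contribute nothing. At [m = 0] the threshold is [0] while every weight is at
   least 1, so the whole integrand vanishes. *)
have gE0 n y : 2 * L m < `|tau n| \/ m = 0 -> g n y = 0.
  move=> H; rewrite /g; case: andP => [[wn wk]|]; last by rewrite mul0r.
  have := modwD_ge n (m - n) x y; rewrite -/(tau n) => H1.
  exfalso; case: H => [|m0]; first by lra.
  by move: wn; rewrite m0 /L normr0 expr0n addn1/= leNgt modw_gt0.
pose q := [pred n | `|tau n| <= 2 * L m].
have termle n : (\int[mu]_y (g n y)%:E <=
    (if q n && (m != 0) then conv_const bt * (1 + `|tau n|) `^ (- th) else 0)%:E)%E.
  case: ifPn => [_|].
    apply: (@le_trans _ _ (\int[mu]_y (w n y `^ (- bt) * w (m - n) (x - y) `^ (- bt))%:E)%E).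
      apply: ge0_le_integral => //.
      - by move=> y _; rewrite lee_fin.
      - apply/measurable_EFinP; apply: measurable_funM.
          apply: measurable_natr_bool; apply: measurable_and.
            by apply: measurable_fun_ler => //; exact: measurable_modw.
          by apply: measurable_fun_ler => //; exact: measurable_modw_subr.
        apply: measurable_funM; apply: measurable_fun_powR; first exact: measurable_modw.
        exact: measurable_modw_subr.
      - apply/measurable_EFinP.
        apply: measurable_funM; apply: measurable_fun_powR; first exact: measurable_modw.
        exact: measurable_modw_subr.
      - move=> y _; rewrite lee_fin /g; case: (_ && _); rewrite ?mul1r// mul0r.
        by rewrite mulr_ge0 ?powR_ge0.
    rewrite -bexpD.
    apply: le_trans (integral_weight_conv (tau n) b12 b1).
    (* Translating by [P(n)] centres the two weights at [0] and at [tau n], the form required by the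
       convolution estimate. *)
    pose h (z : R) : \bar R := ((1 + `|z|) `^ (- bt) * (1 + `|tau n - z|) `^ (- bt))%:E.
    rewrite -(ge0_integral_addr P.[n%:~R] (f := h)); last 2 first.
    - apply/measurable_EFinP; apply: measurable_funM; first exact: measurable_1Dnorm_powR.
      apply: measurable_fun_powR; apply: measurable_funD => //.
      by apply: measurableT_comp => //; exact: measurable_subr.
    - by move=> z; rewrite lee_fin mulr_ge0 ?powR_ge0.
    rewrite le_eqVlt; apply/orP; left; apply/eqP; apply: eq_integral => y _.
    by rewrite /h /w; congr (_ * (1 + `|_|) `^ _)%:E; rewrite /tau; ring.
  rewrite negb_and negbK /q/= -ltNge => H.
  by rewrite integral0_eq// => y _; rewrite gE0//; case/orP: H => [|/eqP]; [left|right].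
apply: (le_trans (lee_sum _ (fun n _ => termle n))).
rewrite sumEFin lee_fin; have [m0|m0] := eqVneq m 0.
  rewrite big1; first by rewrite ltW// mulr_gt0.
  by move=> n _; rewrite andbF.
under eq_bigr do rewrite andbT.
rewrite -big_mkcond/= -mulr_sumr ler_pM2l// -big_filter.
apply: HC1 => //; first exact: filter_uniq.
by move=> n; rewrite mem_filter => /andP[].
Qed.

(** Here the frequency [k] and the weight [W] of the dominant factor are fixed, and the sum runs
    over the output frequency [m]: the far part is estimated after exchanging the order of
    summation. *)
Lemma kernel_far_le : exists2 C : R, 0 < C &
  forall (s : seq int) (k : int) (W : R), uniq s -> 1 <= W ->
  (\sum_(m <- s) \int[mu]_y
     (((w (m - k) y <= W) && (L m < W))%:R * w (m - k) y `^ (- bt))%:E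
   <= (C * W `^ bt)%:E)%E.
Proof.
have [b12 b1] := bexp_bounds.
have D0 : 0 < 2 / (1 - bt) by rewrite divr_gt0//; lra.
exists (3 * (2 / (1 - bt))); first by rewrite mulr_gt0.
move=> s k W us W1; have W0 : 0 < W by lra.
have termle m : (\int[mu]_y
     (((w (m - k) y <= W) && (L m < W))%:R * w (m - k) y `^ (- bt))%:E <=
   (if L m < W then 2 / (1 - bt) * W `^ (1 - bt) else 0)%:E)%E.
  case: ifPn => _.
    apply: le_trans (integral_weight_le b1 W1).
    pose h (z : R) : \bar R := ((1 + `|z| <= W)%R%:R * (1 + `|z|) `^ (- bt))%:E.
    rewrite -(ge0_integral_addr P.[(m - k)%:~R] (f := h)); last 2 first.
    - apply/measurable_EFinP; apply: measurable_funM; last exact: measurable_1Dnorm_powR.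
      by apply: measurable_natr_bool; apply: measurable_fun_ler => //; exact: measurable_funD.
    - by move=> z; rewrite lee_fin mulr_ge0 ?powR_ge0.
    by rewrite le_eqVlt; apply/orP; left; apply/eqP; apply: eq_integral => y _; rewrite andbT.
  by rewrite integral0_eq// => y _; rewrite andbF mul0r.
apply: (le_trans (lee_sum _ (fun n _ => termle n))).
rewrite sumEFin lee_fin -big_mkcond/= -big_filter big_const_seq count_predT.
rewrite iter_addr_0; set z := 2 / (1 - bt) * W `^ (1 - bt); rewrite -(mulr_natl z).
have th0 := th_gt0.
have sz : (size [seq m <- s | L m < W])%:R <= 3 * W `^ th.
  apply: size_int_ball; last first.
  - move=> m; rewrite mem_filter => /andP[LW _].
    rewrite -[leLHS]powRr1// -[X in _ `^ X](@mulfV _ (2 * N + 1)%:R) ?pnatr_eq0 ?addn1//.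
    rewrite powRrM -addn1 powR_mulrn// ge0_ler_powR// ?nnegrE ?exprn_ge0 ?(ltW W0)//; exact: ltW.
  - exact: filter_uniq.
  - by rewrite -[leLHS](powRr0 W) ler_powR// ltW.
apply: (le_trans (ler_wpM2r _ sz)); first by rewrite mulr_ge0 ?powR_ge0 ?(ltW D0).
rewrite {}/z.
have -> : bt = th + (1 - bt) by have := bexpD; lra.
rewrite powRD; last by apply/implyP => _; rewrite gt_eqF.
set a := W `^ th; have -> : th + (1 - bt) = bt by have := bexpD; lra.
rewrite le_eqVlt; apply/orP; left; apply/eqP; ring.
Qed.

End bilinear_kernels.

(** * Sums and squares in the extended reals *)

Section ereal_sums.
Context {R : realType}.
Local Open Scope ereal_scope.

(** Used with [n -> m - n] or [m -> m - n]: reindexed frequencies may leave [s], where the terms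
    vanish, and injectivity counts no frequency of [s] twice. *)
Lemma lee_sum_inj (r s : seq int) (g : int -> int) (V : int -> \bar R) :
  uniq r -> uniq s -> injective g -> (forall k, 0 <= V k) ->
  (forall k, k \notin s -> V k = 0) ->
  \sum_(n <- r) V (g n) <= \sum_(k <- s) V k.
Proof.
move=> ur us ginj V0 Vs.
rewrite -(big_map g xpredT V) (bigID (mem s))/= [X in _ + X]big1 ?adde0//.
rewrite [leRHS](bigID (mem (map g r)))/=.
have -> : \sum_(k <- map g r | k \in s) V k = \sum_(k <- s | k \in map g r) V k.
  rewrite -[LHS]big_filter -[RHS]big_filter; apply: perm_big; apply: uniq_perm.
  - by rewrite filter_uniq// map_inj_uniq.
  - exact: filter_uniq.
  - by move=> k; rewrite !mem_filter andbC.
by rewrite leeDl// sume_ge0.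
Qed.

Lemma mule2_ge0 (z : \bar R) : 0 <= z -> 2%:E * z = z + z.
Proof.
case: z => [z| |]//; last by rewrite gt0_muley.
by move=> _; rewrite -EFinM -EFinD; congr EFin; ring.
Qed.

(* Cauchy-Schwarz enters in this form: the optimal [c] replaces square roots. *)
Lemma esqr_le_of_AMGM (F A : \bar R) (B : R) : 0 <= F -> 0 <= A -> (0 < B)%R ->
  (forall c : R, (0 < c)%R -> 2%:E * F <= c%:E * A + (B / c)%:E) ->
  F * F <= B%:E * A.
Proof.
case: A => [a| |]//; last by move=> _ _ B0 _; rewrite gt0_muley ?leey.
case: F => [f| |]//; last first.
  by move=> _ _ _ /(_ 1%R ltr01); rewrite gt0_muley.
rewrite !lee_fin => f0 a0 B0 H.
have {}H (c : R) : (0 < c)%R -> (2 * f <= c * a + B / c)%R.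
  by move=> /H; rewrite -!EFinM -EFinD lee_fin.
have [->|fn0] := eqVneq f 0%R; first by rewrite mul0r mulr_ge0// ltW.
have fp : (0 < f)%R by rewrite lt_neqAle eq_sym fn0.
(* With [c = B / f] the term [B / c] equals [f] and absorbs half of [2 * f]. *)
have := H (B / f)%R; rewrite divr_gt0// => /(_ isT).
have -> : (B / (B / f) = f)%R by field; rewrite fn0 gt_eqF.
move=> H1; have {}H1 : (f <= B / f * a)%R by lra.
have := ler_wpM2l f0 H1.
have -> // : (f * (B / f * a) = B * a)%R by field.
Qed.

Lemma esqrD2_le (a c : \bar R) : 0 <= a -> 0 <= c ->
  (a + 2%:E * c) * (a + 2%:E * c) <= 2%:E * (a * a) + 8%:E * (c * c).
Proof.
case: a => [a| |]//; case: c => [c| |]//.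
- move=> _ _.
  have : ((a + 2 * c) * (a + 2 * c) <= 2 * (a * a) + 8 * (c * c))%R.
    by have := sqr_ge0 (a - 2 * c)%R; nra.
  by rewrite -lee_fin.
- by move=> _ _; rewrite mulyy [8%:E * _]gt0_muley// addey ?leey// -!EFinM.
- by move=> _ _; rewrite mulyy [2%:E * +oo]gt0_muley// addye ?leey// -!EFinM.
- by move=> _ _; rewrite mulyy [8%:E * _]gt0_muley// addey ?leey// gt0_muley.
Qed.

End ereal_sums.

Section bilinear.
Context {R : realType}.
Variables (N : nat) (b : nat -> R).
Hypotheses (hN : (1 <= N)%N) (hbN : b N != 0).
Hypothesis hc : forall k : nat, (1 <= k <= N)%N -> symb_coef b k <= 0.
Local Notation P := (symbol N b).
Local Notation mu := (@lebesgue_measure R).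
Local Notation bt := (@bexp R N).
Local Notation w := (modw N b).
Local Notation L := (@freqw R N).

Definition modnorm2 (s : seq int) (f : int -> R -> R) : \bar R :=
  (\sum_(n <- s) \int[mu]_x (w n x `^ bt * f n x ^+ 2)%:E)%E.

(** With [f n] the modulus of the n-th coefficient, this majorizes the modulus of the Fourier
    coefficient at [(m, x)] of the square of the trigonometric sum. *)
Definition sconv (s : seq int) (f : int -> R -> R) (m : int) (x : R) : \bar R :=
  (\sum_(n <- s) \int[mu]_y (f n y * f (m - n) (x - y))%:E)%E.

Section fixed.
Variables (s : seq int) (f : int -> R -> R).
Hypotheses (us : uniq s) (mf : forall n, measurable_fun [set: R] (f n)).
Hypotheses (f0 : forall n x, 0 <= f n x) (fs : forall n, n \notin s -> forall x, f n x = 0).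

Let near (m n : int) (x y : R) := (w n y <= L m) && (w (m - n) (x - y) <= L m).
(** Only the half where the factor [n] carries the larger weight; the other half is its image under
    [n -> m - n], [y -> x - y]. *)
Let far (m n : int) (x y : R) := (w (m - n) (x - y) <= w n y) && (L m < w n y).
Let V n x := w n x `^ bt * f n x ^+ 2.

Let V0 n x : 0 <= V n x. Proof. by rewrite mulr_ge0 ?powR_ge0 ?sqr_ge0. Qed.

Let mV n : measurable_fun [set: R] (V n).
Proof.
apply: measurable_funM; first by apply: measurable_fun_powR; exact: measurable_modw.
exact: measurable_funX.
Qed.

Let m1 (g : R -> R) : measurable_fun [set: R] g ->
  measurable_fun [set: R * R] (fun z : R * R => g z.2).
Proof. by move=> mg; apply: (measurableT_comp mg); exact: measurable_snd. Qed.

Let m2 (g : R -> R) : measurable_fun [set: R] g ->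
  measurable_fun [set: R * R] (fun z : R * R => g (z.1 - z.2)).
Proof.
move=> mg; apply: (measurableT_comp mg).
by apply: measurable_funB; [exact: measurable_fst|exact: measurable_snd].
Qed.

Let mnear m n : measurable_fun [set: R * R] (fun z : R * R => (near m n z.1 z.2)%:R : R).
Proof.
apply: measurable_natr_bool; apply: measurable_and; apply: measurable_fun_ler => //.
  by apply: m1; exact: measurable_modw.
by apply: m2; exact: measurable_modw.
Qed.

Let mfar m n : measurable_fun [set: R * R] (fun z : R * R => (far m n z.1 z.2)%:R : R).
Proof.
apply: measurable_natr_bool; apply: measurable_and.
  by apply: measurable_fun_ler; [apply: m2|apply: m1]; exact: measurable_modw.
by apply: measurable_fun_ltr => //; apply: m1; exact: measurable_modw.
Qed.

Let mff m n : measurable_fun [set: R * R] (fun z : R * R => f n z.2 * f (m - n) (z.1 - z.2)).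
Proof. by apply: measurable_funM; [exact: m1|exact: m2]. Qed.

Let msec (g : R * R -> R) x : measurable_fun [set: R * R] g ->
  measurable_fun [set: R] (fun y => g (x, y)).
Proof. by move=> mg; exact: (measurable_fun_pair2 x mg). Qed.

Let mint (g : R * R -> R) : measurable_fun [set: R * R] g -> (forall z, 0 <= g z) ->
  measurable_fun [set: R] (fun x => \int[mu]_y (g (x, y))%:E)%E.
Proof.
move=> mg g0.
apply: (@measurable_fun_fubini_tonelli_F _ _ _ _ R mu (EFin \o g)).
  exact/measurable_EFinP.
by move=> z; rewrite lee_fin.
Qed.

Let tonelli (g : R * R -> R) : measurable_fun [set: R * R] g -> (forall z, 0 <= g z) ->
  (\int[mu]_x \int[mu]_y (g (x, y))%:E = \int[mu]_y \int[mu]_x (g (x, y))%:E)%E.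
Proof.
move=> mg g0.
apply: (@fubini_tonelli _ _ _ _ R mu mu (EFin \o g)).
  exact/measurable_EFinP.
by move=> z; rewrite lee_fin.
Qed.

Let conv_near m x : \bar R := (\sum_(n <- s) \int[mu]_y
  ((near m n x y)%:R * (f n y * f (m - n) (x - y)))%:E)%E.

Let conv_far m x : \bar R := (\sum_(n <- s) \int[mu]_y
  ((far m n x y)%:R * (f n y * f (m - n) (x - y)))%:E)%E.

Let quad_near m x : \bar R := (\sum_(n <- s) \int[mu]_y (V n y * V (m - n) (x - y))%:E)%E.

Let quad_far m x : \bar R := (\sum_(n <- s) \int[mu]_y
  ((far m n x y)%:R * (w (m - n) (x - y) `^ (- bt) * f n y ^+ 2))%:E)%E.

Let mnearff m n : measurable_fun [set: R * R]
  (fun z : R * R => (near m n z.1 z.2)%:R * (f n z.2 * f (m - n) (z.1 - z.2))).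
Proof. by apply: measurable_funM; [exact: mnear|exact: mff]. Qed.

Let mfarff m n : measurable_fun [set: R * R]
  (fun z : R * R => (far m n z.1 z.2)%:R * (f n z.2 * f (m - n) (z.1 - z.2))).
Proof. by apply: measurable_funM; [exact: mfar|exact: mff]. Qed.

Let mVV m n : measurable_fun [set: R * R] (fun z : R * R => V n z.2 * V (m - n) (z.1 - z.2)).
Proof. by apply: measurable_funM; [exact: m1|exact: m2]. Qed.

Let mqfar m n : measurable_fun [set: R * R]
  (fun z : R * R => (far m n z.1 z.2)%:R * (w (m - n) (z.1 - z.2) `^ (- bt) * f n z.2 ^+ 2)).
Proof.
apply: measurable_funM; first exact: mfar.
apply: measurable_funM; last by apply: measurable_funX; exact: m1.
by apply: measurable_fun_powR; apply: m2; exact: measurable_modw.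
Qed.

Let nearff0 m n x y : 0 <= (near m n x y)%:R * (f n y * f (m - n) (x - y)).
Proof. by rewrite !mulr_ge0. Qed.

Let farff0 m n x y : 0 <= (far m n x y)%:R * (f n y * f (m - n) (x - y)).
Proof. by rewrite !mulr_ge0. Qed.

Let qfar0 m n x y : 0 <= (far m n x y)%:R * (w (m - n) (x - y) `^ (- bt) * f n y ^+ 2).
Proof. by rewrite !mulr_ge0 ?powR_ge0 ?sqr_ge0. Qed.

(** If a pair is not near, its larger weight exceeds [L m], so the pair or its mirror image is far.
    Reflection in [y] and reindexing in [n] bound the mirrored terms by a second copy of the far
    sum. *)
Let sconv_le m x : (sconv s f m x <= conv_near m x + 2%:E * conv_far m x)%E.
Proof.
pose G n y : R := (far m n x y)%:R * (f n y * f (m - n) (x - y)).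
have mG n : measurable_fun [set: R] (G n) by exact: (msec x (mfarff m n)).
have G0 n y : 0 <= G n y by exact: farff0.
pose far' n y := far m (m - n) x (x - y).
have far'E n y : far' n y = (w n y <= w (m - n) (x - y)) && (L m < w (m - n) (x - y)).
  by rewrite /far' /far !subKr.
have mG' n : measurable_fun [set: R] (fun y => G (m - n) (x - y)).
  by apply: (measurableT_comp (mG _)); exact: measurable_subr.
have step n : (\int[mu]_y (f n y * f (m - n) (x - y))%:E <=
    \int[mu]_y ((near m n x y)%:R * (f n y * f (m - n) (x - y)))%:E +
    (\int[mu]_y (G n y)%:E + \int[mu]_y (G (m - n) y)%:E))%E.
  rewrite -(ge0_integral_subr x (f := fun y => (G (m - n) y)%:E)); last 2 first.
  - exact/measurable_EFinP.
  - by move=> y; rewrite lee_fin.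
  have mGG : measurable_fun [set: R] (fun y => G n y + G (m - n) (x - y)).
    exact: measurable_funD.
  apply: (@le_trans _ _ (\int[mu]_y ((near m n x y)%:R * (f n y * f (m - n) (x - y)))%:E +
      \int[mu]_y (G n y + G (m - n) (x - y))%:E)%E); last first.
    rewrite leeD2l//; apply: (ge0_integral_leD mu measurableT mGG (mG n) (mG' n)) => // y.
    exact: addr_ge0.
  apply: ge0_integral_leD => //.
  - exact: (msec x (mff m n)).
  - exact: (msec x (mnearff m n)).
  - by move=> y; rewrite mulr_ge0.
  - by move=> y; rewrite addr_ge0.
  move=> y; rewrite /G -/(far' n y) far'E !subKr.
  rewrite (mulrC (f (m - n) _)) -!mulrDl ler_peMl ?mulr_ge0// /near /far.
  (* What remains is that the three indicators cover every pair of weights. *)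
  rewrite -!natrD ler1n.
  case: (leP (w n y) (L m)) => h1; case: (leP (w (m - n) (x - y)) (L m)) => h2 //=;
  case: (leP (w n y) (w (m - n) (x - y))) => h3; case: (leP (w (m - n) (x - y)) (w n y)) => h4 //=; lra.
apply: (le_trans (lee_sum _ (fun n _ => step n))).
rewrite big_split/= leeD2l// big_split/=.
rewrite mule2_ge0; last first.
  by apply: sume_ge0 => n _; apply: integral_ge0 => y _; rewrite lee_fin.
rewrite leeD2l//.
apply: (@lee_sum_inj _ _ _ (fun n => m - n) (fun k => \int[mu]_y (G k y)%:E)%E) => //.
- by move=> n n' /addrI/oppr_inj.
- by move=> k; apply: integral_ge0 => y _; rewrite lee_fin.
- by move=> k ks; rewrite integral0_eq// => y _; rewrite /G (fs ks) mul0r mulr0.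
Qed.

(** Cauchy-Schwarz after writing the product [f f'] as [(w w')^(-bt/2)] times [(w w')^(bt/2) f f']:
    the first factors sum to at most [C], the squares of the second are [V V']. *)
Let conv_near_sqr_le (C : R) : 0 < C ->
  (forall m x, (\sum_(n <- s) \int[mu]_y ((near m n x y)%:R *
      (w n y `^ (- bt) * w (m - n) (x - y) `^ (- bt)))%:E <= C%:E)%E) ->
  forall m x, (conv_near m x * conv_near m x <= C%:E * quad_near m x)%E.
Proof.
move=> C0 HC m x; apply: esqr_le_of_AMGM => //.
- by apply: sume_ge0 => n _; apply: integral_ge0 => y _; rewrite lee_fin.
- by apply: sume_ge0 => n _; apply: integral_ge0 => y _; rewrite lee_fin mulr_ge0.
move=> c c0.
pose K n y := (near m n x y)%:R * (w n y `^ (- bt) * w (m - n) (x - y) `^ (- bt)).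
have K0 n y : 0 <= K n y by rewrite !mulr_ge0 ?powR_ge0.
have mK n : measurable_fun [set: R] (K n).
  apply: measurable_funM; first exact: (msec x (mnear m n)).
  apply: measurable_funM; apply: measurable_fun_powR; first exact: measurable_modw.
  exact: measurable_modw_subr.
have mVVs n : measurable_fun [set: R] (fun y => V n y * V (m - n) (x - y)).
  exact: (msec x (mVV m n)).
apply: (@le_trans _ _ (\sum_(n <- s) (c%:E * \int[mu]_y (V n y * V (m - n) (x - y))%:E +
    c^-1%:E * \int[mu]_y (K n y)%:E))%E).
  rewrite ge0_sume_distrr; last first.
    by move=> n _; apply: integral_ge0 => y _; rewrite lee_fin.
  apply: lee_sum => n _.
  apply: ge0_integral_le_comb; rewrite ?invr_ge0 ?(ltW c0)//.
  - exact: (msec x (mnearff m n)).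
  - exact: mVVs.
  - exact: mK.
  - by move=> y; rewrite mulr_ge0.
  - move=> y; rewrite /K /V.
    have w1 := modw_gt0 N b n y; have w2 := modw_gt0 N b (m - n) (x - y).
    rewrite !powRN.
    have : 0 < w n y `^ bt by rewrite powR_gt0.
    have : 0 < w (m - n) (x - y) `^ bt by rewrite powR_gt0.
    move: (w n y `^ bt) (w (m - n) (x - y) `^ bt) => W1 W2 W20 W10.
    move: (f0 n y) (f0 (m - n) (x - y)); move: (f n y) (f (m - n) (x - y)) => F1 F2 F10 F20.
    have cW : 0 < c * (W1 * W2) by rewrite !mulr_gt0.
    have R0 : 0 <= c * (W1 * F1 ^+ 2 * (W2 * F2 ^+ 2)).
      by rewrite !mulr_ge0 ?sqr_ge0 ?(ltW W20) ?(ltW W10) ?(ltW c0).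
    case: (near m n x y); rewrite ?mul0r ?mulr0 ?addr0 ?mul1r//.
    rewrite -subr_ge0.
    have -> : c * (W1 * F1 ^+ 2 * (W2 * F2 ^+ 2)) + c^-1 * (W1^-1 / W2) - 2 * (F1 * F2) =
       (c * (W1 * W2) * (F1 * F2) - 1) ^+ 2 / (c * (W1 * W2)).
      by field; rewrite !gt_eqF.
    by rewrite divr_ge0 ?sqr_ge0// ltW.
rewrite big_split/=; apply: leeD.
  rewrite -ge0_sume_distrr//.
  by move=> n _; apply: integral_ge0 => y _; rewrite lee_fin mulr_ge0.
rewrite -ge0_sume_distrr; last first.
  by move=> n _; apply: integral_ge0 => y _; rewrite lee_fin.
rewrite muleC EFinM; apply: lee_wpmul2r; first by rewrite lee_fin invr_ge0 ltW.
exact: HC.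
Qed.

(** Cauchy-Schwarz splits off the whole weight of the second factor, the smaller one. The terms
    [w'^bt f'^2] add up to at most the energy, and [w'^(-bt)] stays with [f^2] in [quad_far]. *)
Let conv_far_sqr_le (h : R) : 0 < h -> (modnorm2 s f <= h%:E)%E ->
  forall m x, (conv_far m x * conv_far m x <= h%:E * quad_far m x)%E.
Proof.
move=> h0 Hh m x; apply: esqr_le_of_AMGM => //.
- by apply: sume_ge0 => n _; apply: integral_ge0 => y _; rewrite lee_fin.
- by apply: sume_ge0 => n _; apply: integral_ge0 => y _; rewrite lee_fin.
move=> c c0.
have mV' n : measurable_fun [set: R] (fun y => V (m - n) (x - y)).
  by apply: (measurableT_comp (mV _)); exact: measurable_subr.
have mq n := msec x (mqfar m n).
apply: (@le_trans _ _ (\sum_(n <- s) (c%:E * \int[mu]_y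
     ((far m n x y)%:R * (w (m - n) (x - y) `^ (- bt) * f n y ^+ 2))%:E +
    c^-1%:E * \int[mu]_y (V (m - n) (x - y))%:E))%E).
  rewrite ge0_sume_distrr; last first.
    by move=> n _; apply: integral_ge0 => y _; rewrite lee_fin.
  apply: lee_sum => n _.
  apply: ge0_integral_le_comb; rewrite ?invr_ge0 ?(ltW c0)//.
  - exact: (msec x (mfarff m n)).
  - exact: mq.
  - exact: mV'.
  - move=> y; rewrite /V.
    have w2 := modw_gt0 N b (m - n) (x - y).
    rewrite powRN.
    have : 0 < w (m - n) (x - y) `^ bt by rewrite powR_gt0.
    move: (w (m - n) (x - y) `^ bt) => W2 W20.
    move: (f0 n y) (f0 (m - n) (x - y)); move: (f n y) (f (m - n) (x - y)) => F1 F2 F10 F20.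
    have R0 : 0 <= c^-1 * (W2 * F2 ^+ 2).
      by rewrite !mulr_ge0 ?sqr_ge0 ?invr_ge0 ?(ltW W20) ?(ltW c0).
    case: (far m n x y); rewrite ?mul0r ?mulr0 ?add0r ?mul1r//.
    rewrite -subr_ge0.
    have -> : c * (W2^-1 * F1 ^+ 2) + c^-1 * (W2 * F2 ^+ 2) - 2 * (F1 * F2) =
       (c * F1 - W2 * F2) ^+ 2 / (c * W2).
      by field; rewrite !gt_eqF.
    by rewrite divr_ge0 ?sqr_ge0// ltW// mulr_gt0.
rewrite big_split/=; apply: leeD.
  rewrite -ge0_sume_distrr//.
  by move=> n _; apply: integral_ge0 => y _; rewrite lee_fin.
rewrite -ge0_sume_distrr; last first.
  by move=> n _; apply: integral_ge0 => y _; rewrite lee_fin.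
rewrite muleC EFinM; apply: lee_wpmul2r; first by rewrite lee_fin invr_ge0 ltW.
apply: le_trans Hh.
under eq_bigr => n _.
  rewrite (ge0_integral_subr x (f := fun y => (V (m - n) y)%:E)); last 2 first.
  - by apply/measurable_EFinP; exact: mV.
  - by move=> y; rewrite lee_fin.
  over.
apply: (@lee_sum_inj _ _ _ (fun n => m - n) (fun k => \int[mu]_y (V k y)%:E)%E) => //.
- by move=> n n' /addrI/oppr_inj.
- by move=> k; apply: integral_ge0 => y _; rewrite lee_fin.
- by move=> k ks; rewrite integral0_eq// => y _; rewrite /V (fs ks) expr0n mulr0.
Qed.

Let I n : \bar R := (\int[mu]_x (V n x)%:E)%E.

Let I0 n : (0 <= I n)%E.
Proof. by apply: integral_ge0 => y _; rewrite lee_fin. Qed.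

Let mquad_near m n : measurable_fun [set: R]
  (fun x => \int[mu]_y (V n y * V (m - n) (x - y))%:E)%E.
Proof.
apply: (@mint (fun z => V n z.2 * V (m - n) (z.1 - z.2))); first exact: mVV.
by move=> z; rewrite mulr_ge0.
Qed.

Let mquad_far m n : measurable_fun [set: R] (fun x => \int[mu]_y
  ((far m n x y)%:R * (w (m - n) (x - y) `^ (- bt) * f n y ^+ 2))%:E)%E.
Proof.
apply: (@mint (fun z => (far m n z.1 z.2)%:R *
  (w (m - n) (z.1 - z.2) `^ (- bt) * f n z.2 ^+ 2))); first exact: mqfar.
by move=> z.
Qed.

(** By Tonelli and translation each term is the product [I n * I (m - n)]; summing over [m] and then
    over [n] yields the energy twice. *)
Let quad_near_total (h : R) (r : seq int) : 0 < h -> (modnorm2 s f <= h%:E)%E -> uniq r ->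
  (\sum_(m <- r) \int[mu]_x quad_near m x <= (h * h)%:E)%E.
Proof.
move=> h0 Hh ur.
have E m : (\int[mu]_x quad_near m x = \sum_(n <- s) I n * I (m - n))%E.
  rewrite ge0_integral_sum//; last 2 first.
    by move=> n; exact: mquad_near.
    by move=> n x _; apply: integral_ge0 => y _; rewrite lee_fin mulr_ge0.
  apply: eq_bigr => n _.
  rewrite (@tonelli (fun z => V n z.2 * V (m - n) (z.1 - z.2))); first last.
  - by move=> z; rewrite mulr_ge0.
  - exact: mVV.
  rewrite /I -ge0_integralZr//; first last.
  - exact: I0.
  - by move=> y _; rewrite lee_fin.
  - by apply/measurable_EFinP; exact: mV.
  apply: eq_integral => y _ /=.
  rewrite -(ge0_integral_addr (- y) (f := fun x => (V (m - n) x)%:E)); first last.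
  - by move=> z; rewrite lee_fin.
  - by apply/measurable_EFinP; exact: mV.
  rewrite -ge0_integralZl//.
  - apply/measurable_EFinP; apply: (measurableT_comp (mV _)).
    exact: measurable_funD.
  - by move=> z _; rewrite lee_fin.
  - by rewrite lee_fin.
under eq_bigr do rewrite E.
rewrite exchange_big/=.
apply: (@le_trans _ _ (\sum_(n <- s) I n * h%:E)%E).
  apply: lee_sum => n _; rewrite -ge0_sume_distrr//.
  apply: lee_wpmul2l => //; apply: le_trans Hh.
  apply: (@lee_sum_inj _ _ _ (fun m => m - n) I) => //.
  - by move=> m m' /addIr.
  - by move=> k ks; rewrite /I integral0_eq// => y _; rewrite /V (fs ks) expr0n mulr0.
rewrite -ge0_sume_distrl// EFinM.
by apply: lee_wpmul2r => //; rewrite lee_fin ltW.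
Qed.

(** Integrating in [x] first leaves, for fixed [n] and [y], the kernel [K] with [W = w n y]. Its sum
    over [m] is at most [C * W^bt], and this power turns [f^2] into the energy density [V]. *)
Let quad_far_total (C h : R) (r : seq int) : 0 < C ->
  (forall (k : int) (W : R), 1 <= W ->
     (\sum_(m <- r) \int[mu]_y
       (((w (m - k) y <= W) && (L m < W))%:R * w (m - k) y `^ (- bt))%:E
      <= (C * W `^ bt)%:E)%E) ->
  (modnorm2 s f <= h%:E)%E ->
  (\sum_(m <- r) \int[mu]_x quad_far m x <= (C * h)%:E)%E.
Proof.
move=> C0 HC Hh.
pose K m n W := (\int[mu]_z
   (((w (m - n) z <= W) && (L m < W))%:R * w (m - n) z `^ (- bt))%:E)%E.
have K0 m n W : (0 <= K m n W)%E.
  by apply: integral_ge0 => y _; rewrite lee_fin mulr_ge0 ?powR_ge0.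
have inner m n y : (\int[mu]_x
   ((far m n x y)%:R * (w (m - n) (x - y) `^ (- bt) * f n y ^+ 2))%:E =
   (f n y ^+ 2)%:E * K m n (w n y))%E.
  pose g z : \bar R := (((w (m - n) z <= w n y) && (L m < w n y))%:R * w (m - n) z `^ (- bt))%:E.
  have mg : measurable_fun [set: R] g.
    apply/measurable_EFinP; apply: measurable_funM.
      apply: measurable_natr_bool; apply: measurable_and; last exact: measurable_cst.
      by apply: measurable_fun_ler => //; exact: measurable_modw.
    by apply: measurable_fun_powR; exact: measurable_modw.
  have g0 z : (0 <= g z)%E by rewrite lee_fin mulr_ge0 ?powR_ge0.
  rewrite /K -(ge0_integral_addr (- y) (f := g))// -ge0_integralZl//.
  - by apply: eq_integral => z _; rewrite /g -EFinM; congr EFin; rewrite /far; ring.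
  - by apply: (measurableT_comp mg); exact: measurable_funD.
  - by rewrite lee_fin sqr_ge0.
have mK m n : measurable_fun [set: R] (fun y => (f n y ^+ 2)%:E * K m n (w n y))%E.
  under eq_fun do rewrite -inner.
  apply: (@measurable_fun_fubini_tonelli_G _ _ _ _ R mu (EFin \o (fun z : R * R =>
    (far m n z.1 z.2)%:R * (w (m - n) (z.1 - z.2) `^ (- bt) * f n z.2 ^+ 2)))).
    by apply/measurable_EFinP; exact: mqfar.
  by move=> z; rewrite lee_fin.
have E m : (\int[mu]_x quad_far m x =
    \sum_(n <- s) \int[mu]_y ((f n y ^+ 2)%:E * K m n (w n y)))%E.
  rewrite ge0_integral_sum//; last 2 first.
    by move=> n; exact: mquad_far.
    by move=> n x _; apply: integral_ge0 => y _; rewrite lee_fin.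
  apply: eq_bigr => n _.
  rewrite (@tonelli (fun z => (far m n z.1 z.2)%:R *
    (w (m - n) (z.1 - z.2) `^ (- bt) * f n z.2 ^+ 2))); first last.
  - by move=> z.
  - exact: mqfar.
  by apply: eq_integral => y _; rewrite -inner.
under eq_bigr do rewrite E.
rewrite exchange_big/=.
apply: (@le_trans _ _ (\sum_(n <- s) C%:E * I n)%E).
  apply: lee_sum => n _.
  rewrite -ge0_integral_sum//; last 2 first.
    by move=> m; exact: mK.
    by move=> m y _; rewrite mule_ge0// lee_fin sqr_ge0.
  rewrite /I -ge0_integralZl//; first last.
  - by rewrite lee_fin ltW.
  - by move=> y _; rewrite lee_fin.
  - by apply/measurable_EFinP; exact: mV.
  apply: ge0_le_integral => //.
  - by move=> y _; apply: sume_ge0 => m _; rewrite mule_ge0// lee_fin sqr_ge0.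
  - by apply: emeasurable_sum => m; exact: mK.
  - by apply: measurable_funeM; apply/measurable_EFinP; exact: mV.
  - move=> y _; rewrite -ge0_sume_distrr//.
    have -> : (C%:E * (V n y)%:E = (f n y ^+ 2)%:E * (C * w n y `^ bt)%:E)%E.
      by rewrite -!EFinM; congr EFin; rewrite /V; ring.
    apply: lee_wpmul2l; first by rewrite lee_fin sqr_ge0.
    by apply: HC; exact: modw_ge1.
rewrite -ge0_sume_distrr// EFinM.
by apply: lee_wpmul2l => //; rewrite lee_fin ltW.
Qed.

Let msum (g : int -> R -> \bar R) : (forall n, measurable_fun [set: R] (g n)) ->
  measurable_fun [set: R] (fun x => \sum_(n <- s) g n x)%E.
Proof. by move=> mg; apply: emeasurable_sum => n; exact: mg. Qed.

Lemma measurable_sconv m : measurable_fun [set: R] (sconv s f m).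
Proof.
apply: msum => n; apply: (@mint (fun z => f n z.2 * f (m - n) (z.1 - z.2))); first exact: mff.
by move=> z; rewrite mulr_ge0.
Qed.

Lemma sconv_ge0 m x : (0 <= sconv s f m x)%E.
Proof. by apply: sume_ge0 => n _; apply: integral_ge0 => y _; rewrite lee_fin mulr_ge0. Qed.

Lemma sconv_l2_le_fixed (C1 C2 h : R) (r : seq int) : 0 < C1 -> 0 < C2 -> 0 < h ->
  (forall m x, (\sum_(n <- s) \int[mu]_y
     (((w n y <= L m) && (w (m - n) (x - y) <= L m))%:R *
      (w n y `^ (- bt) * w (m - n) (x - y) `^ (- bt)))%:E <= C1%:E)%E) ->
  (forall (k : int) (W : R), 1 <= W ->
     (\sum_(m <- r) \int[mu]_y
       (((w (m - k) y <= W) && (L m < W))%:R * w (m - k) y `^ (- bt))%:E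
      <= (C2 * W `^ bt)%:E)%E) ->
  uniq r -> (modnorm2 s f <= h%:E)%E ->
  (\sum_(m <- r) \int[mu]_x (sconv s f m x * sconv s f m x)
    <= ((2 * C1 + 8 * C2) * h ^+ 2)%:E)%E.
Proof.
move=> C10 C20 h0 HC1 HC2 ur Hh.
have qn0 m x : (0 <= quad_near m x)%E.
  by apply: sume_ge0 => n _; apply: integral_ge0 => y _; rewrite lee_fin mulr_ge0.
have qf0 m x : (0 <= quad_far m x)%E.
  by apply: sume_ge0 => n _; apply: integral_ge0 => y _; rewrite lee_fin.
have mqn m : measurable_fun [set: R] (quad_near m) by exact: msum.
have mqf m : measurable_fun [set: R] (quad_far m) by exact: msum.
have a0 : (0 <= (2 * C1)%:E :> \bar R)%E by rewrite lee_fin mulr_ge0// ltW.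
have b0 : (0 <= (8 * h)%:E :> \bar R)%E by rewrite lee_fin mulr_ge0// ltW.
have pt m x : (sconv s f m x * sconv s f m x <=
    (2 * C1)%:E * quad_near m x + (8 * h)%:E * quad_far m x)%E.
  have cn0 : (0 <= conv_near m x)%E.
    by apply: sume_ge0 => n _; apply: integral_ge0 => y _; rewrite lee_fin.
  have cf0 : (0 <= conv_far m x)%E.
    by apply: sume_ge0 => n _; apply: integral_ge0 => y _; rewrite lee_fin.
  apply: (le_trans (lee_pmul (sconv_ge0 _ _) (sconv_ge0 _ _) (sconv_le m x) (sconv_le m x))).
  apply: (le_trans (esqrD2_le cn0 cf0)); rewrite !EFinM -!muleA; apply: leeD.
    by apply: lee_wpmul2l; [rewrite lee_fin|exact: conv_near_sqr_le].
  by apply: lee_wpmul2l; [rewrite lee_fin|exact: conv_far_sqr_le].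
have le1 m : (\int[mu]_x (sconv s f m x * sconv s f m x) <=
    (2 * C1)%:E * \int[mu]_x quad_near m x + (8 * h)%:E * \int[mu]_x quad_far m x)%E.
  rewrite -(ge0_integralZl mu _ (mqn m))// -(ge0_integralZl mu _ (mqf m))//.
  rewrite -ge0_integralD//; first last.
  - by apply: measurable_funeM; exact: mqf.
  - by move=> x _; rewrite mule_ge0.
  - by apply: measurable_funeM; exact: mqn.
  - by move=> x _; rewrite mule_ge0.
  apply: ge0_le_integral => //.
  - by move=> x _; rewrite mule_ge0// sconv_ge0.
  - by apply: emeasurable_funM; exact: measurable_sconv.
  - by apply: emeasurable_funD; apply: measurable_funeM; [exact: mqn|exact: mqf].
apply: (le_trans (lee_sum _ (fun m _ => le1 m))).
rewrite big_split/= -!ge0_sume_distrr//; last 2 first.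
- by move=> m _; apply: integral_ge0.
- by move=> m _; apply: integral_ge0.
have -> : (2 * C1 + 8 * C2) * h ^+ 2 = 2 * C1 * (h * h) + 8 * h * (C2 * h) by ring.
rewrite EFinD [(2 * C1 * _)%:E]EFinM [(8 * h * _)%:E]EFinM; apply: leeD.
  by apply: lee_wpmul2l => //; exact: quad_near_total.
by apply: lee_wpmul2l => //; exact: quad_far_total.
Qed.

End fixed.

Lemma sconv_l2_le : exists2 C : R, 0 < C &
  forall (s r : seq int) (f : int -> R -> R) (h : R),
    uniq s -> uniq r -> (forall n, measurable_fun [set: R] (f n)) ->
    (forall n x, 0 <= f n x) -> (forall n, n \notin s -> forall x, f n x = 0) ->
    0 < h -> (modnorm2 s f <= h%:E)%E ->
    (\sum_(m <- r) \int[mu]_x (sconv s f m x * sconv s f m x) <= (C * h ^+ 2)%:E)%E.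
Proof.
have [C1 C10 H1] := kernel_near_le hN hbN hc.
have [C2 C20 H2] := @kernel_far_le R N b hN.
exists (2 * C1 + 8 * C2); first by rewrite addr_gt0// mulr_gt0.
move=> s r f h us ur mf f0 fs h0 Hh.
apply: sconv_l2_le_fixed => //.
- by move=> m x; exact: H1.
- by move=> k W W1; exact: H2.
Qed.

End bilinear.

(** * Complex integrals and Plancherel *)

Section complex_modulus.
Context {R : realType}.
Implicit Types (z w : R[i]) (a : R).

Lemma ReM z w : complex.Re (z * w) = complex.Re z * complex.Re w - complex.Im z * complex.Im w.
Proof. by case: z => ? ?; case: w. Qed.

Lemma ImM z w : complex.Im (z * w) = complex.Re z * complex.Im w + complex.Im z * complex.Re w.
Proof. by case: z => ? ?; case: w. Qed.

Lemma ReD z w : complex.Re (z + w) = complex.Re z + complex.Re w.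
Proof. by case: z => ? ?; case: w. Qed.

Lemma ImD z w : complex.Im (z + w) = complex.Im z + complex.Im w.
Proof. by case: z => ? ?; case: w. Qed.

Lemma complexP z w : complex.Re z = complex.Re w -> complex.Im z = complex.Im w -> z = w.
Proof. by case: z => ? ?; case: w => ? ? /= -> ->. Qed.

Lemma normc_sqr z : normc z ^+ 2 = complex.Re z ^+ 2 + complex.Im z ^+ 2.
Proof. by case: z => a b; rewrite /normc sqr_sqrtr// addr_ge0 ?sqr_ge0. Qed.

Lemma normc_ge0 z : 0 <= normc z. Proof. by case: z => a b; exact: sqrtr_ge0. Qed.

Lemma ler_Re_normc z : `|complex.Re z| <= normc z.
Proof.
case: z => a b; rewrite -sqrtr_sqr /normc ler_wsqrtr//= lerDl sqr_ge0//.
Qed.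

Lemma ler_Im_normc z : `|complex.Im z| <= normc z.
Proof.
case: z => a b; rewrite -sqrtr_sqr /normc ler_wsqrtr//= lerDr sqr_ge0//.
Qed.

Lemma normc_real a : normc (a%:C)%C = `|a|.
Proof. by rewrite /normc/= expr0n/= addr0 sqrtr_sqr. Qed.

Lemma normc_conj z : normc (z^*)%C = normc z.
Proof. by case: z => a b; rewrite /normc/= sqrrN. Qed.

Lemma ler_normc_sum (I : Type) (s : seq I) (F : I -> R[i]) :
  normc (\sum_(i <- s) F i) <= \sum_(i <- s) normc (F i).
Proof.
elim/big_ind2 : _ => //; first by rewrite normc0.
by move=> a z c w za wc; apply: (le_trans (le_normcD z w)); exact: lerD.
Qed.

Lemma conjcM z w : ((z * w)^* = z^* * w^*)%C.
Proof. by case: z => a b; case: w => c d; apply: complexP => /=; ring. Qed.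

Lemma expiD (a c : R) : expi (a + c) = expi a * expi c.
Proof. by apply: complexP; rewrite ?ReM ?ImM/= ?cosD ?sinD//; ring. Qed.

Lemma expi0 : expi 0 = 1 :> R[i].
Proof. by rewrite /expi cos0 sin0. Qed.

Lemma expi_conj (a : R) : (expi a)^*%C = expi (- a).
Proof. by rewrite /expi/= cosN sinN. Qed.

Lemma normc_expi (a : R) : normc (expi a) = 1.
Proof. by rewrite /normc/= cos2Dsin2 sqrtr1. Qed.

End complex_modulus.

Section complex_integral.
Context d (X : measurableType d) (R : realType).
Variable mu : {measure set X -> \bar R}.
Implicit Types f g : X -> R[i].

Definition cmeas f := measurable_fun [set: X] (fun x => complex.Re (f x)) /\
  measurable_fun [set: X] (fun x => complex.Im (f x)).

Definition cintegrable f := mu.-integrable [set: X] (fun x => (complex.Re (f x))%:E) /\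
  mu.-integrable [set: X] (fun x => (complex.Im (f x))%:E).

Definition cint f : R[i] :=
  Complex (\int[mu]_x complex.Re (f x)) (\int[mu]_x complex.Im (f x)).

Lemma cmeasM f g : cmeas f -> cmeas g -> cmeas (fun x => f x * g x).
Proof.
move=> [f1 f2] [g1 g2]; split.
  under eq_fun do rewrite ReM.
  by apply: measurable_funB; exact: measurable_funM.
under eq_fun do rewrite ImM.
by apply: measurable_funD; exact: measurable_funM.
Qed.

Lemma cmeas_cst z : cmeas (fun=> z).
Proof. by split; exact: measurable_cst. Qed.

Lemma cmeas_real (f : X -> R) : measurable_fun [set: X] f -> cmeas (fun x => (f x)%:C)%C.
Proof. by move=> mf; split => //; exact: measurable_cst. Qed.

Lemma cmeas_expi (f : X -> R) : measurable_fun [set: X] f -> cmeas (fun x => expi (f x)).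
Proof.
move=> mf; split => /=.
  exact: (measurableT_comp (continuous_measurable_fun (@continuous_cos R))).
exact: (measurableT_comp (continuous_measurable_fun (@continuous_sin R))).
Qed.

Lemma cmeas_conj f : cmeas f -> cmeas (fun x => (f x)^*)%C.
Proof.
move=> [f1 f2]; split.
  by have -> : (fun x => complex.Re ((f x)^*)%C) = (fun x => complex.Re (f x));
    [apply/funext => x; case: (f x)|].
have -> : (fun x => complex.Im ((f x)^*)%C) = (fun x => - complex.Im (f x)).
  by apply/funext => x; case: (f x).
exact: measurable_funN.
Qed.

Lemma measurable_normc f : cmeas f -> measurable_fun [set: X] (fun x => normc (f x)).
Proof.
move=> [f1 f2].
have -> : (fun x => normc (f x)) =
    (fun x => Num.sqrt (complex.Re (f x) ^+ 2 + complex.Im (f x) ^+ 2)).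
  by apply/funext => x; case: (f x).
apply: (measurableT_comp (continuous_measurable_fun (@sqrt_continuous R))).
by apply: measurable_funD; exact: measurable_funX.
Qed.

Lemma cmeas_sum (I : Type) (s : seq I) (F : I -> X -> R[i]) :
  (forall i, cmeas (F i)) -> cmeas (fun x => \sum_(i <- s) F i x).
Proof.
move=> mF; elim: s => [|i s [IH1 IH2]].
  by under [X in cmeas X]eq_fun do rewrite big_nil; exact: cmeas_cst.
under [X in cmeas X]eq_fun do rewrite big_cons.
have [F1 F2] := mF i; split.
  by under eq_fun do rewrite ReD; exact: measurable_funD.
by under eq_fun do rewrite ImD; exact: measurable_funD.
Qed.

Lemma cintegrable_cmeas f : cintegrable f -> cmeas f.
Proof.
by move=> [/measurable_int f1 /measurable_int f2]; split; exact/measurable_EFinP.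
Qed.

Lemma cintegrable_dominated f (g : X -> R) : cmeas f ->
  mu.-integrable [set: X] (EFin \o g) -> (forall x, normc (f x) <= g x) -> cintegrable f.
Proof.
move=> [f1 f2] ig fg; split; apply: (le_integrable measurableT _ _ ig).
- exact/measurable_EFinP.
- move=> x _ /=; rewrite lee_fin (ger0_norm (le_trans (normc_ge0 _) (fg x))).
  exact: le_trans (ler_Re_normc _) (fg x).
- exact/measurable_EFinP.
- move=> x _ /=; rewrite lee_fin (ger0_norm (le_trans (normc_ge0 _) (fg x))).
  exact: le_trans (ler_Im_normc _) (fg x).
Qed.

Lemma integrable_normc f : cintegrable f -> mu.-integrable [set: X] (fun x => (normc (f x))%:E).
Proof.
move=> ifx; have [i1 i2] := ifx.
have ig := integrableD measurableT (integrable_abse i1) (integrable_abse i2).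
apply: (le_integrable measurableT _ _ ig).
  by apply/measurable_EFinP; apply: measurable_normc; exact: cintegrable_cmeas.
move=> x _ /=; rewrite lee_fin [leLHS]ger0_norm ?normc_ge0// [leRHS]ger0_norm ?addr_ge0//.
rewrite -(@ler_pXn2r _ 2) ?nnegrE ?normc_ge0 ?addr_ge0//.
rewrite normc_sqr sqrrD !real_normK ?num_real//.
by rewrite lerD2r lerDl mulrn_wge0// mulr_ge0.
Qed.

Lemma eq_cint f g : f =1 g -> cint f = cint g.
Proof. by move=> fg; congr cint; exact/funext. Qed.

Lemma Re_cint f : complex.Re (cint f) = \int[mu]_x complex.Re (f x). Proof. by []. Qed.
Lemma Im_cint f : complex.Im (cint f) = \int[mu]_x complex.Im (f x). Proof. by []. Qed.

Lemma cintegrableZl (z : R[i]) f : cintegrable f -> cintegrable (fun x => z * f x).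
Proof.
move=> [i1 i2]; split.
  under eq_fun do rewrite ReM EFinB !EFinM.
  by apply: integrableB => //; exact: integrableZl.
under eq_fun do rewrite ImM EFinD !EFinM.
by apply: integrableD => //; exact: integrableZl.
Qed.

Lemma cintZl (z : R[i]) f : cintegrable f -> cint (fun x => z * f x) = z * cint f.
Proof.
move=> [i1 i2]; have iZ (c : R) h : mu.-integrable [set: X] (EFin \o h) ->
    mu.-integrable [set: X] (EFin \o (fun x => c * h x)).
  by move=> ih; rewrite (_ : _ \o _ = (fun x => c%:E * (h x)%:E)%E); [exact: integrableZl|].
apply: complexP; rewrite ?ReM ?ImM !(Re_cint, Im_cint).
  under eq_Rintegral do rewrite ReM.
  rewrite RintegralB//; [|exact: iZ..].
  by rewrite !RintegralZl.
under eq_Rintegral do rewrite ImM.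
rewrite RintegralD//; [|exact: iZ..].
by rewrite !RintegralZl.
Qed.

Lemma cint0 : cint (fun=> 0) = 0.
Proof. by apply: complexP; rewrite ?Re_cint ?Im_cint/= Rintegral_cst// mul0r. Qed.

Lemma cintegrable0 : cintegrable (fun=> 0).
Proof. by split; exact: integrable0. Qed.

Lemma cintegrableD f g : cintegrable f -> cintegrable g -> cintegrable (fun x => f x + g x).
Proof.
move=> [f1 f2] [g1 g2]; split.
  by under eq_fun do rewrite ReD EFinD; exact: integrableD.
by under eq_fun do rewrite ImD EFinD; exact: integrableD.
Qed.

Lemma cintD f g : cintegrable f -> cintegrable g ->
  cint (fun x => f x + g x) = cint f + cint g.
Proof.
move=> [f1 f2] [g1 g2]; apply: complexP; rewrite ?ReD ?ImD !(Re_cint, Im_cint).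
  by under eq_Rintegral do rewrite ReD; rewrite RintegralD.
by under eq_Rintegral do rewrite ImD; rewrite RintegralD.
Qed.

Lemma cintegrable_sum (I : Type) (s : seq I) (F : I -> X -> R[i]) :
  (forall i, cintegrable (F i)) -> cintegrable (fun x => \sum_(i <- s) F i x).
Proof.
move=> iF; elim: s => [|i s IH].
  by under eq_fun do rewrite big_nil; exact: cintegrable0.
by under eq_fun do rewrite big_cons; exact: cintegrableD.
Qed.

Lemma cint_sum (I : Type) (s : seq I) (F : I -> X -> R[i]) :
  (forall i, cintegrable (F i)) ->
  cint (fun x => \sum_(i <- s) F i x) = \sum_(i <- s) cint (F i).
Proof.
move=> iF; elim: s => [|i s IH].
  by rewrite big_nil; under eq_cint do rewrite big_nil; exact: cint0.
rewrite big_cons -IH -cintD//; first by apply: eq_cint => x; rewrite big_cons.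
exact: cintegrable_sum.
Qed.

(** Multiplying by the conjugate of the integral [z] rotates it to the real number [|z|^2], so only
    the real integral of [Re (z^* f) <= |z| |f|] has to be bounded. *)
Lemma normc_cint_le f : cintegrable f -> normc (cint f) <= \int[mu]_x normc (f x).
Proof.
move=> ifx; have [->|z0] := eqVneq (cint f) 0.
  by rewrite normc0 Rintegral_ge0// => x _; exact: normc_ge0.
set z := cint f in z0 *.
have nz : 0 < normc z.
  by rewrite lt_neqAle normc_ge0 andbT eq_sym; apply: contra z0 => /eqP/eq0_normc ->.
have := cintZl (z^*)%C ifx; rewrite -/z => E.
have : normc z ^+ 2 = complex.Re (cint (fun x => (z^*)%C * f x)).
  by rewrite E normc_sqr ReM; case: (z) => a b /=; ring.
rewrite Re_cint => H.
have H2 : normc z ^+ 2 <= \int[mu]_x (normc z * normc (f x)).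
  rewrite H; apply: le_Rintegral => //.
  - by have [] := cintegrableZl (z^*)%C ifx.
  - rewrite (_ : _ \o _ = (fun x => (normc z)%:E * (normc (f x))%:E)%E)//.
    by apply: integrableZl => //; exact: integrable_normc.
  - move=> x _; rewrite -(normc_conj z) -normcM.
    exact: le_trans (ler_norm _) (ler_Re_normc _).
move: H2; rewrite RintegralZl//; last exact: integrable_normc.
by rewrite expr2 ler_pM2l.
Qed.

End complex_integral.

Section complex_fubini.
Context d1 d2 (X : measurableType d1) (Y : measurableType d2) (R : realType).
Variable m1 : {sigma_finite_measure set X -> \bar R}.
Variable m2 : {sigma_finite_measure set Y -> \bar R}.

(** Integrability is asked of every section, not of almost every one, so that the real-valued inner
    integral agrees with the extended one at each point. *)
Lemma Rintegral_integrable_section (g : X * Y -> R) :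
  (m1 \x m2)%E.-integrable [set: X * Y] (EFin \o g) ->
  (forall x, m2.-integrable [set: Y] (fun y => (g (x, y))%:E)) ->
  m1.-integrable [set: X] (EFin \o (fun x => \int[m2]_y g (x, y))).
Proof.
move=> ig i2; have := integrable_fubini_F ig.
apply: eq_integrable => // x _.
by rewrite /fubini_F /Rintegral/= fineK//; exact: integrable_fin_num.
Qed.

Lemma Rintegral_fubini1 (g : X * Y -> R) :
  (m1 \x m2)%E.-integrable [set: X * Y] (EFin \o g) ->
  (forall x, m2.-integrable [set: Y] (fun y => (g (x, y))%:E)) ->
  \int[m1]_x \int[m2]_y g (x, y) = \int[(m1 \x m2)%E]_z g z.
Proof.
move=> ig i2; rewrite /Rintegral -(integral12_prod_meas1 ig); congr fine.
apply: eq_integral => x _.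
by rewrite /fubini_F fineK//; exact: integrable_fin_num.
Qed.

Lemma Rintegral_fubini2 (g : X * Y -> R) :
  (m1 \x m2)%E.-integrable [set: X * Y] (EFin \o g) ->
  (forall y, m1.-integrable [set: X] (fun x => (g (x, y))%:E)) ->
  \int[m2]_y \int[m1]_x g (x, y) = \int[(m1 \x m2)%E]_z g z.
Proof.
move=> ig i1; rewrite /Rintegral -(integral21_prod_meas1 ig); congr fine.
apply: eq_integral => y _.
by rewrite /fubini_G fineK//; exact: integrable_fin_num.
Qed.

Lemma integrable_tensor (p : X -> R) (q : Y -> R) :
  m1.-integrable [set: X] (EFin \o p) -> m2.-integrable [set: Y] (EFin \o q) ->
  (m1 \x m2)%E.-integrable [set: X * Y] (EFin \o (fun z : X * Y => p z.1 * q z.2)).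
Proof.
move=> ip iq.
have mp : measurable_fun [set: X] p by exact/measurable_EFinP/(measurable_int _ ip).
have mq : measurable_fun [set: Y] q by exact/measurable_EFinP/(measurable_int _ iq).
have mpq : measurable_fun [set: X * Y] (fun z : X * Y => p z.1 * q z.2).
  by apply: measurable_funM; [exact: (measurableT_comp mp)|exact: (measurableT_comp mq)].
apply/integrable12ltyP; first exact/measurable_EFinP.
under eq_integral => x _.
  under eq_integral do rewrite /= normrM EFinM.
  rewrite ge0_integralZl//; last first.
    by apply/measurable_EFinP; exact: measurableT_comp.
  over.
rewrite ge0_integralZr//; first last.
- by apply: integral_ge0.
- by apply/measurable_EFinP; exact: measurableT_comp.
move/integrableP : ip => [_ ip]; move/integrableP : iq => [_ iq].
apply: lte_mul_pinfty => //; first exact: integral_ge0.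
by rewrite ge0_fin_numE//; exact: integral_ge0.
Qed.

Lemma Rintegral_tensor (p : X -> R) (q : Y -> R) :
  m1.-integrable [set: X] (EFin \o p) -> m2.-integrable [set: Y] (EFin \o q) ->
  \int[(m1 \x m2)%E]_z (p z.1 * q z.2) = (\int[m1]_x p x) * (\int[m2]_y q y).
Proof.
move=> ip iq; rewrite -Rintegral_fubini1/=.
- under eq_Rintegral do rewrite RintegralZl//.
  by rewrite RintegralZr.
- exact: integrable_tensor.
- by move=> x; under eq_fun do rewrite EFinM; exact: integrableZl.
Qed.

Lemma cint_fubini (f : X * Y -> R[i]) :
  cintegrable (m1 \x m2)%E f ->
  (forall x, cintegrable m2 (fun y => f (x, y))) ->
  (forall y, cintegrable m1 (fun x => f (x, y))) ->
  cint m1 (fun x => cint m2 (fun y => f (x, y))) =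
  cint m2 (fun y => cint m1 (fun x => f (x, y))).
Proof.
move=> [i1 i2] iy ix; apply: complexP; rewrite !(Re_cint, Im_cint)/=.
  rewrite (@Rintegral_fubini1 (fun z => complex.Re (f z)))//; last by move=> x; have [] := iy x.
  by rewrite (@Rintegral_fubini2 (fun z => complex.Re (f z)))//; move=> y; have [] := ix y.
rewrite (@Rintegral_fubini1 (fun z => complex.Im (f z)))//; last by move=> x; have [] := iy x.
by rewrite (@Rintegral_fubini2 (fun z => complex.Im (f z)))//; move=> y; have [] := ix y.
Qed.

Lemma cintegrable_section (f : X * Y -> R[i]) :
  cintegrable (m1 \x m2)%E f -> (forall x, cintegrable m2 (fun y => f (x, y))) ->
  cintegrable m1 (fun x => cint m2 (fun y => f (x, y))).
Proof.
move=> [i1 i2] iy; split.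
  by apply: (@Rintegral_integrable_section (fun z => complex.Re (f z))) => // x; have [] := iy x.
by apply: (@Rintegral_integrable_section (fun z => complex.Im (f z))) => // x; have [] := iy x.
Qed.

End complex_fubini.

(** * A local Plancherel inequality *)

Section plancherel.
Context {R : realType}.
Local Notation mu := (@lebesgue_measure R).
(* A named copy of the product measure, on which the s-finite product measure
   carries a sigma-finite structure, as Fubini's theorem requires. *)
Definition lebprod : set (measurableTypeR R * measurableTypeR R) -> \bar R :=
  (mu \x mu)%E.

HB.instance Definition _ := Measure.on lebprod.

(** The exhaustion of the line is taken increasing, so a point of the plane lies in the square
    indexed by the larger of the indices of its coordinates. *)
Lemma sigma_finite_lebprod : sigma_finite setT lebprod.
Proof.
have /sigma_finiteP[F [TF ndF Foo]] := sigma_finiteT mu.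
exists (fun n => F n `*` F n).
  apply/seteqP; split => [[x y] _|//].
  have [] : (\bigcup_n F n) x /\ (\bigcup_n F n) y by rewrite -TF.
  move=> [n _ nx] [m _ my]; exists (maxn n m) => //; split => /=.
    by move: nx; apply/subsetPset; apply: ndF; exact: leq_maxl.
  by move: my; apply/subsetPset; apply: ndF; exact: leq_maxr.
move=> k; have [? ?] := Foo k; split; first exact: measurableX.
by rewrite /lebprod product_measure1E// lte_mul_pinfty// ge0_fin_numE.
Qed.

HB.instance Definition _ := Measure_isSigmaFinite.Build _ _ _ lebprod sigma_finite_lebprod.

Local Notation mumu := lebprod.
Local Notation RR := (measurableTypeR R * measurableTypeR R)%type.

Lemma Rintegral_subr (c : R) (f : R -> R) : measurable_fun [set: R] f ->
  \int[mu]_x f (c - x) = \int[mu]_x f x.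
Proof.
move=> mf; rewrite /Rintegral.
by rewrite (integral_subr c (f := fun x => (f x)%:E))//; exact/measurable_EFinP.
Qed.

Lemma integrable_exp_absM (c : R) (f : R -> R) : 0 < c -> measurable_fun [set: R] f ->
  (forall x, `|f x| <= 1) -> mu.-integrable [set: R] (fun x => (exp_abs c x * f x)%:E).
Proof.
move=> c0 mf f1; apply: (le_integrable measurableT _ _ (integrable_exp_abs c0)).
  by apply/measurable_EFinP; apply: measurable_funM => //; exact: measurable_exp_abs.
move=> x _ /=; rewrite lee_fin normrM ler_piMr//.
Qed.

Lemma measurable_sinM (w : R) : measurable_fun [set: R] (fun x => sin (w * x)).
Proof.
apply: (measurableT_comp (continuous_measurable_fun (@continuous_sin R))).
exact: measurable_funM.
Qed.

Lemma Rintegral_exp_cos (c w : R) : 0 < c ->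
  \int[mu]_x (exp_abs c x * cos (w * x)) = 2 * (c / (c ^+ 2 + w ^+ 2)).
Proof. by move=> c0; rewrite /Rintegral integral_exp_cos. Qed.

Lemma Rintegral_exp_sin (c w : R) : 0 < c ->
  \int[mu]_x (exp_abs c x * sin (w * x)) = 0.
Proof.
move=> c0; have ms : measurable_fun [set: R] (fun x : R => exp_abs c x * sin (w * x)).
  by apply: measurable_funM; [exact: measurable_exp_abs|exact: measurable_sinM].
have H := Rintegral_subr 0 ms.
set I := RHS in H; suff : I = - I by rewrite /I; lra.
rewrite -{1}H -mulN1r -RintegralZl//; last first.
  apply: integrable_exp_absM => //; first exact: measurable_sinM.
  by move=> x; rewrite ler_norml sin_geN1 sin_le1.
apply: eq_Rintegral => x _; rewrite sub0r mulrN sinN /exp_abs normrN; ring.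
Qed.

Lemma cint_exp_expi (c w : R) : 0 < c ->
  cint mu (fun x => (exp_abs c x)%:C%C * expi (w * x)) =
  (2 * (c / (c ^+ 2 + w ^+ 2)))%:C%C.
Proof.
move=> c0; apply: complexP; rewrite ?Re_cint ?Im_cint.
  under eq_Rintegral do rewrite ReM/= mul0r subr0.
  by rewrite Rintegral_exp_cos.
under eq_Rintegral do rewrite ImM/= mul0r addr0.
by rewrite Rintegral_exp_sin.
Qed.

(** The Fourier transform of [exp_abs 1] at angular frequency [x], the case [c = 1] of
    [integral_exp_cos]. *)
Definition cauchy_kernel (x : R) : R := 2 * (oneDsqr x)^-1.

Lemma measurable_cauchy_kernel : measurable_fun [set: R] cauchy_kernel.
Proof.
apply: measurable_funM => //.
exact: (continuous_measurable_fun (@continuous_oneDsqrV R)).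
Qed.

Lemma cauchy_kernel_ge0 x : 0 <= cauchy_kernel x.
Proof. by rewrite mulr_ge0// invr_ge0 ltW// oneDsqr_gt0. Qed.

Lemma integral_cauchy_kernel : (\int[mu]_x (cauchy_kernel x)%:E = (2 * pi)%:E)%E.
Proof.
rewrite ge0_integral_even; last 3 first.
- exact: measurable_cauchy_kernel.
- exact: cauchy_kernel_ge0.
- by move=> x; rewrite /cauchy_kernel /oneDsqr sqrrN.
rewrite EFinM; congr (_ * _)%E; rewrite /cauchy_kernel.
under eq_integral do rewrite EFinM.
rewrite ge0_integralZl//; last first.
  apply/measurable_EFinP/measurable_funTS.
  exact: (continuous_measurable_fun (@continuous_oneDsqrV R)).
by rewrite integral0y_oneDsqr -EFinM; congr EFin; field.
Qed.

Definition wave (a t : R) : R[i] := expi (2 * pi * (a * t)).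

Section local_bound.
Variable c : R -> R[i].
Hypothesis ic : cintegrable mu c.
Let mc := cintegrable_cmeas ic.

Let W t := cint mu (fun l => c l * wave l t).

Let cw t l := c l * wave l t.

Let mcw t : cmeas (cw t).
Proof.
apply: cmeasM => //; apply: cmeas_expi; apply: measurable_funM => //.
exact: measurable_funM.
Qed.

Lemma cintegrable_wave t : cintegrable mu (fun l => c l * wave l t).
Proof.
apply: (@cintegrable_dominated _ _ R mu (cw t) (fun l => normc (c l))); first exact: mcw.
  exact: integrable_normc.
by move=> l; rewrite normcM normc_expi mulr1.
Qed.

Let A (z : RR) := c z.1 * (c z.2)^*%C.

Let Ew (z : RR) t : cw t z.1 * (cw t z.2)^*%C = A z * wave (z.1 - z.2) t.
Proof.
have -> : (cw t z.2)^*%C = (c z.2)^*%C * expi (- (2 * pi * (z.2 * t))).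
  by rewrite -expi_conj; exact: conjcM.
rewrite /cw /A /wave mulrACA -expiD.
by congr (_ * expi _); ring.
Qed.

Lemma normc_sqr_wave t :
  normc (W t) ^+ 2 = \int[mumu]_z complex.Re (A z * wave (z.1 - z.2) t).
Proof.
have [i1 i2] := cintegrable_wave t.
rewrite normc_sqr Re_cint Im_cint !expr2 -!Rintegral_tensor//.
rewrite -RintegralD//; [|exact: (integrable_tensor i1 i1)|exact: (integrable_tensor i2 i2)].
apply: eq_Rintegral => z _; rewrite -Ew ReM.
by rewrite /cw; case: (c z.1 * _) => a b; case: (c z.2 * _) => a' b' /=; rewrite mulrN opprK.
Qed.

Let g (z : measurableTypeR R * RR) := exp_abs 1 z.1 * complex.Re (A z.2 * wave (z.2.1 - z.2.2) z.1).

Let mA : cmeas A.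
Proof.
have [c1 c2] := mc.
apply: (@cmeasM _ _ _ (fun z : RR => c z.1) (fun z => (c z.2)^*%C)).
  by split; [exact: (measurableT_comp c1)|exact: (measurableT_comp c2)].
apply: cmeas_conj.
by split; [exact: (measurableT_comp c1)|exact: (measurableT_comp c2)].
Qed.

Let mAw : cmeas (fun z : measurableTypeR R * RR => A z.2 * wave (z.2.1 - z.2.2) z.1).
Proof.
have [A1 A2] := mA; apply: cmeasM.
  by split; [exact: (measurableT_comp A1)|exact: (measurableT_comp A2)].
apply: cmeas_expi; apply: measurable_funM => //; apply: measurable_funM => //.
by apply: measurable_funB; apply: measurableT_comp.
Qed.

Let mg : measurable_fun [set: measurableTypeR R * RR] g.
Proof.
apply: measurable_funM; first exact: (measurableT_comp (measurable_exp_abs 1)).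
by have [] := mAw.
Qed.

Let B (z : RR) := normc (c z.1) * normc (c z.2).

Let normA z : normc (A z) = B z. Proof. by rewrite normcM normc_conj. Qed.

Let iB : mumu.-integrable [set: RR] (EFin \o B).
Proof.
apply: (@integrable_tensor _ _ (measurableTypeR R) (measurableTypeR R) R mu mu
  (fun l => normc (c l)) (fun l => normc (c l))); exact: integrable_normc.
Qed.

Let iA : cintegrable mumu A.
Proof. by apply: (@cintegrable_dominated _ _ R mumu _ _ mA iB) => z; rewrite normA. Qed.

Let g_le z : `|g z| <= exp_abs 1 z.1 * B z.2.
Proof.
rewrite normrM ger0_norm ?exp_abs_ge0// ler_wpM2l ?exp_abs_ge0//.
by apply: (le_trans (ler_Re_normc _)); rewrite normcM normc_expi mulr1 normA.
Qed.

Let ig : (mu \x mumu)%E.-integrable [set: measurableTypeR R * RR] (EFin \o g).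
Proof.
have i1 := @integrable_tensor _ _ (measurableTypeR R) _ R mu mumu _ _ (integrable_exp_abs (@ltr01 R)) iB.
apply: (le_integrable measurableT _ _ i1); first exact/measurable_EFinP.
by move=> z _ /=; rewrite lee_fin (le_trans (g_le z))// ler_norm.
Qed.

Let g_section t : mumu.-integrable [set: RR] (fun z => (g (t, z))%:E).
Proof.
have i1 : mumu.-integrable [set: RR] (fun z => (exp_abs 1 t)%:E * (B z)%:E)%E.
  exact: integrableZl.
apply: (le_integrable measurableT _ _ i1).
  by apply/measurable_EFinP; exact: (measurable_fun_pair2 t mg).
by move=> z _ /=; rewrite lee_fin (le_trans (g_le (t, z)))// ler_norm.
Qed.

Let WE t : (exp_abs 1 t * normc (W t) ^+ 2)%:E = fubini_F mumu (EFin \o g) t.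
Proof.
have -> : exp_abs 1 t * normc (W t) ^+ 2 = \int[mumu]_z g (t, z).
  rewrite normc_sqr_wave -RintegralZl//.
  have [|z|//] := @cintegrable_dominated _ _ R mumu (fun z => A z * wave (z.1 - z.2) t) _ _ iB.
    by have [m1 m2] := mAw; split; [exact: (measurable_fun_pair2 t m1)|exact: (measurable_fun_pair2 t m2)].
  by rewrite normcM normc_expi mulr1 normA.
by rewrite /fubini_F /Rintegral fineK//; exact: integrable_fin_num.
Qed.

(** The damped square is a section integral in Fubini's theorem, hence measurable; the damping
    factor never vanishes and is divided out. *)
Lemma measurable_normc_wave : measurable_fun [set: R] (fun t => normc (W t) ^+ 2).
Proof.
have -> : (fun t => normc (W t) ^+ 2) =
    (fun t => (exp_abs 1 t)^-1 * fine (fubini_F mumu (EFin \o g) t)).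
  apply/funext => t; rewrite -WE/= mulrA mulVf ?mul1r//.
  by rewrite gt_eqF ?expR_gt0.
apply: measurable_funM.
  have -> : (fun t : R => (exp_abs 1 t)^-1) = (fun t => expR `|t|).
    by apply/funext => t; rewrite /exp_abs mul1r expRN invrK.
  exact: (measurableT_comp (@measurable_expR R)).
apply: (measurableT_comp (@fine_measurable R setT measurableT)).
exact: (@measurable_fubini_F _ _ _ _ R mu mumu _ ig).
Qed.

Let K (x : R) := 2 * (1 / (1 ^+ 2 + (2 * pi * x) ^+ 2)).

Let K0 x : 0 <= K x.
Proof. by rewrite mulr_ge0// divr_ge0// addr_ge0// sqr_ge0. Qed.

(** The factor [2 pi] in the argument is dropped, as it is at least 1; only a constant is lost. *)
Let K_le x : K x <= cauchy_kernel x.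
Proof.
rewrite /K /cauchy_kernel ler_wpM2l// mul1r expr1n /oneDsqr lef_pV2 ?posrE ?ltr_pwDl ?sqr_ge0//.
rewrite lerD2l exprMn ler_peMl ?sqr_ge0//.
have : 2 <= pi :> R by exact: pi_ge2.
by move=> p2; rewrite exprMn; nra.
Qed.

Let inner z : (\int[mu]_t (g (t, z))%:E = (complex.Re (A z) * K (z.1 - z.2))%:E)%E.
Proof.
pose w := 2 * pi * (z.1 - z.2).
have gE t : g (t, z) = complex.Re (A z) * (exp_abs 1 t * cos (w * t)) -
    complex.Im (A z) * (exp_abs 1 t * sin (w * t)).
  by rewrite /g ReM /wave /expi/= /w !mulrA; ring.
have c1 x : `|cos x| <= 1 :> R by rewrite ler_norml cos_geN1 cos_le1.
have s1 x : `|sin x| <= 1 :> R by rewrite ler_norml sin_geN1 sin_le1.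
have ic1 := integrable_exp_absM (@ltr01 R) (measurable_cosM w) (fun x => c1 _).
have is1 := integrable_exp_absM (@ltr01 R) (measurable_sinM w) (fun x => s1 _).
under eq_integral do rewrite gE EFinB !EFinM.
rewrite integralB//; [|exact: integrableZl|exact: integrableZl].
rewrite !integralZl// integral_exp_cos// .
have -> : (\int[mu]_x (exp_abs 1 x * sin (w * x))%:E = 0)%E.
  rewrite -[LHS]fineK; last exact: integrable_fin_num.
  by rewrite -[fine _]/(\int[mu]_x (exp_abs 1 x * sin (w * x))) Rintegral_exp_sin.
by rewrite mule0 sube0.
Qed.

(* [normc (W t) ^+ 2] is a double integral over frequencies; integrating in [t]
   first leaves a kernel dominated by [cauchy_kernel], to which Schur's test
   applies. *)
Lemma plancherel_weighted :
  (\int[mu]_t (exp_abs 1 t * normc (W t) ^+ 2)%:E <=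
   (2 * pi)%:E * \int[mu]_l (normc (c l) ^+ 2)%:E)%E.
Proof.
under eq_integral do rewrite WE.
rewrite (@integral12_prod_meas1 _ _ _ _ R mu mumu _ ig) -(@integral21_prod_meas1 _ _ _ _ R mu mumu _ ig).
under eq_integral do rewrite /fubini_G inner.
have mn2 : measurable_fun [set: R] (fun l => normc (c l) ^+ 2).
  by apply: measurable_funX; exact: measurable_normc.
have mk1 : measurable_fun [set: RR] (fun z : RR => cauchy_kernel (z.1 - z.2)).
  apply: (measurableT_comp measurable_cauchy_kernel).
  by apply: measurable_funB; [exact: measurable_fst|exact: measurable_snd].
(* Schur's test: the product of the moduli is at most half the sum of their squares, and each half
   contributes [pi] times the squared norm because the kernel has integral [2 * pi] in either
   variable. *)
pose D1 (z : RR) := 2^-1 * (normc (c z.1) ^+ 2 * cauchy_kernel (z.1 - z.2)).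
pose D2 (z : RR) := 2^-1 * (normc (c z.2) ^+ 2 * cauchy_kernel (z.1 - z.2)).
have D10 z : 0 <= D1 z by rewrite mulr_ge0 ?invr_ge0// mulr_ge0 ?sqr_ge0 ?cauchy_kernel_ge0.
have D20 z : 0 <= D2 z by rewrite mulr_ge0 ?invr_ge0// mulr_ge0 ?sqr_ge0 ?cauchy_kernel_ge0.
have mD1 : measurable_fun [set: RR] D1.
  apply: measurable_funM => //; apply: measurable_funM => //.
  exact: (measurableT_comp mn2).
have mD2 : measurable_fun [set: RR] D2.
  apply: measurable_funM => //; apply: measurable_funM => //.
  exact: (measurableT_comp mn2).
have mAK : measurable_fun [set: RR] (fun z => complex.Re (A z) * K (z.1 - z.2)).
  apply: measurable_funM; first by have [] := mA.
  have -> : (fun z : RR => K (z.1 - z.2)) =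
      (fun z => 2 * (oneDsqr (2 * pi * (z.1 - z.2)))^-1).
    by apply/funext => z; rewrite /K /oneDsqr expr1n mul1r.
  apply: measurable_funM => //.
  apply: (measurableT_comp (continuous_measurable_fun (@continuous_oneDsqrV R))).
  apply: measurable_funM => //.
  by apply: measurable_funB; [exact: measurable_fst|exact: measurable_snd].
apply: (@le_trans _ _ (\int[mumu]_z ((D1 z)%:E + (D2 z)%:E))%E).
  apply: (@le_trans _ _ (\int[mumu]_z `|(complex.Re (A z) * K (z.1 - z.2))%:E|)%E).
    apply: (le_trans (lee_abs _)); apply: le_abse_integral => //.
    exact/measurable_EFinP.
  apply: ge0_le_integral => //.
  - by apply: measurableT_comp => //; exact/measurable_EFinP.
  - by apply: emeasurable_funD; exact/measurable_EFinP.
  - move=> z _; rewrite abse_EFin -EFinD lee_fin normrM (ger0_norm (K0 _)).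
    apply: (@le_trans _ _ (B z * cauchy_kernel (z.1 - z.2))).
      by apply: ler_pM => //; rewrite -normA; exact: ler_Re_normc.
    rewrite /D1 /D2 -mulrDr -mulrDl mulrA ler_wpM2r ?cauchy_kernel_ge0// /B.
    by have := sqr_ge0 (normc (c z.1) - normc (c z.2)); nra.
rewrite ge0_integralD//; first last.
- exact/measurable_EFinP.
- by move=> z _; rewrite lee_fin.
- exact/measurable_EFinP.
- by move=> z _; rewrite lee_fin.
have inner2 (l : R) (h : R -> R) : measurable_fun [set: R] h -> (forall x, 0 <= h x) ->
    (\int[mu]_x (h x)%:E = (2 * pi)%:E)%E ->
    (\int[mu]_x (2^-1 * (normc (c l) ^+ 2 * h x))%:E = pi%:E * (normc (c l) ^+ 2)%:E)%E.
  move=> mh h0 h1; under eq_integral do rewrite mulrA EFinM.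
  rewrite ge0_integralZl//; last 3 first.
  - exact/measurable_EFinP.
  - by move=> x _; rewrite lee_fin.
  - by rewrite lee_fin mulr_ge0 ?sqr_ge0.
  by rewrite h1 -!EFinM; congr EFin; field.
have mk (h : R -> R) : measurable_fun [set: R] h ->
  measurable_fun [set: R] (fun x => cauchy_kernel (h x)).
  exact: (measurableT_comp measurable_cauchy_kernel).
have outer : (\int[mu]_l (pi%:E * (normc (c l) ^+ 2)%:E) =
    pi%:E * \int[mu]_l (normc (c l) ^+ 2)%:E)%E.
  rewrite ge0_integralZl//; last 2 first.
  - by move=> l _; rewrite lee_fin sqr_ge0.
  - by rewrite lee_fin pi_ge0.
  exact/measurable_EFinP.
have mck : measurable_fun [set: R] (EFin \o cauchy_kernel).
  by apply/measurable_EFinP; exact: measurable_cauchy_kernel.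
have ck0 x : (0 <= (cauchy_kernel x)%:E)%E by rewrite lee_fin cauchy_kernel_ge0.
have E1 : (\int[mumu]_z (D1 z)%:E = pi%:E * \int[mu]_l (normc (c l) ^+ 2)%:E)%E.
  rewrite -outer (fubini_tonelli1 (EFin \o D1))//; last exact/measurable_EFinP.
  apply: eq_integral => l _; apply: (inner2 l (fun x => cauchy_kernel (l - x))) => [|x|];
    [by apply: (mk (fun x => l - x)); exact: measurable_subr|exact: cauchy_kernel_ge0|].
  by rewrite (ge0_integral_subr l (f := EFin \o cauchy_kernel))//= integral_cauchy_kernel.
have E2 : (\int[mumu]_z (D2 z)%:E = pi%:E * \int[mu]_l (normc (c l) ^+ 2)%:E)%E.
  rewrite -outer (fubini_tonelli2 (EFin \o D2))//; last exact/measurable_EFinP.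
  apply: eq_integral => l _; apply: (inner2 l (fun x => cauchy_kernel (x - l))) => [|x|];
    [by apply: (mk (fun x => x - l)); exact: measurable_funD|exact: cauchy_kernel_ge0|].
  by rewrite (ge0_integral_addr (- l) (f := EFin \o cauchy_kernel))//= integral_cauchy_kernel.
have I0 : (0 <= \int[mu]_l (normc (c l) ^+ 2)%:E)%E.
  by apply: integral_ge0 => l _; rewrite lee_fin sqr_ge0.
have p0 : (0 <= pi%:E :> \bar R)%E by rewrite lee_fin pi_ge0.
by rewrite E1 E2 EFinM -muleA mule2_ge0// mule_ge0.
Qed.

(** On [[0, T]] the damping [exp_abs 1] is at least [expR (- T)], which is the origin of the factor
    [expR T]. *)
Lemma plancherel_local (T : R) :
  (\int[mu]_(t in `[0%R, T]) (normc (W t) ^+ 2)%:E <=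
   (expR T * (2 * pi))%:E * \int[mu]_l (normc (c l) ^+ 2)%:E)%E.
Proof.
have mE : measurable_fun [set: R] (fun t => exp_abs 1 t * normc (W t) ^+ 2).
  by apply: measurable_funM; [exact: measurable_exp_abs|exact: measurable_normc_wave].
rewrite EFinM -muleA.
apply: le_trans (lee_wpmul2l _ plancherel_weighted); last by rewrite lee_fin expR_ge0.
rewrite -ge0_integralZl//; first last.
- by move=> t _; rewrite lee_fin mulr_ge0 ?exp_abs_ge0 ?sqr_ge0.
- exact/measurable_EFinP.
rewrite [leLHS]integral_mkcond; apply: ge0_le_integral => //.
- by move=> t _; rewrite patchE; case: ifPn => // _; rewrite lee_fin sqr_ge0.
- apply/measurable_restrict => //; apply/measurable_EFinP/measurable_funTS.
  exact: measurable_normc_wave.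
- by apply: measurable_funeM; exact/measurable_EFinP.
- move=> t _; rewrite patchE; case: ifPn; last first.
    by move=> _; rewrite -EFinM (_ : point = 0%E)// lee_fin mulr_ge0 ?expR_ge0// mulr_ge0 ?exp_abs_ge0 ?sqr_ge0.
  rewrite inE/= in_itv/= => /andP[t0 tT]; rewrite -EFinM lee_fin mulrA ler_peMl ?sqr_ge0//.
  by rewrite /exp_abs mul1r ger0_norm// -expRD -expR0 ler_expR subr_ge0.
Qed.

End local_bound.
End plancherel.

(** * The L^4 bound for trigonometric sums *)

Section parseval.
Context {R : realType}.
Local Notation mu := (@lebesgue_measure R).

Lemma expi_int (j : int) : expi (2 * pi * j%:~R) = 1 :> R[i].
Proof.
have H (n : nat) : expi (2 * pi * n%:R) = 1 :> R[i].
  elim: n => [|n IH]; first by rewrite mulr0 expi0.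
  rewrite -[n.+1]addn1 natrD mulrDr mulr1 expiD IH mul1r /expi mulr_natl cos2pi sin2pi.
  by apply: complexP.
case: j => n; first exact: H.
have <- : (expi (2 * pi * n.+1%:R))^*%C = 1 :> R[i] by rewrite H; apply: complexP => //=; rewrite oppr0.
by rewrite expi_conj NegzE mulrNz mulrN.
Qed.

Lemma measurable_torus : measurable (@torus R : set (measurableTypeR R)).
Proof. exact: measurable_itv. Qed.

Lemma Re_waveE (z : R[i]) (a t : R) : complex.Re (z * wave a t) =
  complex.Re z * cos (2 * pi * (a * t)) - complex.Im z * sin (2 * pi * (a * t)).
Proof. by rewrite ReM. Qed.

Lemma ler_Re_wave (z : R[i]) (a t : R) : `|complex.Re (z * wave a t)| <= normc z.
Proof. by apply: (le_trans (ler_Re_normc _)); rewrite normcM normc_expi mulr1. Qed.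

Lemma measurable_Re_wave (z : R[i]) (a : R) :
  measurable_fun [set: R] (fun t => complex.Re (z * wave a t)).
Proof.
have [] // : cmeas (fun t : measurableTypeR R => z * wave a t).
apply: cmeasM; first exact: cmeas_cst.
by apply: cmeas_expi; apply: measurable_funM => //; exact: measurable_funM.
Qed.

Lemma integrable_torus_bounded (f : R -> R) (M : R) : measurable_fun [set: R] f ->
  (forall x, `|f x| <= M) -> mu.-integrable torus (EFin \o f).
Proof.
move=> mf fM; apply: (@le_integrable _ _ _ mu torus measurable_torus _ (fun=> M%:E)).
- by apply/measurable_EFinP; exact: measurable_funTS.
- by move=> x _ /=; rewrite lee_fin (le_trans (fM x))// ler_norm.
- apply/integrableP; split; first exact: measurable_cst.
  rewrite integral_cst//=; last exact: measurable_torus.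
  by rewrite lebesgue_measure_itv/= lte_fin ltr01 -EFinD -EFinM ltry.
Qed.

Lemma Rintegral_torus_wave (z : R[i]) (j : int) :
  \int[mu]_(x in torus) complex.Re (z * wave j%:~R x) = (j == 0)%:R * complex.Re z.
Proof.
rewrite /Rintegral; have [->|j0] := eqVneq j 0.
  rewrite (eq_integral (fun=> (complex.Re z)%:E)); last first.
    by move=> x _; rewrite /wave mul0r mulr0 expi0 mulr1.
  rewrite integral_cst//=; last exact: measurable_torus.
  by rewrite lebesgue_measure_itv/= lte_fin ltr01 oppr0 adde0 mule1 mul1r.
rewrite mul0r /torus integral_itv_bndo_bndc; last first.
  by apply/measurable_EFinP; apply: measurable_funTS; exact: measurable_Re_wave.
have p0 : 2 * pi * j%:~R != 0 :> R by rewrite !mulf_neq0 ?intr_eq0// gt_eqF ?pi_gt0.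
(* A primitive that is 1-periodic because [j] is an integer, so its values at 0 and 1 coincide. *)
pose F x := (2 * pi * j%:~R)^-1 *
  (complex.Re z * sin (2 * pi * j%:~R * x) + complex.Im z * cos (2 * pi * j%:~R * x)).
have dF (x : R) : is_derive x 1 F (complex.Re (z * wave j%:~R x)).
  rewrite Re_waveE /F; apply: is_derive_eq.
  have j1 : j%:~R != 0 :> R by rewrite intr_eq0.
  have := lt0r_neq0 (pi_gt0 R); rewrite !mulrA /GRing.scale/=.
  by move: (pi : R) (j%:~R : R) j1 => q k k0 q0; field; rewrite k0 q0.
rewrite (@integral_itv_is_derive _ _ F 0 1 ler01 (fun x _ => dF x))/=.
  rewrite /F mulr1 mulr0 cos0 sin0.
  have := expi_int j; rewrite /expi => -[-> ->]; ring.
move=> x _; rewrite (funext (fun y => Re_waveE z j%:~R y)).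
have cl : {for x, continuous (fun y : R => 2 * pi * (j%:~R * y))}.
  by apply: cvgM; [exact: cvg_cst|apply: cvgM; [exact: cvg_cst|exact: cvg_id]].
apply: cvgB; (apply: cvgM; first exact: cvg_cst).
  exact: (continuous_comp cl (@continuous_cos R _)).
exact: (continuous_comp cl (@continuous_sin R _)).
Qed.

Lemma Rintegral_sum d (X : measurableType d) (nu : {measure set X -> \bar R})
  (D : set X) (I : Type) (r : seq I) (F : I -> X -> R) : measurable D ->
  (forall i, nu.-integrable D (EFin \o F i)) ->
  nu.-integrable D (EFin \o (fun x => \sum_(i <- r) F i x)) /\
  \int[nu]_(x in D) (\sum_(i <- r) F i x) = \sum_(i <- r) \int[nu]_(x in D) F i x.
Proof.
move=> mD iF; elim: r => [|i r [IH1 IH2]].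
  rewrite big_nil; split.
    rewrite (_ : _ \o _ = cst 0%E); first exact: integrable0.
    by apply/funext => x /=; rewrite big_nil.
  rewrite /Rintegral (eq_integral (cst 0%E)) ?integral0//.
  by move=> x _; rewrite big_nil.
split.
  rewrite (_ : _ \o _ = (EFin \o F i) \+ (EFin \o (fun x => \sum_(j <- r) F j x)%R))%E.
    exact: integrableD.
  by apply/funext => x /=; rewrite big_cons.
rewrite big_cons -IH2 -RintegralD//.
by apply: eq_Rintegral => x _; rewrite big_cons.
Qed.

Lemma waveB (a c t : R) : wave (a - c) t = wave a t * (wave c t)^*%C.
Proof. by rewrite /wave expi_conj -expiD; congr expi; ring. Qed.

Lemma conjc_sum (I : Type) (r : seq I) (F : I -> R[i]) :
  (\sum_(i <- r) F i)^*%C = \sum_(i <- r) (F i)^*%C.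
Proof.
elim: r => [|i r IH]; first by rewrite !big_nil; apply: complexP; rewrite //= oppr0.
rewrite !big_cons -IH; case: (F i) => p q; case: (\sum_(j <- r) _) => p' q'.
by apply: complexP => //=; rewrite opprD.
Qed.

Lemma Re_sum (I : Type) (r : seq I) (F : I -> R[i]) :
  complex.Re (\sum_(i <- r) F i) = \sum_(i <- r) complex.Re (F i).
Proof. by elim: r => [|i r IH]; rewrite ?big_nil// !big_cons -IH ReD. Qed.

Lemma normc_sqr_Re (z : R[i]) : normc z ^+ 2 = complex.Re (z * z^*%C).
Proof. by rewrite normc_sqr ReM; case: z => p q /=; ring. Qed.

Lemma parseval (r : seq int) (c : int -> R[i]) : uniq r ->
  (\int[mu]_(x in torus) (normc (\sum_(m <- r) c m * wave m%:~R x) ^+ 2)%:E =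
   (\sum_(m <- r) normc (c m) ^+ 2)%:E)%E.
Proof.
move=> ur.
pose g (m k : int) (x : R) := complex.Re (c m * (c k)^*%C * wave (m - k)%:~R x).
have ig m k : mu.-integrable torus (EFin \o g m k).
  apply: (@integrable_torus_bounded _ (normc (c m * (c k)^*%C))).
    exact: measurable_Re_wave.
  by move=> x; exact: ler_Re_wave.
have E x : normc (\sum_(m <- r) c m * wave m%:~R x) ^+ 2 =
    \sum_(m <- r) \sum_(k <- r) g m k x.
  rewrite normc_sqr_Re conjc_sum mulr_suml Re_sum; apply: eq_bigr => m _.
  rewrite mulr_sumr Re_sum; apply: eq_bigr => k _.
  by rewrite /g intrB waveB conjcM mulrACA.
have i1 m := (Rintegral_sum r measurable_torus (ig m)).1.
have [i2 E2] := Rintegral_sum r measurable_torus i1.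
under eq_integral do rewrite E.
rewrite -[LHS]fineK; last by apply: integrable_fin_num; [exact: measurable_torus|exact: i2].
rewrite -[fine _]/(\int[mu]_(x in torus) _) E2; congr EFin.
apply: eq_big_seq => m mr.
rewrite (Rintegral_sum r measurable_torus (ig m)).2 (bigD1_seq m)//=.
rewrite [X in _ + X]big1_seq ?addr0 => [|k /andP[km _]].
  by rewrite Rintegral_torus_wave subrr eqxx mul1r normc_sqr_Re.
by rewrite Rintegral_torus_wave subr_eq0 eq_sym (negbTE km) mul0r.
Qed.

End parseval.

(** * The convolution theorem for exponentially decaying coefficients *)

Section convolution.
Context {R : realType}.
Local Notation mu := (@lebesgue_measure R).
Local Notation RR := (measurableTypeR R * measurableTypeR R)%type.
Variables (A e : R).
Hypothesis e0 : 0 < e.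

(** Such a function is both bounded and integrable, so its convolutions converge at every point and
    Fubini's theorem applies. *)
Definition exp_dominated (a : R -> R[i]) :=
  cmeas (a : measurableTypeR R -> _) /\ forall l, normc (a l) <= A * exp_abs e l.

Lemma exp_dominated_integrable (a : R -> R[i]) : exp_dominated a -> cintegrable mu a.
Proof.
move=> [ma aA]; apply: (@cintegrable_dominated _ _ R mu a (fun l => A * exp_abs e l)) => //.
have := integrableZl measurableT A (integrable_exp_abs e0).
by apply: eq_integrable.
Qed.

Variables (a a' : R -> R[i]).
Hypotheses (ha : exp_dominated a) (ha' : exp_dominated a').

Let A0 : 0 <= A.
Proof.
have := le_trans (normc_ge0 _) (ha.2 0).
by rewrite pmulr_lge0// expR_gt0.
Qed.

Let mpair : cmeas (fun z : RR => a z.2 * a' (z.1 - z.2)).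
Proof.
have [[m1 m2] _] := ha; have [[m1' m2'] _] := ha'.
have ms : measurable_fun [set: RR] (fun z : RR => z.1 - z.2).
  by apply: measurable_funB; [exact: measurable_fst|exact: measurable_snd].
apply: cmeasM; split.
- exact: (measurableT_comp m1).
- exact: (measurableT_comp m2).
- exact: (measurableT_comp m1').
- exact: (measurableT_comp m2').
Qed.

Let expM1 l : exp_abs e l <= 1.
Proof. by rewrite /exp_abs -expR0 ler_expR oppr_le0 mulr_ge0// ltW. Qed.

Let iexpA : mu.-integrable [set: R] (EFin \o (fun y => A * exp_abs e y * A)).
Proof.
have := integrableZl measurableT (A * A) (integrable_exp_abs e0).
by apply: eq_integrable => // x _; rewrite /= -EFinM mulrAC.
Qed.

Lemma cintegrable_conv (x : R) : cintegrable mu (fun y => a y * a' (x - y)).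
Proof.
apply: (@cintegrable_dominated _ _ R mu _ (fun y => A * exp_abs e y * A)) => //.
  by have [m1 m2] := mpair; split;
    [exact: (measurable_fun_pair2 x m1)|exact: (measurable_fun_pair2 x m2)].
move=> y; rewrite normcM; apply: ler_pM; rewrite ?normc_ge0//; first exact: ha.2.
by apply: (le_trans (ha'.2 _)); rewrite -[leRHS]mulr1 ler_wpM2l.
Qed.

Let cintegrable_pair : cintegrable lebprod (fun z : RR => a z.2 * a' (z.1 - z.2)).
Proof.
pose g (z : RR) := (A * exp_abs e z.2) * (A * exp_abs e (z.1 - z.2)).
have mg : measurable_fun [set: RR] g.
  apply: measurable_funM; apply: measurable_funM => //.
    exact: (measurableT_comp (measurable_exp_abs e)).
  apply: (measurableT_comp (measurable_exp_abs e)).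
  by apply: measurable_funB; [exact: measurable_fst|exact: measurable_snd].
have g0 z : 0 <= g z by rewrite mulr_ge0 ?mulr_ge0 ?exp_abs_ge0.
apply: (@cintegrable_dominated _ _ R lebprod _ g) => //; last first.
  move=> z; rewrite normcM; apply: ler_pM; rewrite ?normc_ge0//; [exact: ha.2|exact: ha'.2].
apply/integrableP; split; first exact/measurable_EFinP.
have -> : (\int[lebprod]_z `|(EFin \o g) z| = \int[mu]_y \int[mu]_x (g (x, y))%:E)%E.
  rewrite (eq_integral (EFin \o g)); last first.
    by move=> z _; rewrite /= ger0_norm.
  by rewrite (fubini_tonelli2 (EFin \o g))//; exact/measurable_EFinP.
have iE (c : R) : (\int[mu]_x (exp_abs e (x - c))%:E = \int[mu]_x (exp_abs e x)%:E)%E.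
  rewrite (ge0_integral_addr (- c) (f := fun x => (exp_abs e x)%:E))//.
    by apply/measurable_EFinP; exact: measurable_exp_abs.
  by move=> x; rewrite lee_fin exp_abs_ge0.
set I := (\int[mu]_x (exp_abs e x)%:E)%E in iE.
have Ifin : I \is a fin_num by exact: integrable_fin_num (integrable_exp_abs e0).
have -> : (\int[mu]_y \int[mu]_x (g (x, y))%:E =
    \int[mu]_y (A * exp_abs e y * A * fine I)%:E)%E.
  apply: eq_integral => y _; rewrite /g/=.
  under eq_integral do rewrite mulrA EFinM.
  rewrite ge0_integralZl//; last 3 first.
  - apply/measurable_EFinP; apply: (measurableT_comp (measurable_exp_abs e)).
    exact: measurable_funD.
  - by move=> x _; rewrite lee_fin exp_abs_ge0.
  - by rewrite lee_fin mulr_ge0// mulr_ge0// exp_abs_ge0.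
  by rewrite iE [RHS]EFinM fineK.
have := integrable_fin_num measurableT
  (integrableZl measurableT (A * A * fine I) (integrable_exp_abs e0)).
rewrite ge0_fin_numE; last first.
  apply: integral_ge0 => x _; rewrite -EFinM lee_fin !mulr_ge0 ?exp_abs_ge0//.
  by rewrite fine_ge0// integral_ge0// => y _; rewrite lee_fin exp_abs_ge0.
by congr (_ < _)%E; apply: eq_integral => x _; rewrite -EFinM; congr EFin; ring.
Qed.

Lemma cintegrable_conv_cint : cintegrable mu (fun x => cint mu (fun y => a y * a' (x - y))).
Proof.
exact: (@cintegrable_section _ _ _ _ R mu mu _ cintegrable_pair cintegrable_conv).
Qed.

Lemma waveD (p q t : R) : wave (p + q) t = wave p t * wave q t.
Proof. by rewrite /wave -expiD; congr expi; ring. Qed.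

Lemma cint_subr (f : R -> R[i]) (c : R) : cintegrable mu f ->
  cintegrable mu (fun x => f (x - c)) /\ cint mu (fun x => f (x - c)) = cint mu f.
Proof.
have iD (g : R -> R) : mu.-integrable [set: R] (EFin \o g) ->
    mu.-integrable [set: R] (EFin \o (fun x => g (x - c))).
  move=> /integrableP[/measurable_EFinP mg ig]; apply/integrableP; split.
    by apply/measurable_EFinP; apply: (measurableT_comp mg); exact: measurable_funD.
  rewrite (ge0_integral_addr (- c) (f := fun x => `|(g x)%:E|%E))//.
  by apply: measurableT_comp => //; exact/measurable_EFinP.
have eD (g : R -> R) : measurable_fun [set: R] g ->
    \int[mu]_x g (x - c) = \int[mu]_x g x.
  move=> mg; rewrite /Rintegral; congr fine.
  by rewrite (integral_addr (- c) (f := fun x => (g x)%:E))//; exact/measurable_EFinP.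
move=> [/[dup] i1 /measurable_int/measurable_EFinP m1 /[dup] i2 /measurable_int/measurable_EFinP m2].
split; first by split; [exact: iD i1|exact: iD i2].
apply: complexP; rewrite ?Re_cint ?Im_cint.
  exact: (eD (fun x => complex.Re (f x))).
exact: (eD (fun x => complex.Im (f x))).
Qed.

(** Fubini together with [wave x t = wave (x - y) t * wave y t]: the inner integral in [x] is a
    translate of the second factor. *)
Lemma wave_product (t : R) :
  cint mu (fun l => a l * wave l t) * cint mu (fun l => a' l * wave l t) =
  cint mu (fun x => cint mu (fun y => a y * a' (x - y)) * wave x t).
Proof.
have ia := cintegrable_wave (exp_dominated_integrable ha) t.
have ia' := cintegrable_wave (exp_dominated_integrable ha') t.
rewrite mulrC -cintZl//.
pose f (z : RR) := a z.2 * a' (z.1 - z.2) * wave z.1 t.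
have ifz : cintegrable lebprod f.
  have [m1 m2] := mpair.
  apply: (@cintegrable_dominated _ _ R lebprod f
    (fun z => normc (a z.2 * a' (z.1 - z.2)))).
  - apply: cmeasM => //; apply: cmeas_expi; apply: measurable_funM => //.
    by apply: measurable_funM => //; exact: measurable_fst.
  - exact: (@integrable_normc _ _ R lebprod _ cintegrable_pair).
  - by move=> z; rewrite /f normcM normc_expi mulr1.
have ify x : cintegrable mu (fun y => f (x, y)).
  rewrite /f/=; under eq_fun do rewrite mulrC.
  exact: cintegrableZl (cintegrable_conv x).
have ifx y : cintegrable mu (fun x => f (x, y)).
  rewrite /f/=.
  have -> : (fun x => a y * a' (x - y) * wave x t) =
      (fun x => (a y * wave y t) * (a' (x - y) * wave (x - y) t)).
    apply/funext => x.
    have -> : wave x t = wave (x - y) t * wave y t by rewrite -waveD subrK.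
    by ring.
  apply: cintegrableZl.
  exact: (cint_subr y ia').1.
have := @cint_fubini _ _ _ _ R mu mu f ifz ify ifx.
have -> : (fun x => cint mu (fun y => f (x, y))) =
    (fun x => cint mu (fun y => a y * a' (x - y)) * wave x t).
  apply/funext => x; rewrite mulrC -cintZl; last exact: cintegrable_conv.
  by apply: eq_cint => y; rewrite mulrC.
move=> ->; apply: eq_cint => y.
rewrite mulrC -(cint_subr y ia').2 -cintZl; last exact: (cint_subr y ia').1.
apply: eq_cint => x; rewrite /f/=.
have -> : wave x t = wave (x - y) t * wave y t by rewrite -waveD subrK.
by ring.
Qed.

End convolution.

Section wave_parameter.
Context {R : realType}.
Local Notation mu := (@lebesgue_measure R).
Local Notation RR := (measurableTypeR R * measurableTypeR R)%type.

(* Damping by [exp_abs 1 t] makes the integrand integrable in the pair [(t, l)],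
   so that measurability in [t] is a by-product of Fubini's theorem. *)
Lemma cmeas_exp_abs_inv (f : R -> R[i]) :
  cmeas (fun t : measurableTypeR R => (exp_abs 1 t)%:C%C * f t) ->
  cmeas (f : measurableTypeR R -> _).
Proof.
move=> mf; have -> : f = fun t => (expR `|t|)%:C%C * ((exp_abs 1 t)%:C%C * f t).
  apply/funext => t; rewrite mulrA -rmorphM/= /exp_abs mul1r -expRD subrr expR0.
  by rewrite mul1r.
apply: cmeasM => //; apply: cmeas_real.
exact: (measurableT_comp (@measurable_expR R)).
Qed.

Lemma cmeas_cint_wave (c : R -> R[i]) : cintegrable mu c ->
  cmeas (fun t : measurableTypeR R => cint mu (fun l => c l * wave l t)).
Proof.
move=> ic; apply: cmeas_exp_abs_inv.
pose f (z : RR) := (exp_abs 1 z.1)%:C%C * (c z.2 * wave z.2 z.1).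
have ify t : cintegrable mu (fun l => f (t, l)).
  exact: (@cintegrableZl _ _ R mu (exp_abs 1 t)%:C%C _ (cintegrable_wave ic t)).
have -> : (fun t => (exp_abs 1 t)%:C%C * cint mu (fun l => c l * wave l t)) =
    (fun t => cint mu (fun l => f (t, l))).
  by apply/funext => t; rewrite -cintZl//; exact: cintegrable_wave.
apply/cintegrable_cmeas/(@cintegrable_section _ _ _ _ R mu mu f) => //.
have [m1 m2] := cintegrable_cmeas ic.
apply: (@cintegrable_dominated _ _ R lebprod f (fun z => exp_abs 1 z.1 * normc (c z.2))).
- apply: cmeasM.
    by apply: cmeas_real; exact: (measurableT_comp (measurable_exp_abs 1)).
  apply: cmeasM.
    by split; [exact: (measurableT_comp m1)|exact: (measurableT_comp m2)].
  by apply: cmeas_expi; do 2 apply: measurable_funM => //.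
- apply: (@integrable_tensor _ _ (measurableTypeR R) (measurableTypeR R) R mu mu
    (exp_abs 1) (fun l => normc (c l))); last exact: integrable_normc.
  exact: integrable_exp_abs.
- move=> z; rewrite !normcM normc_expi mulr1 normc_real ger0_norm ?exp_abs_ge0//.
Qed.

End wave_parameter.

Section l4_bound.
Context {R : realType}.
Local Notation mu := (@lebesgue_measure R).
Local Notation RR := (measurableTypeR R * measurableTypeR R)%type.
Variables (A e : R) (s : seq int) (a : int -> R -> R[i]).
Hypotheses (e0 : 0 < e) (us : uniq s) (ha : forall n, exp_dominated A e (a n)).
Hypothesis as0 : forall n, n \notin s -> forall l, a n l = 0.

Definition trig_sum (z : R * R) : R[i] :=
  \sum_(n <- s) cint mu (fun l => a n l * wave l z.2) * wave n%:~R z.1.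

Let U n t := cint mu (fun l => a n l * wave l t).
Let r : seq int := undup [seq n + k | n <- s, k <- s].
Let conv n k x := cint mu (fun y => a n y * a k (x - y)).
Let G m x := \sum_(n <- s) conv n (m - n) x.
Let W m t := cint mu (fun l => G m l * wave l t).

Let iconv n k : cintegrable mu (conv n k).
Proof. exact: (cintegrable_conv_cint e0 (ha n) (ha k)). Qed.

Let iG m : cintegrable mu (G m).
Proof. by apply: cintegrable_sum => n; exact: iconv. Qed.

Let U0 n t : n \notin s -> U n t = 0.
Proof.
move=> ns; rewrite /U -(cint0 mu); apply: eq_cint => l.
by rewrite as0// mul0r.
Qed.

Let WE m t : W m t = \sum_(n <- s) U n t * U (m - n) t.
Proof.
rewrite /W; transitivity (cint mu (fun l => \sum_(n <- s) conv n (m - n) l * wave l t)).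
  by apply: eq_cint => l; rewrite mulr_suml.
rewrite cint_sum; last by move=> n; exact: cintegrable_wave (iconv _ _) t.
by apply: eq_bigr => n _; rewrite (wave_product e0 (ha n) (ha (m - n))).
Qed.

(** The double product is regrouped by [m = n + k]. For [m] in [r] with [m - n] outside [s] the
    coefficient [U (m - n)] vanishes, so no correction terms appear. *)
Let trig_sum_sqr x t : trig_sum (x, t) ^+ 2 = \sum_(m <- r) W m t * wave m%:~R x.
Proof.
rewrite expr2 /trig_sum /= mulr_suml -/(U _ _).
transitivity (\sum_(n <- s) \sum_(m <- r) U n t * U (m - n) t * wave m%:~R x); last first.
  by rewrite exchange_big/=; apply: eq_bigr => m _; rewrite WE mulr_suml.
apply: eq_big_seq => n ns; rewrite mulr_sumr.
rewrite [RHS](bigID (fun m => m - n \in s))/= [X in _ = _ + X]big1 ?addr0; last first.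
  by move=> m mns; rewrite (U0 _ mns) mulr0 mul0r.
rewrite -[RHS]big_filter.
have pr : perm_eq [seq m <- r | m - n \in s] [seq n + k | k <- s].
  apply: uniq_perm.
  - by rewrite filter_uniq// undup_uniq.
  - by rewrite map_inj_uniq//; exact: addrI.
  - move=> m; rewrite mem_filter mem_undup; apply/andP/mapP => [[mns _]|[k ks ->]].
      by exists (m - n) => //; rewrite addrC subrK.
    by split; [rewrite addrC addKr|apply/allpairsP; exists (n, k)].
rewrite [RHS](perm_big _ pr)/= big_map; apply: eq_bigr => k _.
rewrite -/(U n t) -/(U k t) (_ : n + k - n = k); last by rewrite addrC addKr.
by rewrite intrD waveD; ring.
Qed.

Let F n l := normc (a n l).

Let mG m : measurable_fun [set: R] (fun l => normc (G m l)).
Proof. exact: measurable_normc (cintegrable_cmeas (iG m)). Qed.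

Let normG m x : ((normc (G m x))%:E <= sconv s F m x)%E.
Proof.
apply: (@le_trans _ _ (\sum_(n <- s) (normc (conv n (m - n) x))%:E)%E).
  by rewrite sumEFin lee_fin; exact: ler_normc_sum.
apply: lee_sum => n _; rewrite /F.
have ic := cintegrable_conv e0 (ha n) (ha (m - n)) x.
have := normc_cint_le ic; rewrite -lee_fin => /le_trans; apply.
rewrite /Rintegral fineK; last by apply: integrable_fin_num => //; exact: integrable_normc.
rewrite le_eqVlt; apply/orP; left; apply/eqP; apply: eq_integral => y _.
by rewrite normcM.
Qed.

Let mU n : cmeas (U n : measurableTypeR R -> _).
Proof. exact: cmeas_cint_wave (exp_dominated_integrable e0 (ha n)). Qed.

Lemma measurable_trig_sum : cmeas (trig_sum : RR -> _).
Proof.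
apply: (@cmeas_sum _ RR R _ s (fun n (z : RR) => U n z.2 * wave n%:~R z.1)) => n.
have [m1 m2] := mU n; apply: cmeasM.
  by split; [exact: (measurableT_comp m1)|exact: (measurableT_comp m2)].
apply: cmeas_expi; do 2 apply: measurable_funM => //.
Qed.

Lemma trig_sum_l4_le (T : R) :
  (\int[lebprod]_(z in slab T) (normc (trig_sum z) ^+ 4)%:E <=
   (expR T * (2 * pi))%:E * \sum_(m <- r) \int[mu]_x (sconv s F m x * sconv s F m x))%E.
Proof.
have mS4 : measurable_fun [set: RR] (fun z => normc (trig_sum z) ^+ 4).
  by apply: measurable_funX; exact: measurable_normc measurable_trig_sum.
have mT : measurable (`[0, T]%classic : set (measurableTypeR R)) by exact: measurable_itv.
have mslab : measurable (slab T : set RR) by apply: measurableX => //; exact: measurable_torus.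
pose f : RR -> \bar R := ((fun z => (normc (trig_sum z) ^+ 4)%:E) \_ (slab T))%E.
have mf : measurable_fun [set: RR] f.
  by apply/measurable_restrict => //; apply/measurable_EFinP; exact: measurable_funTS.
have f0 z : (0 <= f z)%E.
  by rewrite /f patchE; case: ifPn => // _; rewrite lee_fin exprn_ge0// normc_ge0.
(* For fixed time, [|S|^4 = |S^2|^2] and [S^2] is a trigonometric polynomial in space with
   coefficients [W m y], so Parseval applies to it. *)
have inner y : y \in `[0, T] -> fubini_G mu f y = (\sum_(m <- r) normc (W m y) ^+ 2)%:E.
  move=> yT; rewrite -parseval ?undup_uniq// [RHS]integral_mkcond; apply: eq_integral => x _.
  rewrite /f !patchE -trig_sum_sqr.
  have -> : normc (trig_sum (x, y) ^+ 2) ^+ 2 = normc (trig_sum (x, y)) ^+ 4.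
    by rewrite [in LHS]expr2 normcM; ring.
  have -> // : ((x, y) \in slab T) = (x \in torus).
  by apply/idP/idP; rewrite !inE//= => -[].
rewrite integral_mkcond (fubini_tonelli2 f)//.
rewrite (_ : (\int[mu]_y fubini_G mu f y =
    \int[mu]_(y in `[0%R, T]) (\sum_(m <- r) normc (W m y) ^+ 2)%:E)%E); last first.
  rewrite [RHS]integral_mkcond; apply: eq_integral => y _.
  rewrite patchE; case: ifPn => [|yT]; first by rewrite inE; exact: inner.
  rewrite /fubini_G integral0_eq// => x _; rewrite /f patchE ifF//.
  by apply/negbTE; apply: contra yT; rewrite !inE => -[].
under eq_integral do rewrite -sumEFin.
rewrite ge0_integral_sum//; last 2 first.
- by move=> m; apply/measurable_EFinP/measurable_funTS; exact: measurable_normc_wave (iG m).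
- by move=> m y _; rewrite lee_fin sqr_ge0.
rewrite ge0_sume_distrr; last by move=> m _; apply: integral_ge0 => x _; rewrite mule_ge0// sconv_ge0// => *; exact: normc_ge0.
apply: lee_sum => m _.
apply: (le_trans (plancherel_local (iG m) T)).
apply: lee_wpmul2l; first by rewrite lee_fin mulr_ge0 ?expR_ge0// mulr_ge0// pi_ge0.
have F0 n x : 0 <= F n x by exact: normc_ge0.
have mF n : measurable_fun [set: R] (F n) by exact: measurable_normc (ha n).1.
apply: ge0_le_integral => //.
- by move=> x _; rewrite lee_fin sqr_ge0.
- apply/measurable_EFinP; apply: measurable_funX; exact: mG.
- by apply: emeasurable_funM; exact: measurable_sconv.
- move=> x _; rewrite expr2 EFinM; apply: lee_pmul; rewrite ?lee_fin ?normc_ge0//.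
Qed.

End l4_bound.

Lemma cvgr_sum (R : realType) (I : Type) (r : seq I) (f : I -> nat -> R) (l : I -> R) :
  (forall i, f i @ \oo --> l i) ->
  (fun n => \sum_(i <- r) f i n) @ \oo --> \sum_(i <- r) l i.
Proof.
move=> fl; elim: r => [|i r IH].
  rewrite big_nil; have -> : (fun n => \sum_(i <- [::]) f i n) = (fun=> 0).
    by apply/funext => n; rewrite big_nil.
  exact: cvg_cst.
rewrite big_cons; have -> : (fun n => \sum_(j <- i :: r) f j n) =
    (fun n => f i n + \sum_(j <- r) f j n) by apply/funext => n; rewrite big_cons.
exact: cvgD.
Qed.

(** * Weak limits *)

Section dynkin_vanishing.
Context d (X : measurableType d) (R : realType).
Variables (nu : nat -> set X -> R) (G : set (set X)).
Hypothesis nuU : forall j E F, measurable E -> measurable F -> E `&` F = set0 ->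
  nu j (E `|` F) = nu j E + nu j F.
Hypothesis nu_tail : forall E : nat -> set X, (forall k, measurable (E k)) ->
  (forall k, E k.+1 `<=` E k) -> \bigcap_k E k = set0 ->
  forall e, 0 < e -> exists k, forall j, `|nu j (E k)| <= e.
Hypothesis gen : @measurable _ X = <<s G >>.
Hypothesis GI : setI_closed G.
Hypothesis nuT : nu ^~ setT @ \oo --> 0.
Hypothesis nuG : forall E, G E -> nu ^~ E @ \oo --> 0.

(** The sets on which [nu] tends to 0 form a Dynkin system. Complements use the value on the whole
    space. For a disjoint union the limit must pass through an infinite sum, and it is the smallness
    of the tails uniformly in [j] that allows it. *)
Lemma dynkin_vanish E : measurable E -> nu ^~ E @ \oo --> 0.
Proof.
rewrite gen; move: E; apply: (dynkin_induction gen GI) => //.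
- move=> S mS nuS.
  have -> : nu ^~ (~` S) = (fun j => nu j setT - nu j S).
    apply/funext => j; rewrite -(setUv S) nuU ?setICr//; last exact: measurableC.
    by rewrite addrAC subrr add0r.
  by rewrite -[X in _ --> X](subrr 0); exact: cvgB.
- move=> F mF tF nuF.
  pose E k := \bigcup_(i in [set i | (k <= i)%N]) F i.
  have mE k : measurable (E k) by exact: bigcup_measurable.
  have ES k : E k = F k `|` E k.+1.
    apply/seteqP; split => [x [i /= ki Fx]|x [Fx|[i /= ki Fx]]].
    - move: ki; rewrite leq_eqVlt => /predU1P[->|ki]; first by left.
      by right; exists i.
    - by exists k => //=.
    - by exists i => //=; exact: ltnW.
  have FE k : F k `&` E k.+1 = set0.
    apply/seteqP; split => // x [Fk [i /= ki Fi]].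
    have := tF k i Logic.I Logic.I (ex_intro _ x (conj Fk Fi)).
    by move=> kE; move: ki; rewrite kE ltnn.
  have E0 : \bigcup_k F k = E 0%N by apply/seteqP; split => x [i _ Fx]; exists i.
  have nuE j k : nu j (E 0%N) = \sum_(i < k) nu j (F i) + nu j (E k).
    elim: k => [|k IH]; first by rewrite big_ord0 add0r.
    by rewrite IH big_ord_recr/= -addrA {1}ES nuU.
  have Ecap : \bigcap_k E k = set0.
    apply/seteqP; split => // x Ex.
    have [i _ Fi] := Ex 0%N Logic.I; have [k /= ik Fk] := Ex i.+1 Logic.I.
    have := tF i k Logic.I Logic.I (ex_intro _ x (conj Fi Fk)).
    by move=> kE; move: ik; rewrite kE ltnn.
  have Emono k : E k.+1 `<=` E k by rewrite (ES k) => x ?; right.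
  rewrite E0; apply/cvgrPdist_le => e e0.
  have [k nuk] := nu_tail mE Emono Ecap (divr_gt0 e0 (@ltr0n R 2)).
  have : (fun j => \sum_(i < k) nu j (F i)) @ \oo --> 0.
    have H0 : \sum_(i < k) 0 = 0 :> R by rewrite big1.
    rewrite -[X in _ --> X]H0; by apply: cvgr_sum => i; exact: nuF.
  move/cvgrPdist_le => /(_ _ (divr_gt0 e0 (@ltr0n R 2))).
  apply: filterS => j; rewrite !sub0r !normrN (nuE j k) => H.
  apply: (le_trans (ler_normD _ _)); rewrite [leRHS](splitr e).
  exact: lerD.
Qed.

End dynkin_vanishing.

Section Rintegral_convergence.
Context d (X : measurableType d) (R : realType).
Variables (nu : {measure set X -> \bar R}) (D : set X).
Hypothesis mD : measurable D.

Lemma Rintegral_dominated_cvg (f_ : nat -> X -> R) (f g : X -> R) :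
  (forall n, measurable_fun D (f_ n)) -> measurable_fun D f ->
  {ae nu, forall x, D x -> f_ ^~ x @ \oo --> f x} ->
  nu.-integrable D (EFin \o g) ->
  (forall n x, D x -> `|f_ n x| <= g x) ->
  \int[nu]_(x in D) f_ n x @[n --> \oo] --> \int[nu]_(x in D) f x.
Proof.
move=> mf_ mf cf ig fg.
have e_cvg : {ae nu, forall x, D x -> EFin \o f_ ^~ x @ \oo --> (EFin \o f) x}.
  by apply: filterS cf => x cfx Dx; apply: cvg_EFin; [near=> n|exact: cfx].
have e_dom : {ae nu, forall x n, D x -> (`|(EFin \o f_ n) x| <= (EFin \o g) x)%E}.
  by apply/aeW => x n Dx; rewrite lee_fin; exact: fg.
have e_mf_ n : measurable_fun D (EFin \o f_ n) by exact/measurable_EFinP.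
have e_mf : measurable_fun D (EFin \o f) by exact/measurable_EFinP.
have [] := dominated_convergence mD e_mf_ e_mf e_cvg ig e_dom.
move=> i1 _ H; apply: fine_cvg.
rewrite fineK//; exact: integrable_fin_num.
Unshelve. all: by end_near.
Qed.


Lemma Rintegral_vanishing_tail (g : X -> R) (E : nat -> set X) :
  nu.-integrable D (EFin \o g) -> (forall k, measurable (E k)) ->
  (forall k, E k.+1 `<=` E k) -> \bigcap_k E k = set0 ->
  \int[nu]_(x in D `&` E k) g x @[k --> \oo] --> 0.
Proof.
move=> ig mE Emono Ecap.
have mg : measurable_fun D g by apply/measurable_EFinP; exact: measurable_int ig.
have Ele m n : (m <= n)%N -> E n `<=` E m.
  move=> mn; rewrite -(subnK mn); elim: (n - m)%N => [//|k IH].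
  by rewrite addSn; exact: subset_trans (Emono _) IH.
have I0 : \int[nu]_(x in D) (fun=> 0 : R) x = 0 by rewrite Rintegral_cst// mul0r.
rewrite -[X in _ --> X]I0.
have -> : (fun k => \int[nu]_(x in D `&` E k) g x) =
    (fun k => \int[nu]_(x in D) (g \_ (E k)) x).
  by apply/funext => k; rewrite Rintegral_mkcondr.
apply: (@Rintegral_dominated_cvg _ _ (fun x => `|g x|)).
- move=> n; apply/(measurable_restrict _ (mE n) mD).
  by apply: measurable_funS mg => //; exact: subIsetl.
- exact: measurable_cst.
- apply/aeW => x Dx; have [k Ek] : exists k, ~ E k x.
    apply: contrapT => H; have : (\bigcap_k E k) x.
      by move=> k _; apply: contrapT => nE; apply: H; exists k.
    by rewrite Ecap.
  apply: cvg_near_cst; exists k => //= n /= kn.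
  by rewrite patchE memNset// => /(Ele _ _ kn).
- exact: integrable_norm.
- by move=> n x Dx; rewrite patchE; case: ifPn => // _; rewrite normr0.
Qed.

End Rintegral_convergence.

(** * Stability of the L^4 bound under weak limits *)

Section weak_convergence.
Context d (X : measurableType d) (R : realType).
Variables (nu : {measure set X -> \bar R}) (D : set X).
Hypotheses (mD : measurable D) (Dfin : (nu D < +oo)%E).
Variables (u : X -> R) (S : nat -> X -> R) (B : R).
Hypothesis iu : nu.-integrable D (EFin \o u).
Hypothesis mS : forall j, measurable_fun D (S j).
Hypothesis SB : forall j, (\int[nu]_(x in D) (S j x ^+ 4)%:E <= B%:E)%E.

Let B0 : 0 <= B.
Proof.
rewrite -lee_fin; apply: le_trans (SB 0%N); apply: integral_ge0 => x _.
by rewrite lee_fin -[4%N]/(2 * 2)%N exprM sqr_ge0.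
Qed.

Let pow4 (y : R) : 0 <= y ^+ 4. Proof. by rewrite -[4%N]/(2 * 2)%N exprM sqr_ge0. Qed.

Let iS4 j : nu.-integrable D (EFin \o (fun x => S j x ^+ 4)).
Proof.
apply/integrableP; split; first by apply/measurable_EFinP; exact: measurable_funX.
under eq_integral do rewrite gee0_abs ?lee_fin ?pow4//.
exact: le_lt_trans (SB j) (ltry _).
Qed.

Let icst (M : R) : nu.-integrable D (EFin \o (fun=> M)).
Proof.
apply/integrableP; split; first exact: measurable_cst.
by rewrite integral_cst//=; apply: lte_mul_pinfty.
Qed.

(** Either [|y| <= 1 / e] or [(e |y|)^3 >= 1]. A small [e] makes the quartic term negligible at the
    price of a large constant: an L^4 bound yields uniform integrability. *)
Let young (e y : R) : 0 < e -> `|y| <= e ^+ 3 * y ^+ 4 + e^-1.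
Proof.
move=> e0; have -> : y ^+ 4 = `|y| ^+ 4.
  by rewrite -[4%N]/(2 * 2)%N !exprM real_normK ?num_real.
set z := `|y|; have z0 : 0 <= z by exact: normr_ge0.
have [ze|ze] := leP (e * z) 1.
  have : z <= e^-1 by rewrite -[e^-1]mul1r ler_pdivlMr// mulrC.
  have : 0 <= e ^+ 3 * z ^+ 4 by rewrite mulr_ge0 ?exprn_ge0// ltW.
  by lra.
have e1 : 0 <= e^-1 by rewrite invr_ge0 ltW.
have : z <= (e * z) ^+ 3 * z by rewrite ler_peMl// exprn_ege1// ltW.
have -> : (e * z) ^+ 3 * z = e ^+ 3 * z ^+ 4 by ring.
lra.
Qed.

Lemma integrable_l4 j : nu.-integrable D (EFin \o S j).
Proof.
have i1 := integrableD mD (iS4 j) (icst 1).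
apply: (le_integrable mD _ _ i1); first exact/measurable_EFinP.
move=> x _ /=; rewrite lee_fin [leRHS]ger0_norm ?addr_ge0//.
by have := young (S j x) ltr01; rewrite expr1n mul1r invr1.
Qed.

(** Uniform integrability of [S j - u]: by [young] the integrand is at most [c^3 S^4 + (1/c + |u|)].
    The first term integrates to at most [c^3 B] for all [j]; the second is a fixed integrable
    function, whose integral over the shrinking sets tends to 0. *)
Lemma l4_tail (E : nat -> set X) : (forall k, measurable (E k)) ->
  (forall k, E k.+1 `<=` E k) -> \bigcap_k E k = set0 ->
  forall e, 0 < e -> exists k, forall j,
    `|\int[nu]_(x in D `&` E k) (S j x - u x)| <= e.
Proof.
move=> mE Emono Ecap e e0.
(* The bound by 1 gives [c^3 <= c]; the denominator uses [B + 1] so as to stay positive when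
   [B = 0]. *)
pose c := Num.min 1 (e / (2 * (B + 1))).
have B1 : 0 < B + 1 by rewrite ltr_wpDl.
have c0 : 0 < c by rewrite lt_min ltr01 divr_gt0// mulr_gt0.
have cB : c ^+ 3 * B <= e / 2.
  have c1 : c <= 1 by rewrite ge_min lexx.
  have c2 : c <= e / (2 * (B + 1)) by rewrite ge_min lexx orbT.
  apply: (@le_trans _ _ (c * (B + 1))); last first.
    apply: (le_trans (ler_wpM2r (ltW B1) c2)).
    have -> // : e / (2 * (B + 1)) * (B + 1) = e / 2.
    by field; rewrite gt_eqF.
  apply: ler_pM => //; [by rewrite exprn_ge0// ltW| |by rewrite lerDl].
  by rewrite -[leRHS]mulr1 exprSr mulrC ler_wpM2l ?(ltW c0)// exprn_ile1// ltW.
have ig : nu.-integrable D (EFin \o (fun x => c^-1 + `|u x|)).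
  have -> : EFin \o (fun x => c^-1 + `|u x|) =
      ((EFin \o (fun=> c^-1)%R) \+ (EFin \o (fun x => `|u x|)%R))%E by [].
  by apply: integrableD => //; exact: integrable_norm.
have /cvgrPdist_le/(_ _ (divr_gt0 e0 (@ltr0n R 2))) :=
  Rintegral_vanishing_tail mD ig mE Emono Ecap.
move=> [k _ /(_ k (leqnn k)) /=]; rewrite sub0r normrN => H.
exists k => j; set F := D `&` E k.
have mF : measurable F by exact: measurableI.
have FD : F `<=` D by exact: subIsetl.
have iF (f : X -> R) : nu.-integrable D (EFin \o f) -> nu.-integrable F (EFin \o f).
  exact: integrableS.
have iSu : nu.-integrable D (EFin \o (fun x => S j x - u x)).
  exact: (integrableB mD (integrable_l4 j) iu).
have i4 : nu.-integrable D (EFin \o (fun x => c ^+ 3 * S j x ^+ 4)).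
  exact: (integrableZl mD (c ^+ 3) (iS4 j)).
apply: (le_trans (le_normr_Rintegral mF (iF _ iSu))).
apply: (@le_trans _ _ (\int[nu]_(x in F) (c ^+ 3 * S j x ^+ 4 + (c^-1 + `|u x|)))).
  apply: le_Rintegral => //.
  - by apply: iF; exact: integrable_norm.
  - by apply: iF; exact: (integrableD mD i4 ig).
  - move=> x _; apply: (le_trans (ler_normB _ _)).
    by rewrite addrA lerD2r; exact: young.
rewrite RintegralD//; [|exact: iF|exact: iF].
rewrite [leRHS](splitr e); apply: lerD; last exact: le_trans (ler_norm _) H.
rewrite RintegralZl//; last exact: iF.
apply: (le_trans _ cB); rewrite ler_wpM2l ?exprn_ge0 ?(ltW c0)//.
rewrite -lee_fin; apply: le_trans (SB j).
rewrite /Rintegral fineK; last by apply: integrable_fin_num => //; exact: iF.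
apply: ge0_subset_integral => //.
  by apply/measurable_EFinP; exact: measurable_funX.
by move=> x _; rewrite lee_fin pow4.
Qed.

Hypothesis weak : forall E, measurable E ->
  \int[nu]_(x in D `&` E) S j x @[j --> \oo] --> \int[nu]_(x in D `&` E) u x.

Import HBNNSimple.

(** Duality with the test function [r^3]. Since [r] lies below the positive part of [u], the
    integral of [r^4] is at most that of [u r^3], the limit of those of [S j r^3], hence at most
    [B / 4] plus [3 / 4] of itself. It is finite because [r] is simple, so it can be absorbed. *)
Lemma weak_nnsfun_le (r : {nnsfun X >-> R}) :
  (forall x, D x -> r x <= Num.max (u x) 0) ->
  (\int[nu]_(x in D) (r x ^+ 4)%:E <= B%:E)%E.
Proof.
move=> ru.
have [vals Hvals] : exists vals : seq R, forall x, r x \in undup vals.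
  have /finite_seqP[vals E] := @fimfunP _ _ r.
  exists vals => x; rewrite mem_undup.
  by have : [set` vals] (r x) by rewrite -E; exists x.
(* [r^3] is a finite combination of indicators of level sets, so convergence on measurable sets
   suffices. *)
have r3E (f : X -> R) x :
    f x * r x ^+ 3 = \sum_(v <- undup vals) v ^+ 3 * (f \_ (r @^-1` [set v])) x.
  rewrite (bigD1_seq (r x))//= ?undup_uniq//.
  rewrite patchE mem_set// big1 ?addr0 1?mulrC// => v vr.
  by rewrite patchE memNset ?mulr0//= => rv; rewrite rv eqxx in vr.
have mr v : measurable (r @^-1` [set v]) by exact: measurable_sfunP.
have ipatch (f : X -> R) v : nu.-integrable D (EFin \o f) ->
    nu.-integrable D (EFin \o (f \_ (r @^-1` [set v]))).
  move=> iif; apply: (le_integrable mD _ _ iif).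
    apply/measurable_EFinP/(measurable_restrict _ (mr v) mD).
    apply: (measurable_funS mD (@subIsetl _ _ _)).
    by apply/measurable_EFinP; exact: measurable_int iif.
  by move=> x _ /=; rewrite lee_fin patchE; case: ifPn; rewrite ?normr0.
have intE (f : X -> R) : nu.-integrable D (EFin \o f) ->
    \int[nu]_(x in D) (f x * r x ^+ 3) =
    \sum_(v <- undup vals) v ^+ 3 * \int[nu]_(x in D `&` r @^-1` [set v]) f x.
  move=> iif; under eq_Rintegral do rewrite r3E.
  rewrite (Rintegral_sum (undup vals) mD _).2 => [|v]; last first.
    exact: (integrableZl mD (v ^+ 3) (ipatch f v iif)).
  apply: eq_bigr => v _; rewrite RintegralZl ?ipatch//.
  by rewrite Rintegral_mkcondr.
have ir (f : X -> R) : nu.-integrable D (EFin \o f) ->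
    nu.-integrable D (EFin \o (fun x => f x * r x ^+ 3)).
  move=> iif; have -> : (fun x => f x * r x ^+ 3) =
      (fun x => \sum_(v <- undup vals) v ^+ 3 * (f \_ (r @^-1` [set v])) x).
    by apply/funext => x; rewrite r3E.
  apply: (Rintegral_sum (undup vals) mD _).1 => v.
  exact: (integrableZl mD (v ^+ 3) (ipatch f v iif)).
have cv : \int[nu]_(x in D) (S j x * r x ^+ 3) @[j --> \oo] -->
    \int[nu]_(x in D) (u x * r x ^+ 3).
  have -> : (fun j => \int[nu]_(x in D) (S j x * r x ^+ 3)) = (fun j =>
      \sum_(v <- undup vals) v ^+ 3 * \int[nu]_(x in D `&` r @^-1` [set v]) S j x).
    by apply/funext => j; rewrite intE//; exact: integrable_l4.
  rewrite intE//; apply: cvgr_sum => v.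
  by apply: cvgM; [exact: cvg_cst|exact: weak].
have irr : nu.-integrable D (EFin \o r).
  have i1 := integrable_norm iu.
  apply: (le_integrable mD _ _ i1).
    by apply/measurable_EFinP/measurable_funTS.
  move=> x Dx; rewrite lee_fin normr_id ger0_norm//.
  apply: (le_trans (ru x Dx)); rewrite ge_max normr_ge0 andbT; exact: ler_norm.
have rr : nu.-integrable D (EFin \o (fun x => r x ^+ 4)).
  have -> : (fun x => r x ^+ 4) = (fun x => r x * r x ^+ 3).
    by apply/funext => x; rewrite -exprS.
  exact: (ir (fun x => r x) irr).
have u_ge : \int[nu]_(x in D) (r x ^+ 4) <= \int[nu]_(x in D) (u x * r x ^+ 3).
  apply: le_Rintegral => //; first exact: ir.
  move=> x Dx; rewrite exprS; have := ru x Dx.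
  have : 0 <= r x by [].
  rewrite le_eqVlt => /predU1P[<-|r0 rux]; first by rewrite !expr0n !mulr0.
  rewrite ler_wpM2r ?exprn_ge0 ?(ltW r0)//.
  by move: rux; rewrite le_max [X in _ || X]leNgt r0 orbF.
have S_le j : \int[nu]_(x in D) (S j x * r x ^+ 3) <=
    4^-1 * B + 3 / 4 * \int[nu]_(x in D) (r x ^+ 4).
  have i1 : nu.-integrable D (EFin \o (fun x => 4^-1 * S j x ^+ 4))
    by exact: (integrableZl mD 4^-1 (iS4 j)).
  have i2 : nu.-integrable D (EFin \o (fun x => 3 / 4 * r x ^+ 4))
    by exact: (integrableZl mD (3 / 4) rr).
  apply: (@le_trans _ _ (\int[nu]_(x in D) (4^-1 * S j x ^+ 4 + 3 / 4 * r x ^+ 4))).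
    apply: le_Rintegral => //; first by apply: ir; exact: integrable_l4.
      exact: (integrableD mD i1 i2).
    move=> x _; set s := S j x; set t := r x.
    (* Young's inequality [4 s t^3 <= s^4 + 3 t^4], proved by factoring the difference. *)
    have : 0 <= (s - t) ^+ 2 * ((s + t) ^+ 2 + 2 * t ^+ 2).
      by rewrite mulr_ge0 ?sqr_ge0// addr_ge0 ?sqr_ge0// mulr_ge0 ?sqr_ge0.
    by rewrite [X in 0 <= X](_ : _ = s ^+ 4 + 3 * t ^+ 4 - 4 * (s * t ^+ 3)); [lra|ring].
  rewrite RintegralD// !RintegralZl// lerD2r ler_wpM2l//.
  rewrite -lee_fin; apply: le_trans (SB j).
  by rewrite /Rintegral fineK//; exact: (integrable_fin_num mD (iS4 j)).
have H : \int[nu]_(x in D) (u x * r x ^+ 3) <= 4^-1 * B + 3 / 4 * \int[nu]_(x in D) (r x ^+ 4).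
  by apply: (cvgr_to_le cv); near=> j; exact: S_le.
have : \int[nu]_(x in D) (r x ^+ 4) <= B by lra.
by rewrite -lee_fin /Rintegral fineK//; exact: (integrable_fin_num mD rr).
Unshelve. all: by end_near.
Qed.

(** Simple functions increasing to the positive part of [u] and monotone convergence. *)
Lemma weak_l4_pos : (\int[nu]_(x in D) (Num.max (u x) 0 ^+ 4)%:E <= B%:E)%E.
Proof.
have mup : measurable_fun D (fun x => Num.max (u x) 0).
  apply: measurable_maxr => //.
  by apply/measurable_EFinP; exact: measurable_int iu.
have mup' : measurable_fun D (EFin \o (fun x => Num.max (u x) 0)) by exact/measurable_EFinP.
pose r := nnsfun_approx mD mup'.
have p0 x : 0 <= Num.max (u x) 0 by rewrite le_max lexx orbT.
have cr x : D x -> r k x @[k --> \oo] --> Num.max (u x) 0.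
  move=> Dx; have := @cvg_nnsfun_approx _ _ _ _ mD _ mup' _ x Dx.
  by move=> /(_ (fun x _ => p0 x)); exact: fine_cvg.
have ndr x : nondecreasing_seq (r ^~ x).
  by move=> m n mn; have := nd_nnsfun_approx mD mup' mn; move/lefP.
have le_r k x : D x -> r k x <= Num.max (u x) 0.
  by move=> Dx; rewrite -(cvg_lim _ (cr x Dx))//; apply: nondecreasing_cvgn_le => //; apply/cvg_ex; eexists; exact: cr.
have cv := @cvg_monotone_convergence _ _ _ nu D mD (fun k x => (r k x ^+ 4)%:E).
have : (\int[nu]_(x in D) (r k x ^+ 4)%:E)%E @[k --> \oo] -->
    (\int[nu]_(x in D) (Num.max (u x) 0 ^+ 4)%:E)%E.
  rewrite [X in _ --> X](_ : _ = \int[nu]_(x in D) limn (fun k => (r k x ^+ 4)%:E))%E.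
    apply: cv.
    - by move=> k; apply/measurable_EFinP; apply: measurable_funX; exact: measurable_funTS.
    - by move=> k x _; rewrite lee_fin pow4.
    - move=> x Dx m n mn; rewrite lee_fin lerXn2r ?nnegrE//; exact: ndr.
  apply: eq_integral => x; rewrite inE => Dx; apply/esym/cvg_lim => //.
  apply: cvg_EFin; first by near=> k.
  rewrite -[fine \o _]/(fun k => r k x ^+ 4); elim: 4%N => [|n IH]; first exact: cvg_cst.
  rewrite exprS; have -> : (fun k => r k x ^+ n.+1) = (fun k => r k x * r k x ^+ n).
    by apply/funext => k; rewrite exprS.
  by apply: cvgM => //; exact: cr.
move=> H; apply: cvge_le H; near=> k; exact: weak_nnsfun_le (le_r k).
Unshelve. all: by end_near.
Qed.

End weak_convergence.

(** The bound for the positive part is applied to [u] and to [- u], which accounts for the factor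
    2. *)
Lemma weak_l4 d (X : measurableType d) (R : realType)
    (nu : {measure set X -> \bar R}) (D : set X) (u : X -> R) (S : nat -> X -> R) (B : R) :
  measurable D -> (nu D < +oo)%E -> nu.-integrable D (EFin \o u) ->
  (forall j, measurable_fun D (S j)) ->
  (forall j, (\int[nu]_(x in D) (S j x ^+ 4)%:E <= B%:E)%E) ->
  (forall E, measurable E ->
    \int[nu]_(x in D `&` E) S j x @[j --> \oo] --> \int[nu]_(x in D `&` E) u x) ->
  (\int[nu]_(x in D) (u x ^+ 4)%:E <= (2 * B)%:E)%E.
Proof.
move=> mD Dfin iu mS SB weak.
have H1 := weak_l4_pos mD Dfin iu mS SB weak.
have iS j : nu.-integrable D (EFin \o S j) by exact: (integrable_l4 mD Dfin mS SB j).
have H2 : (\int[nu]_(x in D) (Num.max (- u x) 0 ^+ 4)%:E <= B%:E)%E.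
  apply: (@weak_l4_pos _ _ _ nu D mD Dfin (fun x => - u x) (fun j x => - S j x) B).
  - by have := integrableN iu.
  - by move=> j; exact: measurable_funN.
  - by move=> j; under eq_integral do rewrite -[4%N]/(2 * 2)%N exprM sqrrN -exprM.
  - move=> E mE; have iE (f : X -> R) : nu.-integrable D (EFin \o f) ->
        \int[nu]_(x in D `&` E) (- f x) = - \int[nu]_(x in D `&` E) f x.
      move=> iif; rewrite -[RHS]mulN1r -RintegralZl//.
      + by apply: eq_Rintegral => x _; rewrite mulN1r.
      + exact: measurableI.
      + by apply: integrableS iif => //; exact: measurableI.
    under eq_cvg do rewrite iE//.
    by rewrite iE//; apply: cvgN; exact: weak.
have mu_ : measurable_fun D u by apply/measurable_EFinP; exact: measurable_int iu.
have pow4 (y : R) : 0 <= y ^+ 4 by rewrite -[4%N]/(2 * 2)%N exprM sqr_ge0.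
rewrite (eq_integral (fun x => (Num.max (u x) 0 ^+ 4)%:E + (Num.max (- u x) 0 ^+ 4)%:E)%E).
  rewrite ge0_integralD//; last 4 first.
  - by move=> x _; rewrite lee_fin.
  - by apply/measurable_EFinP; apply: measurable_funX; exact: measurable_maxr.
  - by move=> x _; rewrite lee_fin.
  - apply/measurable_EFinP; apply: measurable_funX; apply: measurable_maxr => //.
    exact: measurable_funN.
  by rewrite mulr2n mulrDl mul1r EFinD leeD.
move=> x _; rewrite -EFinD; congr EFin; rewrite !maxElt oppr_lt0.
case: (ltrgt0P (u x)) => [_|_|->]; rewrite ?oppr0 ?expr0n ?addr0//= add0r.
by rewrite -[4%N]/(2 * 2)%N !exprM sqrrN.
Qed.

(** * Fejer and Poisson means *)

Section approximate_identity.
Context {R : realType}.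
Local Notation mu := (@lebesgue_measure R).
Variables (D : set (measurableTypeR R)) (y : R) (k : nat -> R -> R).
Hypotheses (mD : measurable D) (Dfin : (mu D < +oo)%E).
Hypothesis mk : forall j, measurable_fun [set: R] (k j).
Hypothesis k0 : forall j x, 0 <= k j x.
Hypothesis ik : forall j, mu.-integrable D (EFin \o k j).
Hypothesis k1 : \int[mu]_(x in D) k j x @[j --> \oo] --> (1 : R).
Hypothesis koff : forall e, 0 < e -> exists2 c : nat -> R, c @ \oo --> 0 &
  forall j x, D x -> e <= `|x - y| -> k j x <= c j.

Let off (A : set (measurableTypeR R)) (e : R) : measurable A -> A `<=` D -> 0 < e ->
  (forall x, A x -> e <= `|x - y|) -> \int[mu]_(x in A) k j x @[j --> \oo] --> 0.
Proof.
move=> mA AD e0 Ae; have [c c0 kc] := koff e0.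
have Afin : (mu A < +oo)%E by apply: (le_lt_trans _ Dfin); apply: le_measure; rewrite ?inE.
have c1 : c j * fine (mu A) @[j --> \oo] --> 0.
  by rewrite -[X in _ --> X](mul0r (fine (mu A))); apply: cvgM => //; exact: cvg_cst.
apply: (squeeze_cvgr _ (cvg_cst 0) c1); near=> j; apply/andP; split.
  by apply: Rintegral_ge0 => x _; exact: k0.
have icst : mu.-integrable A (EFin \o (fun=> c j)).
  apply/integrableP; split; first exact: measurable_cst.
  by rewrite integral_cst//=; apply: lte_mul_pinfty.
rewrite -Rintegral_cst//; apply: le_Rintegral => //.
  exact: integrableS (ik j).
by move=> x Ax; apply: kc; [exact: AD|exact: Ae].
Unshelve. all: by end_near.
Qed.

(** If [y] is outside the ray, the kernel is uniformly small on it. If [y] is inside, the complement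
    of the ray is the small part and the total mass tends to 1. The endpoint [a = y] is excluded, as
    the mass could split there. *)
Lemma approx_identity_ray (a : R) : a != y ->
  \int[mu]_(x in D `&` `]a, +oo[) k j x @[j --> \oo] --> ((a < y)%R%:R : R).
Proof.
have ma : measurable (`]a, +oo[%classic : set (measurableTypeR R)) by exact: measurable_itv.
rewrite neq_lt => /orP[|ya].
  move=> ay; rewrite ay.
  have E j : \int[mu]_(x in D `&` `]a, +oo[) k j x =
      \int[mu]_(x in D) k j x - \int[mu]_(x in D `&` ~` `]a, +oo[) k j x.
    apply/eqP; rewrite eq_sym subr_eq; apply/eqP.
    rewrite -Rintegral_setU//; first by rewrite -setIUr setUv setIT.
    - exact: measurableI.
    - by apply: measurableI => //; exact: measurableC.
    - by rewrite -setIUr setUv setIT; exact: ik.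
    - apply/disj_setPS => x [[_ H] [_ nH]]; exact: nH.
  have -> : (fun j => \int[mu]_(x in D `&` `]a, +oo[) k j x) = (fun j =>
      \int[mu]_(x in D) k j x - \int[mu]_(x in D `&` ~` `]a, +oo[) k j x).
    exact/funext.
  rewrite -[X in _ --> X](subr0 1); apply: cvgB => //.
  apply: (off (e := y - a)); rewrite ?subr_gt0//.
    by apply: measurableI => //; exact: measurableC.
  move=> x [_ /=]; rewrite in_itv/= andbT => /negP; rewrite -leNgt => xa.
  by rewrite distrC ger0_norm ?subr_ge0 ?lerB// (le_trans xa)// ltW.
rewrite ltNge (ltW ya)/=; apply: (off (e := a - y)); rewrite ?subr_gt0//.
  exact: measurableI.
move=> x [_ /=]; rewrite in_itv/= andbT => ax.
by rewrite ger0_norm ?subr_ge0 ?lerB// ltW// (lt_trans ya).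
Qed.

End approximate_identity.

(** * The Fejer and Poisson kernels *)

Section kernels.
Context {R : realType}.
Local Notation mu := (@lebesgue_measure R).

(** A one-sided geometric sum: its squared modulus is [K] times the Fejer kernel, and it telescopes
    without centring. *)
Definition dirichlet_sum (K : nat) (y : R) : R[i] := \sum_(j < K) wave j%:R y.

Definition fejer (K : nat) (y : R) : R := K%:R^-1 * normc (dirichlet_sum K y) ^+ 2.

Lemma fejer_ge0 K y : 0 <= fejer K y.
Proof. by rewrite mulr_ge0 ?invr_ge0 ?sqr_ge0. Qed.

Lemma fejer_le K y : fejer K y <= K%:R.
Proof.
have H : normc (dirichlet_sum K y) <= K%:R.
  apply: (le_trans (ler_normc_sum _ _)); under eq_bigr do rewrite normc_expi.
  by rewrite sumr_const card_ord.
case: K H => [|K] H; first by rewrite /fejer invr0 mul0r.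
rewrite /fejer ler_pdivrMl ?ltr0n// -expr2 lerXn2r ?nnegrE ?normc_ge0//.
Qed.

Lemma measurable_fejer K : measurable_fun [set: R] (fejer K).
Proof.
apply: measurable_funM => //; apply: measurable_funX; apply: measurable_normc.
apply: (@cmeas_sum _ (measurableTypeR R)) => j.
by apply: cmeas_expi; do 2 apply: measurable_funM => //.
Qed.

Lemma dirichlet_sum_int K y : dirichlet_sum K y = \sum_(m <- map Posz (index_iota 0 K)) wave m%:~R y.
Proof. by rewrite big_map big_mkord. Qed.

(** Parseval for [K] coefficients of modulus 1, divided by [K]. *)
Lemma integral_fejer K (y : R) : (0 < K)%N -> \int[mu]_(x in torus) fejer K (x - y) = 1.
Proof.
move=> K0; pose c (m : int) := wave m%:~R (- y).
have ur : uniq (map Posz (index_iota 0 K)) by rewrite map_inj_uniq ?iota_uniq// => ? ? [].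
have := parseval c ur; set I := (\int[mu]_(x in _) _)%E => IE.
have EI : I = (\int[mu]_(x in torus) (normc (dirichlet_sum K (x - y)) ^+ 2)%:E)%E.
  apply: eq_integral => x _; congr ((normc _ ^+ 2)%:E).
  rewrite dirichlet_sum_int; apply: eq_bigr => m _.
  by rewrite /c /wave -expiD; congr expi; ring.
have cE : \sum_(m <- map Posz (index_iota 0 K)) normc (c m) ^+ 2 = K%:R.
  under eq_bigr do rewrite normc_expi expr1n.
  by rewrite big_map big_mkord sumr_const card_ord.
rewrite /fejer RintegralZl; last 2 first.
- exact: measurable_torus.
- apply: (@integrable_torus_bounded _ _ (K%:R * K%:R)).
    apply: measurable_funX; apply: measurable_normc.
    apply: (@cmeas_sum _ (measurableTypeR R)) => j.
    by apply: cmeas_expi; do 2 apply: measurable_funM => //; exact: measurable_funD.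
  move=> x; rewrite ger0_norm ?sqr_ge0//.
  by have := fejer_le K (x - y); rewrite /fejer ler_pdivrMl ?ltr0n.
by rewrite /Rintegral -EI IE cE mulVf// pnatr_eq0 -lt0n.
Qed.

Lemma waveX (j : nat) (y : R) : wave j%:R y = wave 1 y ^+ j.
Proof.
elim: j => [|j IH]; first by rewrite /wave mul0r mulr0 expi0 expr0.
by rewrite exprS -IH -waveD nat1r.
Qed.

(** The first factor is [|wave 1 y - 1|^2], and it turns the geometric sum into [wave 1 y ^+ K - 1],
    of modulus at most 2. The product form avoids dividing by zero at integers. *)
Lemma fejer_geometric K (y : R) :
  (2 - 2 * cos (2 * pi * y)) * (K%:R * fejer K y) <= 4.
Proof.
case: K => [|K]; first by rewrite /fejer invr0 !mul0r mulr0.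
have -> : K.+1%:R * fejer K.+1 y = normc (dirichlet_sum K.+1 y) ^+ 2.
  by rewrite /fejer mulrA divff ?mul1r// pnatr_eq0.
have -> : 2 - 2 * cos (2 * pi * y) = normc (wave 1 y - 1) ^+ 2.
  rewrite normc_sqr /wave /expi/= mul1r subr0 sqrrB1 addrAC; have := cos2Dsin2 (2 * pi * y).
  by rewrite mulr2n; lra.
rewrite -exprMn -normcM.
have -> : (wave 1 y - 1) * dirichlet_sum K.+1 y = wave 1 y ^+ K.+1 - 1.
  by rewrite subrX1; congr (_ * _); apply: eq_bigr => j _; rewrite waveX.
have H : normc (wave 1 y ^+ K.+1 - 1) <= 2.
  apply: (le_trans (le_normcD _ _)); rewrite -waveX normc_expi.
  have -> : normc (-1 : R[i]) = 1 by rewrite -expi0 -(normc_expi 0) /normc/= sqrrN sin0 oppr0.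
  by rewrite -[leRHS]/(1 + 1).
have -> : 4 = 2 ^+ 2 :> R by ring.
by rewrite lerXn2r ?nnegrE ?normc_ge0.
Qed.

(** Folding [q] to [1 - q] brings the argument into [[0, pi]], where cosine decreases. *)
Lemma cos_gap (e p : R) : 0 < e -> e <= `|p| -> `|p| <= 1 - e ->
  cos (2 * pi * p) <= cos (2 * pi * e).
Proof.
move=> e0 ep pe; have -> : cos (2 * pi * p) = cos (2 * pi * `|p|).
  by have [_|_] := ger0P p => //; rewrite mulrN cosN.
have p0 := pi_gt0 R; move: `|p| ep pe => q ep pe.
wlog qh : q ep pe / q <= 1 / 2.
  move=> H; have [|hq] := leP q (1 / 2); first exact: H.
  have -> : cos (2 * pi * q) = cos (2 * pi * (1 - q)).
    rewrite -cosN -(cosD2pi (- _)); congr cos; rewrite mulr2n; ring.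
  apply: H; lra.
have in_pi r : 0 <= r -> r <= 1 / 2 -> 2 * pi * r \in `[0, pi].
  move=> r0 rh; rewrite in_itv/= mulr_ge0 ?mulr_ge0 ?pi_ge0//=.
  rewrite -subr_ge0; have -> : pi - 2 * pi * r = pi * (1 - 2 * r) by ring.
  by apply: mulr_ge0; [exact: pi_ge0|lra].
move: ep; rewrite le_eqVlt => /predU1P[->//|eq].
apply: ltW; rewrite ltr_cos ?in_pi//; try lra.
by rewrite ltr_pM2l// mulr_gt0.
Qed.

Lemma fejer_cvg_ray (y a : R) : 0 < y < 1 -> a != y ->
  \int[mu]_(x in torus `&` `]a, +oo[) fejer j.+1 (x - y) @[j --> \oo] --> ((a < y)%R%:R : R).
Proof.
move=> /andP[y0 y1].
have mf j : measurable_fun [set: R] (fun x => fejer j.+1 (x - y)).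
  by apply: (measurableT_comp (measurable_fejer j.+1)); exact: measurable_funD.
apply: (@approx_identity_ray _ torus y (fun j x => fejer j.+1 (x - y))) => //.
- exact: measurable_torus.
- by rewrite lebesgue_measure_itv/= lte_fin ltr01 -EFinD ltry.
- by move=> j x; exact: fejer_ge0.
- move=> j; apply: (@integrable_torus_bounded _ _ j.+1%:R); first exact: mf.
  by move=> x; rewrite ger0_norm ?fejer_ge0// fejer_le.
- by under eq_cvg do rewrite integral_fejer//; exact: cvg_cst.
(* The bounds by [y] and [1 - y] keep [|x - y| <= 1 - e] for [x] in [[0, 1[], so the peak of the
   periodic kernel does not reappear at the other end; [1 / 4] keeps the angle [2 * pi * e] in the
   range where cosine decreases. *)
move=> e0 e00; pose e := Num.min e0 (Num.min (1 / 4) (Num.min y (1 - y))).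
have e_gt0 : 0 < e by rewrite !lt_min e00 y0 subr_gt0 y1 divr_gt0.
have ee0 : e <= e0 by rewrite ge_min lexx.
have e4 : e <= 1 / 4 by rewrite !ge_min lexx !orbT.
have ey : e <= y by rewrite !ge_min lexx !orbT.
have ey1 : e <= 1 - y by rewrite !ge_min lexx !orbT.
pose q := 2 - 2 * cos (2 * pi * e).
have p0 := pi_gt0 R.
have q0 : 0 < q.
  have : cos (2 * pi * e) < cos 0.
    by rewrite ltr_cos ?in_itv/= ?lexx ?(ltW p0)//; [rewrite !mulr_gt0|apply/andP; split; nra].
  rewrite cos0 /q; lra.
exists (fun j => 4 / q * j.+1%:R^-1).
  rewrite -[X in _ --> X](mulr0 (4 / q)); apply: cvgM; first exact: cvg_cst.
  exact: cvg_harmonic.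
move=> j x; rewrite /torus/= in_itv/= => /andP[x0 x1] xe.
have H : cos (2 * pi * (x - y)) <= cos (2 * pi * e).
  apply: cos_gap => //; first exact: le_trans xe.
  by rewrite ler_norml; apply/andP; split; lra.
have G := fejer_geometric j.+1 (x - y).
have j0 : 0 < j.+1%:R :> R by rewrite ltr0n.
have F0 := fejer_ge0 j.+1 (x - y).
rewrite ler_pdivlMr// ler_pdivlMr//; apply: le_trans G.
have JF : 0 <= j.+1%:R * fejer j.+1 (x - y) by rewrite mulr_ge0.
rewrite mulrC [_ * j.+1%:R]mulrC ler_wpM2r// /q lerD2l lerN2 ler_pM2l//.
Qed.

(** The Fourier transform of [exp_abs c] at angular frequency [2 * pi * s]; this scaling gives it
    total mass 1 on the line. *)
Definition poisson (c s : R) : R := 2 * (c / (c ^+ 2 + (2 * pi * s) ^+ 2)).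

Lemma poisson_ge0 c s : 0 < c -> 0 <= poisson c s.
Proof.
move=> c0; rewrite mulr_ge0// divr_ge0 ?(ltW c0)// addr_ge0 ?sqr_ge0//.
Qed.

Lemma poisson_le c s : 0 < c -> poisson c s <= 2 / c.
Proof.
move=> c0; rewrite /poisson ler_wpM2l// ler_pdivrMr ?ltr_pwDl ?exprn_gt0 ?sqr_ge0//.
by rewrite mulrDr expr2 mulrA mulVf ?mul1r ?gt_eqF// lerDl mulr_ge0 ?sqr_ge0// invr_ge0 ltW.
Qed.

Lemma poissonE c : 0 < c -> poisson c = (fun s => 2 * (c^-1 * (oneDsqr (c^-1 * (2 * pi * s)))^-1)).
Proof.
move=> c0; apply/funext => s; rewrite /poisson /oneDsqr; congr (_ * _).
have H : c ^+ 2 + (2 * pi * s) ^+ 2 != 0 by rewrite gt_eqF// ltr_pwDl ?exprn_gt0 ?sqr_ge0.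
move: (2 * pi * s) H => w H; field.
by rewrite gt_eqF//= H.
Qed.

Lemma measurable_poisson c : 0 < c -> measurable_fun [set: R] (poisson c).
Proof.
move=> c0; rewrite poissonE//.
do 2 apply: measurable_funM => //.
apply: (measurableT_comp (continuous_measurable_fun (@continuous_oneDsqrV R))).
by do 2 apply: measurable_funM => //.
Qed.

Lemma integral_poisson (c T t : R) : 0 < c -> 0 <= T ->
  (\int[mu]_(x in `[0%R, T]) (poisson c (x - t))%:E =
   ((atan (2 * pi * (T - t) / c) + atan (2 * pi * t / c)) / pi)%:E)%E.
Proof.
move=> c0 T0; have p0 := pi_gt0 R.
pose F (x : R) := atan (2 * pi * (x - t) / c) / pi.
have dF (x : R) : is_derive x 1 F (poisson c (x - t)).
  apply: is_derive_eq; rewrite /poisson /GRing.scale/=.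
  have H : c ^+ 2 + (2 * pi * (x - t)) ^+ 2 != 0.
    by rewrite gt_eqF// ltr_pwDl ?exprn_gt0 ?sqr_ge0.
  move: p0 H; move: (pi : R) => q q0 H.
  by field; rewrite H !gt_eqF.
rewrite (@integral_itv_is_derive _ _ F 0 T T0 (fun x _ => dF x)).
  rewrite /F sub0r mulrN mulNr atanN; congr EFin; ring.
move=> x _; rewrite poissonE//; do 2 apply: continuous_cstM.
have cl : {for x, continuous (fun y : R => c^-1 * (2 * pi * (y - t)))}.
  by do 2 apply: continuous_cstM; apply: cvgB; [exact: cvg_id|exact: cvg_cst].
exact: (continuous_comp cl (@continuous_oneDsqrV R _)).
Qed.

(** Unlike the Fejer kernel on the torus, the mass on [[0, T]] is not 1 but tends to 1: both
    arctangents tend to [pi / 2] because [t] is strictly inside the interval. *)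
Lemma poisson_cvg_ray (T t a : R) : 0 < t < T -> a != t ->
  \int[mu]_(x in `[0%R, T] `&` `]a, +oo[) poisson (j.+1%:R^-1) (x - t) @[j --> \oo] -->
    ((a < t)%R%:R : R).
Proof.
move=> /andP[t0 tT]; have T0 : 0 <= T by rewrite ltW// (lt_trans t0).
have c0 j : 0 < j.+1%:R^-1 :> R by rewrite invr_gt0 ltr0n.
have mf j : measurable_fun [set: R] (fun x => poisson j.+1%:R^-1 (x - t)).
  by apply: (measurableT_comp (measurable_poisson (c0 j))); exact: measurable_funD.
apply: (@approx_identity_ray _ `[0, T] t (fun j x => poisson j.+1%:R^-1 (x - t))) => //.
- by rewrite lebesgue_measure_itv/=; case: ifP => _; rewrite -?EFinD ltry.
- by move=> j x; exact: poisson_ge0.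
- move=> j; apply/integrableP; split; first by apply/measurable_EFinP; exact: (measurable_funTS (mf j)).
  under eq_integral do rewrite gee0_abs ?lee_fin ?poisson_ge0//.
  by rewrite integral_poisson// ltry.
- have atan_cvg p : 0 < p -> atan (p * j.+1%:R) @[j --> \oo] --> (pi / 2 : R).
    move=> p0; have py : p * j.+1%:R @[j --> \oo] --> +oo.
      have y1 : (j.+1%:R : R) @[j --> \oo] --> +oo.
        by rewrite (cvg_shiftS (fun n => n%:R : R)); exact: cvgr_idn.
      move/cvgryPge : y1 => y1; apply/cvgryPge => A.
      by apply: filterS (y1 (A / p)) => j; rewrite ler_pdivrMr// mulrC.
    exact: (cvg_comp _ _ py (@cvgy_atan R)).
  have -> : (fun j => \int[mu]_(x in `[0%R, T]) poisson j.+1%:R^-1 (x - t)) =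
      (fun j => (atan (2 * pi * (T - t) * j.+1%:R) + atan (2 * pi * t * j.+1%:R)) / pi).
    by apply/funext => j; rewrite /Rintegral integral_poisson// !invrK.
  have E1 : (pi / 2 + pi / 2) / pi = 1 :> R by rewrite -splitr divff ?gt_eqF ?pi_gt0.
  rewrite -[X in _ --> X]E1; apply: cvgM; last exact: cvg_cst.
  by apply: cvgD; apply: atan_cvg; rewrite !mulr_gt0 ?pi_gt0 ?subr_gt0.
move=> e e0; exists (fun j => 2 / (2 * pi * e) ^+ 2 * j.+1%:R^-1).
  rewrite -[X in _ --> X](mulr0 (2 / (2 * pi * e) ^+ 2)); apply: cvgM; first exact: cvg_cst.
  exact: cvg_harmonic.
move=> j x _ xe; rewrite /poisson -[leRHS]mulrA ler_wpM2l// [leRHS]mulrC ler_wpM2l ?(ltW (c0 j))//.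
have q0 : 0 < (2 * pi * e) ^+ 2 by rewrite exprn_gt0// !mulr_gt0// pi_gt0.
rewrite lef_pV2 ?posrE//; last by rewrite ltr_pwDl ?exprn_gt0 ?sqr_ge0.
apply: (@le_trans _ _ ((2 * pi * (x - t)) ^+ 2)); last by rewrite lerDr sqr_ge0.
rewrite -(real_normK (num_real (2 * pi * (x - t)))) lerXn2r ?nnegrE ?normr_ge0//.
  by rewrite !mulr_ge0 ?pi_ge0 ?(ltW e0).
by rewrite normrM ger0_norm ?mulr_ge0 ?pi_ge0// ler_wpM2l// mulr_ge0// pi_ge0.
Qed.

End kernels.

(** * The means as trigonometric sums *)

Section approximants.
Context {R : realType}.
Local Notation mu := (@lebesgue_measure R).
Local Notation RR := (measurableTypeR R * measurableTypeR R)%type.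
Variable u0 : RR -> R.
Hypothesis iu0 : lebprod.-integrable setT (EFin \o u0).

Let mu0 : measurable_fun [set: RR] u0.
Proof. by apply/measurable_EFinP; exact: measurable_int iu0. Qed.

(** For [u0] cut off to the slab, this integral over the plane coincides with the space-time
    transform on the torus. *)
Definition fourier_plane (n : int) (l : R) : R[i] :=
  cint lebprod (fun w : RR => (u0 w)%:C%C * expi (- (2 * pi * (n%:~R * w.1 + l * w.2)))).

Definition fejer_freqs (K : nat) : seq int :=
  undup [seq Posz p.1 - Posz p.2 | p <- [seq (j, k) | j <- iota 0 K, k <- iota 0 K]].

(** The triangular multiplier [max(1 - |n| / K, 0)], written as a count of pairs with difference
    [n], the form in which it comes out of expanding [|dirichlet_sum|^2]. *)
Definition fejer_coef (K : nat) (n : int) : R :=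
  K%:R^-1 * \sum_(j < K) \sum_(k < K) (Posz j - Posz k == n)%:R.

Lemma fejer_coef_ge0 K n : 0 <= fejer_coef K n.
Proof. by rewrite mulr_ge0 ?invr_ge0// sumr_ge0// => j _; rewrite sumr_ge0. Qed.

Lemma fejer_coef_le1 K n : fejer_coef K n <= 1.
Proof.
case: K => [|K]; first by rewrite /fejer_coef invr0 mul0r.
rewrite /fejer_coef ler_pdivrMl ?ltr0n// mulr1.
apply: (@le_trans _ _ (\sum_(j < K.+1) 1)); last by rewrite sumr_const card_ord.
apply: ler_sum => j _.
have [k0 /= /eqP Hk0|Hno] := pickP (fun k : 'I_K.+1 => Posz j - Posz k == n).
  rewrite (bigD1 k0)//= Hk0 eqxx big1 ?addr0// => k kk0.
  rewrite (_ : _ == n = false)//; apply/negbTE; apply: contra kk0 => /eqP Hk.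
  apply/eqP/val_inj; move: Hk; rewrite -Hk0 => /addrI/oppr_inj; by case.
by rewrite big1// => k _; rewrite Hno.
Qed.

Lemma fejer_coef0 K n : n \notin fejer_freqs K -> fejer_coef K n = 0.
Proof.
move=> ns; rewrite /fejer_coef big1 ?mulr0// => j _; rewrite big1// => k _.
rewrite (_ : _ == n = false)//; apply/negbTE; apply: contra ns => /eqP <-.
rewrite mem_undup; apply/mapP; exists (val j, val k) => //.
by apply/allpairsP; exists (val j, val k); rewrite !mem_iota !add0n !leq0n !ltn_ord.
Qed.

Lemma sum_fejer_coef K (y : R) :
  \sum_(n <- fejer_freqs K) (fejer_coef K n)%:C%C * wave n%:~R y = (fejer K y)%:C%C.
Proof.
have E : (normc (dirichlet_sum K y) ^+ 2)%:C%C =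
    \sum_(j < K) \sum_(k < K) wave (Posz j - Posz k)%:~R y.
  have -> : (normc (dirichlet_sum K y) ^+ 2)%:C%C = dirichlet_sum K y * (dirichlet_sum K y)^*%C.
    apply: complexP; first by rewrite normc_sqr_Re.
    by rewrite ImM; case: (dirichlet_sum K y) => p q /=; ring.
  rewrite /dirichlet_sum conjc_sum mulr_suml; apply: eq_bigr => j _.
  rewrite mulr_sumr; apply: eq_bigr => k _.
  by rewrite intrB waveB.
rewrite /fejer rmorphM/= E mulr_sumr.
transitivity (\sum_(n <- fejer_freqs K) \sum_(j < K) \sum_(k < K)
    (K%:R^-1)%:C%C * ((Posz j - Posz k == n)%:R * wave n%:~R y)).
  apply: eq_bigr => n _; rewrite /fejer_coef rmorphM/= -mulrA; under [RHS]eq_bigr do rewrite -mulr_sumr.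
  rewrite -mulr_sumr; congr (_ * _); rewrite rmorph_sum/= mulr_suml; apply: eq_bigr => j _.
  rewrite rmorph_sum/= mulr_suml; apply: eq_bigr => k _.
  by rewrite rmorph_nat.
rewrite exchange_big/=; apply: eq_bigr => j _; rewrite exchange_big/= mulr_sumr.
apply: eq_bigr => k _; rewrite -mulr_sumr; congr (_ * _).
rewrite (bigD1_seq (Posz j - Posz k)) ?undup_uniq//=; last first.
  rewrite mem_undup; apply/mapP; exists (val j, val k) => //.
  by apply/allpairsP; exists (val j, val k); rewrite !mem_iota !add0n !leq0n !ltn_ord.
rewrite eqxx mul1r big1 ?addr0// => n nn.
by rewrite eq_sym (negbTE nn) mul0r.
Qed.

Let nrm := \int[lebprod]_w `|u0 w|.

Let iphase (f : RR -> R) : measurable_fun [set: RR] f ->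
  cintegrable lebprod (fun w : RR => (u0 w)%:C%C * expi (f w)).
Proof.
move=> mf; apply: (@cintegrable_dominated _ _ R lebprod _ (fun w => `|u0 w|)).
- by apply: cmeasM; [exact: cmeas_real|exact: cmeas_expi].
- exact: integrable_norm iu0.
- by move=> w; rewrite normcM normc_expi mulr1 normc_real.
Qed.

Lemma fourier_plane_le n l : normc (fourier_plane n l) <= nrm.
Proof.
have mf : measurable_fun [set: RR] (fun w : RR => - (2 * pi * (n%:~R * w.1 + l * w.2))).
  apply: measurable_funN; apply: measurable_funM => //.
  by apply: measurable_funD; apply: measurable_funM => //.
apply: (le_trans (normc_cint_le (iphase mf))).
rewrite le_eqVlt; apply/orP; left; apply/eqP; apply: eq_Rintegral => w _.
by rewrite normcM normc_expi mulr1 normc_real.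
Qed.

Variable j : nat.
Let K := j.+1.
Let c : R := j.+1%:R^-1.
Let c0 : 0 < c. Proof. by rewrite invr_gt0 ltr0n. Qed.

Definition damped_coef (n : int) (l : R) : R[i] :=
  (fejer_coef K n)%:C%C * ((exp_abs c l)%:C%C * fourier_plane n l).

Let h n (z : measurableTypeR R * RR) : R[i] := (exp_abs c z.1)%:C%C *
  ((u0 z.2)%:C%C * expi (- (2 * pi * (n%:~R * z.2.1 + z.1 * z.2.2)))).

Let mphase n : measurable_fun [set: measurableTypeR R * RR]
  (fun z : measurableTypeR R * RR => - (2 * pi * (n%:~R * z.2.1 + z.1 * z.2.2))).
Proof.
apply: measurable_funN; apply: measurable_funM => //.
apply: measurable_funD; apply: measurable_funM => //.
  exact: (measurableT_comp measurable_fst).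
exact: (measurableT_comp measurable_snd).
Qed.

Let idom : (mu \x lebprod)%E.-integrable setT
  (EFin \o (fun z : measurableTypeR R * RR => exp_abs c z.1 * `|u0 z.2|)).
Proof.
apply: (@integrable_tensor _ _ (measurableTypeR R) _ R mu lebprod (exp_abs c) (fun w => `|u0 w|)).
  exact: integrable_exp_abs.
exact: integrable_norm iu0.
Qed.

Let mh n : cmeas (h n).
Proof.
apply: cmeasM; first by apply: cmeas_real; exact: (measurableT_comp (measurable_exp_abs c)).
by apply: cmeasM; [apply: cmeas_real; exact: (measurableT_comp mu0)|exact: cmeas_expi (mphase n)].
Qed.

Let normh n z : normc (h n z) = exp_abs c z.1 * `|u0 z.2|.
Proof. by rewrite !normcM normc_expi mulr1 !normc_real ger0_norm ?exp_abs_ge0. Qed.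

Let hsec n l : cintegrable lebprod (fun w => h n (l, w)).
Proof.
apply: (@cintegrableZl _ _ R lebprod (exp_abs c l)%:C%C); apply: iphase.
exact: (measurable_fun_pair2 l (mphase n)).
Qed.

Let hE n l : cint lebprod (fun w => h n (l, w)) = (exp_abs c l)%:C%C * fourier_plane n l.
Proof.
by apply: (@cintZl _ _ R lebprod (exp_abs c l)%:C%C); apply: iphase; exact: (measurable_fun_pair2 l (mphase n)).
Qed.

Let cmeas_exp_fourier n :
  cmeas (fun l : measurableTypeR R => (exp_abs c l)%:C%C * fourier_plane n l).
Proof.
have -> : (fun l => (exp_abs c l)%:C%C * fourier_plane n l) =
    (fun l => cint lebprod (fun w => h n (l, w))) by apply/funext => l; rewrite hE.
apply/cintegrable_cmeas/(@cintegrable_section _ _ _ _ R mu lebprod (h n)); last exact: hsec.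
apply: (@cintegrable_dominated _ _ R (mu \x lebprod)%E (h n) _ (mh n) idom) => z.
by rewrite normh.
Qed.

(** The damped integrand is integrable in all variables, so Fubini's theorem yields measurability in
    [l]; multiplying by the inverse exponential removes the damping. *)
Lemma cmeas_fourier_plane n : cmeas (fourier_plane n : measurableTypeR R -> _).
Proof.
have -> : fourier_plane n =
    fun l => (expR (c * `|l|))%:C%C * ((exp_abs c l)%:C%C * fourier_plane n l).
  apply/funext => l; rewrite mulrA -rmorphM/= /exp_abs -expRD subrr expR0.
  by rewrite mul1r.
apply: cmeasM; last exact: cmeas_exp_fourier.
apply: cmeas_real; apply: (measurableT_comp (@measurable_expR R)).
by apply: measurable_funM => //; exact: measurableT_comp.
Qed.

Lemma damped_coef_dominated n : exp_dominated nrm c (damped_coef n).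
Proof.
split; first by apply: cmeasM; [exact: cmeas_cst|exact: cmeas_exp_fourier].
move=> l; rewrite /damped_coef !normcM !normc_real ger0_norm ?fejer_coef_ge0//.
rewrite (ger0_norm (exp_abs_ge0 _ _)) mulrC [nrm * _]mulrC -mulrA ler_wpM2l ?exp_abs_ge0//.
rewrite -[leRHS]mulr1; apply: ler_pM => //; rewrite ?normc_ge0 ?fejer_coef_ge0//.
  exact: fourier_plane_le.
exact: fejer_coef_le1.
Qed.

Lemma damped_coef0 n : n \notin fejer_freqs K -> forall l, damped_coef n l = 0.
Proof. by move=> ns l; rewrite /damped_coef fejer_coef0// mul0r. Qed.

(** Both multipliers lie in [[0, 1]]. Hence the energy of the coefficients is bounded by that of
    [u], uniformly in [j]. *)
Lemma normc_damped_coef_le n l : normc (damped_coef n l) <= normc (fourier_plane n l).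
Proof.
rewrite /damped_coef !normcM !normc_real (ger0_norm (exp_abs_ge0 _ _)).
rewrite ger0_norm ?fejer_coef_ge0// mulrA ler_piMl ?normc_ge0//.
rewrite mulr_ile1 ?fejer_coef_ge0 ?exp_abs_ge0 ?fejer_coef_le1//.
by rewrite /exp_abs -expR0 ler_expR oppr_le0 mulr_ge0// ltW.
Qed.

Let hw n t (z : measurableTypeR R * RR) := h n z * wave z.1 t.

(** Integrating in [l] before the space-time variables leaves the transform of the exponential at
    [t - w.2], which is the Poisson kernel. *)
Let damped_wave n t : cint mu (fun l => damped_coef n l * wave l t) =
  (fejer_coef K n)%:C%C *
  cint lebprod (fun w : RR => (u0 w * poisson c (t - w.2))%:C%C * wave n%:~R (- w.1)).
Proof.
have ihw : cintegrable (mu \x lebprod)%E (hw n t).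
  apply: (@cintegrable_dominated _ _ R (mu \x lebprod)%E (hw n t) _ _ idom) => [|z].
    apply: cmeasM; first exact: mh.
    by apply: cmeas_expi; do 2 apply: measurable_funM => //.
  by rewrite /hw normcM normc_expi mulr1 normh.
have hwl l : cintegrable lebprod (fun w => hw n t (l, w)).
  rewrite /hw; under eq_fun do rewrite mulrC.
  exact: (@cintegrableZl _ _ R lebprod (wave l t) _ (hsec n l)).
have hwE w l : hw n t (l, w) = ((u0 w)%:C%C * wave n%:~R (- w.1)) *
    ((exp_abs c l)%:C%C * expi (2 * pi * (t - w.2) * l)).
  rewrite /hw /h /wave/= -!mulrA mulrCA; congr (_ * _).
  rewrite [RHS]mulrCA; congr (_ * _); rewrite -!expiD; congr expi; ring.
have iexp w : cintegrable mu (fun l => (exp_abs c l)%:C%C * expi (2 * pi * (t - w) * l)).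
  apply: (@cintegrable_dominated _ _ R mu _ (exp_abs c)).
  - apply: cmeasM; first by apply: cmeas_real; exact: measurable_exp_abs.
    by apply: cmeas_expi; exact: measurable_funM.
  - exact: integrable_exp_abs.
  - by move=> l; rewrite normcM normc_expi mulr1 normc_real ger0_norm ?exp_abs_ge0.
have hww w : cintegrable mu (fun l => hw n t (l, w)).
  under eq_fun do rewrite hwE.
  exact: (@cintegrableZl _ _ R mu _ _ (iexp w.2)).
transitivity ((fejer_coef K n)%:C%C *
    cint mu (fun l => cint lebprod (fun w => hw n t (l, w)))).
  rewrite -cintZl; last exact: (@cintegrable_section _ _ _ _ R mu lebprod _ ihw hwl).
  apply: eq_cint => l; rewrite /damped_coef -mulrA; congr (_ * _).
  rewrite -hE mulrC -cintZl; last exact: hsec.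
  by apply: eq_cint => w; rewrite /hw mulrC.
congr (_ * _); rewrite (@cint_fubini _ _ _ _ R mu lebprod _ ihw hwl hww).
apply: eq_cint => w; under eq_cint do rewrite hwE.
rewrite (@cintZl _ _ R mu _ _ (iexp w.2)) cint_exp_expi// -/(poisson c (t - w.2)).
have -> : (u0 w * poisson c (t - w.2))%:C%C = (u0 w)%:C%C * (poisson c (t - w.2))%:C%C.
  exact: rmorphM.
by ring.
Qed.

Definition approximant (z : RR) : R :=
  \int[lebprod]_w (u0 w * (fejer K (z.1 - w.1) * poisson c (z.2 - w.2))).

(** After [damped_wave], summing over [n] reassembles the Fejer kernel at [x - w.1] through
    [sum_fejer_coef]; in particular the sum is real. *)
Lemma trig_sum_approximant z :
  trig_sum (fejer_freqs K) damped_coef z = (approximant z)%:C%C.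
Proof.
case: z => x t; rewrite /trig_sum/=.
pose g n (w : RR) := ((fejer_coef K n)%:C%C * wave n%:~R x) *
  ((u0 w * poisson c (t - w.2))%:C%C * wave n%:~R (- w.1)).
have iuw n : cintegrable lebprod
    (fun w : RR => (u0 w * poisson c (t - w.2))%:C%C * wave n%:~R (- w.1)).
  apply: (@cintegrable_dominated _ _ R lebprod _ (fun w => 2 / c * `|u0 w|)).
  - apply: cmeasM.
      apply: cmeas_real; apply: measurable_funM => //.
      by apply: (measurableT_comp (measurable_poisson c0)); exact: measurable_funB.
    by apply: cmeas_expi; do 2 apply: measurable_funM => //; exact: measurable_funN.
  - exact: (integrableZl measurableT (2 / c) (integrable_norm iu0)).
  - move=> w; rewrite normcM normc_expi mulr1 normc_real normrM mulrC.
    by rewrite ger0_norm ?poisson_ge0// ler_wpM2r// poisson_le.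
transitivity (cint lebprod (fun w => \sum_(n <- fejer_freqs K) g n w)).
  rewrite cint_sum; last by move=> n; exact: (@cintegrableZl _ _ R lebprod _ _ (iuw n)).
  apply: eq_bigr => n _; rewrite damped_wave mulrAC -cintZl//.
have E w : \sum_(n <- fejer_freqs K) g n w =
    (u0 w * (fejer K (x - w.1) * poisson c (t - w.2)))%:C%C.
  have -> : u0 w * (fejer K (x - w.1) * poisson c (t - w.2)) =
    (u0 w * poisson c (t - w.2)) * fejer K (x - w.1) by ring.
  rewrite rmorphM/= -sum_fejer_coef mulr_sumr; apply: eq_bigr => n _.
  rewrite /g; have -> : wave n%:~R (x - w.1) = wave n%:~R x * wave n%:~R (- w.1).
    by rewrite /wave -expiD; congr expi; ring.
  by ring.
under eq_cint do rewrite E.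
apply: complexP; rewrite ?Re_cint ?Im_cint//.
by rewrite Rintegral_cst//= mul0r.
Qed.

End approximants.

(** * Weak convergence of the means on the slab *)

Section weak_limit.
Context {R : realType}.
Local Notation mu := (@lebesgue_measure R).
Local Notation RR := (measurableTypeR R * measurableTypeR R)%type.

Lemma Rintegral_indicM d (X : measurableType d) (nu : {measure set X -> \bar R})
    (A : set X) (f : X -> R) :
  \int[nu]_(x in A) f x = \int[nu]_x (\1_A x * f x).
Proof.
rewrite Rintegral_mkcond; apply: eq_Rintegral => x _.
by rewrite patchE indicE; case: (x \in A); rewrite ?mul1r ?mul0r.
Qed.

Lemma Rintegral_subset_le d (X : measurableType d) (nu : {measure set X -> \bar R})
    (A F : set X) (f : X -> R) : measurable A -> measurable F -> A `<=` F ->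
  nu.-integrable F (EFin \o f) -> (forall x, 0 <= f x) ->
  \int[nu]_(x in A) f x <= \int[nu]_(x in F) f x.
Proof.
move=> mA mF AF iif f0; have ia := integrableS mF mA AF iif.
rewrite -lee_fin /Rintegral !fineK;
  [|exact: (integrable_fin_num mF iif)|exact: (integrable_fin_num mA ia)].
apply: ge0_subset_integral => //; first exact: measurable_int iif.
by move=> x _; rewrite lee_fin.
Qed.

Lemma ae_fst_neq (p : R) : {ae lebprod, forall w : RR, w.1 != p}.
Proof.
exists ([set p] `*` setT); split.
- by apply: measurableX => //; exact: measurable_set1.
- have -> : lebprod ([set p] `*` setT : set RR) = (mu [set p] * mu setT)%E.
    by rewrite /lebprod product_measure1E//; exact: measurable_set1.
  by rewrite lebesgue_measure_set1 mul0e.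
- by move=> w /= /negP; rewrite negbK => /eqP.
Qed.

Lemma ae_snd_neq (p : R) : {ae lebprod, forall w : RR, w.2 != p}.
Proof.
exists (setT `*` [set p]); split.
- by apply: measurableX => //; exact: measurable_set1.
- have -> : lebprod (setT `*` [set p] : set RR) = (mu setT * mu [set p])%E.
    by rewrite /lebprod product_measure1E//; exact: measurable_set1.
  by rewrite lebesgue_measure_set1 mule0.
- by move=> w /= /negP; rewrite negbK => /eqP.
Qed.

Variables (T : R) (u : RR -> R).
Hypothesis T0 : 0 < T.
Let D : set RR := slab T.
Hypothesis iu : lebprod.-integrable D (EFin \o u).

Let mtorus : measurable (torus : set (measurableTypeR R)) := measurable_torus.
Let mitv : measurable (`[0, T]%classic : set (measurableTypeR R)).
Proof. exact: measurable_itv. Qed.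
Let mray (a : R) : measurable (`]a, +oo[%classic : set (measurableTypeR R)).
Proof. exact: measurable_itv. Qed.

Lemma measurable_slab : measurable D.
Proof. exact: measurableX. Qed.

Lemma slab_fin : (lebprod D < +oo)%E.
Proof.
have e1 : (mu (torus : set (measurableTypeR R)) < +oo)%E.
  by rewrite lebesgue_measure_itv/= lte_fin ltr01 -EFinD ltry.
have e2 : (mu (`[0%R, T]%classic : set (measurableTypeR R)) < +oo)%E.
  by rewrite lebesgue_measure_itv/= lte_fin T0 -EFinD ltry.
rewrite /lebprod /D /slab product_measure1E//.
by apply: lte_mul_pinfty => //; rewrite ge0_fin_numE.
Qed.

Let u0 : RR -> R := u \_ D.

Lemma integrable_slab_ext : lebprod.-integrable setT (EFin \o u0).
Proof. by move/(integrable_mkcond _ measurable_slab) : iu; rewrite restrict_EFin. Qed.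

Let iu0 := integrable_slab_ext.

Let mu0 : measurable_fun [set: RR] u0.
Proof. by apply/measurable_EFinP; exact: measurable_int iu0. Qed.

Section rays.
Variables (a e : R).
Let A : set (measurableTypeR R) := torus `&` `]a, +oo[.
Let B : set (measurableTypeR R) := `[0, T] `&` `]e, +oo[.
Let mA : measurable A. Proof. exact: measurableI. Qed.
Let mB : measurable B. Proof. exact: measurableI. Qed.
Let E : set RR := A `*` B.
Let mE : measurable E. Proof. exact: measurableX. Qed.

Let P (j : nat) (x y : R) := fejer j.+1 (x - y).
Let Q (j : nat) (t s : R) := poisson (j.+1%:R^-1) (t - s).
Let c0 j : 0 < j.+1%:R^-1 :> R. Proof. by rewrite invr_gt0 ltr0n. Qed.
Let P0 j x y : 0 <= P j x y. Proof. exact: fejer_ge0. Qed.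
Let Q0 j x y : 0 <= Q j x y. Proof. exact: poisson_ge0. Qed.

Let I j (y : R) := \int[mu]_(x in A) P j x y.
Let J j (s : R) := \int[mu]_(t in B) Q j t s.

(** In [z], the first point is where [u0] is sampled and the second is where the mean is
    evaluated. *)
Let g j (z : RR * RR) := u0 z.1 * ((\1_A z.2.1 * P j z.2.1 z.1.1) * (\1_B z.2.2 * Q j z.2.2 z.1.2)).

Let mg j : measurable_fun [set: RR * RR] (g j).
Proof.
have m11 : measurable_fun [set: RR * RR] (fun z : RR * RR => z.1.1).
  exact: (measurableT_comp measurable_fst).
have m12 : measurable_fun [set: RR * RR] (fun z : RR * RR => z.1.2).
  exact: (measurableT_comp measurable_snd).
have m21 : measurable_fun [set: RR * RR] (fun z : RR * RR => z.2.1).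
  exact: (measurableT_comp measurable_fst).
have m22 : measurable_fun [set: RR * RR] (fun z : RR * RR => z.2.2).
  exact: (measurableT_comp measurable_snd).
apply: measurable_funM; first exact: (measurableT_comp mu0).
apply: measurable_funM; apply: measurable_funM.
- exact: (measurableT_comp (measurable_indic mA)).
- by apply: (measurableT_comp (measurable_fejer j.+1)); exact: measurable_funB.
- exact: (measurableT_comp (measurable_indic mB)).
- by apply: (measurableT_comp (measurable_poisson (c0 j))); exact: measurable_funB.
Qed.

(** The product of the suprema of the two kernels. It grows with [j] and serves only for
    integrability at fixed [j]. *)
Let M j : R := j.+1%:R * (2 / j.+1%:R^-1).

Let indE (z : RR) : \1_E z = \1_A z.1 * \1_B z.2 :> R.
Proof. by rewrite !indicE -natrM mulnb /E in_setX. Qed.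

Let g_le j w z : `|g j (w, z)| <= M j * (`|u0 w| * \1_E z).
Proof.
rewrite normrM [leRHS]mulrCA ler_wpM2l ?normr_ge0//.
have iA : 0 <= \1_A z.1 :> R by []; have iB : 0 <= \1_B z.2 :> R by [].
have hP := P0 j z.1 w.1; have hQ := Q0 j z.2 w.2.
rewrite /= indE ger0_norm; last by apply: mulr_ge0; exact: mulr_ge0.
rewrite /M mulrACA mulrC; apply: ler_wpM2r; first exact: mulr_ge0.
by apply: ler_pM => //; [exact: fejer_le|exact: poisson_le].
Qed.

Let ind_fin : lebprod.-integrable setT (EFin \o (\1_E : RR -> R)).
Proof.
apply/integrableP; split; first exact/measurable_EFinP.
under eq_integral do rewrite gee0_abs ?lee_fin//.
rewrite integral_indic// setIT; apply: (le_lt_trans _ slab_fin).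
apply: le_measure; rewrite ?inE//; first exact: measurable_slab.
by move=> [x t] [[Ax _] [Bt _]].
Qed.

Let ig j : (lebprod \x lebprod)%E.-integrable setT (EFin \o g j).
Proof.
have i1 := @integrable_tensor _ _ RR RR R lebprod lebprod (fun w => `|u0 w|) (\1_E : RR -> R)
  (integrable_norm iu0) ind_fin.
have i2 := integrableZl measurableT (M j) i1.
apply: (le_integrable measurableT _ _ i2); first exact/measurable_EFinP.
by move=> [w z] _ /=; rewrite lee_fin (le_trans (g_le j w z))// ler_norm.
Qed.

Let igw j w : lebprod.-integrable setT (EFin \o (fun z => g j (w, z))).
Proof.
have i2 := integrableZl measurableT (M j * `|u0 w|) ind_fin.
apply: (le_integrable measurableT _ _ i2).
  by apply/measurable_EFinP; exact: (measurable_fun_pair2 w (mg j)).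
by move=> z _ /=; rewrite lee_fin (le_trans (g_le j w z))// mulrA ler_norm.
Qed.

Let igz j z : lebprod.-integrable setT (EFin \o (fun w => g j (w, z))).
Proof.
have i2 := integrableZl measurableT (M j * \1_E z) (integrable_norm iu0).
apply: (le_integrable measurableT _ _ i2).
  by apply/measurable_EFinP; exact: (measurable_fun_pair1 z (mg j)).
move=> w _ /=; rewrite lee_fin (le_trans (g_le j w z))// mulrCA mulrC.
by rewrite ler_norm.
Qed.

Let iP j y : mu.-integrable setT (EFin \o (fun x => \1_A x * P j x y)).
Proof.
have mP : measurable_fun [set: R] (fun x => P j x y).
  by apply: (measurableT_comp (measurable_fejer j.+1)); exact: measurable_funD.
have i1 : mu.-integrable torus (EFin \o (fun x => P j x y)).
  apply: (@integrable_torus_bounded _ _ j.+1%:R) => // x.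
  by rewrite ger0_norm ?P0// fejer_le.
have := integrableS mtorus mA (@subIsetl _ _ _) i1.
move/(integrable_mkcond _ mA); apply: eq_integrable => // x _.
by rewrite /= patchE indicE; case: (x \in A); rewrite ?mul1r ?mul0r.
Qed.

Let iQitv j s : mu.-integrable `[0, T] (EFin \o (fun t => Q j t s)).
Proof.
have mQ : measurable_fun [set: R] (fun t => Q j t s).
  by apply: (measurableT_comp (measurable_poisson (c0 j))); exact: measurable_funD.
apply/integrableP; split; first by apply/measurable_EFinP; exact: (measurable_funTS mQ).
under eq_integral do rewrite gee0_abs ?lee_fin ?Q0//.
by rewrite integral_poisson// ?ltry// ltW.
Qed.

Let iQ j s : mu.-integrable setT (EFin \o (fun t => \1_B t * Q j t s)).
Proof.
have := integrableS mitv mB (@subIsetl _ _ _) (iQitv j s).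
move/(integrable_mkcond _ mB); apply: eq_integrable => // x _.
by rewrite /= patchE indicE; case: (x \in B); rewrite ?mul1r ?mul0r.
Qed.

Let int_gw j w : \int[lebprod]_z g j (w, z) = u0 w * (I j w.1 * J j w.2).
Proof.
have ipq := @integrable_tensor _ _ (measurableTypeR R) (measurableTypeR R) R mu mu _ _
  (iP j w.1) (iQ j w.2).
rewrite /g/= RintegralZl//.
rewrite (@Rintegral_tensor _ _ (measurableTypeR R) (measurableTypeR R) R mu mu _ _
  (iP j w.1) (iQ j w.2)).
by rewrite -!Rintegral_indicM.
Qed.

(** Fubini moves both kernels from [u0] onto the indicators of the rectangle, where they act as
    approximate identities separately in each coordinate. *)
Let int_approximant j : \int[lebprod]_(z in E) approximant u0 j z =
  \int[lebprod]_w (u0 w * (I j w.1 * J j w.2)).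
Proof.
rewrite Rintegral_indicM.
under [RHS]eq_Rintegral do rewrite -int_gw.
rewrite (@Rintegral_fubini1 _ _ RR RR R lebprod lebprod _ (ig j) (igw j)).
rewrite -(@Rintegral_fubini2 _ _ RR RR R lebprod lebprod _ (ig j) (igz j)).
apply: eq_Rintegral => z _; rewrite /approximant -RintegralZl//.
  by apply: eq_Rintegral => w _; rewrite /g/= indE /P /Q; ring.
apply: (@le_integrable _ _ _ lebprod setT measurableT _
  (EFin \o (fun w => M j * `|u0 w|))); last first.
- exact: (integrableZl measurableT (M j) (integrable_norm iu0)).
- move=> w _ /=; rewrite lee_fin normrM [leRHS]ger0_norm ?mulr_ge0//.
  have hP := P0 j z.1 w.1; have hQ := Q0 j z.2 w.2.
  rewrite mulrC ler_wpM2r// ger0_norm; last exact: mulr_ge0.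
  by apply: ler_pM => //; [exact: fejer_le|exact: poisson_le].
- apply/measurable_EFinP; apply: measurable_funM => //; apply: measurable_funM.
    apply: (measurableT_comp (measurable_fejer j.+1)).
    by apply: measurable_funB => //; exact: measurable_fst.
  apply: (measurableT_comp (measurable_poisson (c0 j))).
  by apply: measurable_funB => //; exact: measurable_snd.
Qed.

Let I01 j y : 0 <= I j y <= 1.
Proof.
apply/andP; split; first by apply: Rintegral_ge0 => x _; exact: P0.
rewrite -(@integral_fejer R j.+1 y)//.
apply: Rintegral_subset_le => //; first exact: subIsetl.
apply: (@integrable_torus_bounded _ _ j.+1%:R).
  by apply: (measurableT_comp (measurable_fejer j.+1)); exact: measurable_funD.
by move=> x; rewrite ger0_norm ?fejer_ge0 ?fejer_le.
Qed.

Let J01 j s : 0 <= J j s <= 1.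
Proof.
apply/andP; split; first by apply: Rintegral_ge0 => x _; exact: Q0.
apply: (@le_trans _ _ (\int[mu]_(t in `[0, T]) Q j t s)).
  by apply: Rintegral_subset_le => //; exact: subIsetl.
rewrite /Rintegral integral_poisson ?(ltW T0)//.
rewrite [X in X <= _]/fine ler_pdivrMr ?pi_gt0// mul1r.
have := atan_ltpi2 (2 * pi * (T - s) / j.+1%:R^-1).
have := atan_ltpi2 (2 * pi * s / j.+1%:R^-1).
lra.
Qed.

(** Dominated convergence: [I] and [J] lie in [[0, 1]], so [|u0|] is a majorant, and both tend to
    indicators of rays at almost every point. *)
Lemma approximant_ray_cvg :
  \int[lebprod]_(z in E) approximant u0 j z @[j --> \oo] --> \int[lebprod]_(z in E) u z.
Proof.
have -> : (fun j => \int[lebprod]_(z in E) approximant u0 j z) =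
    (fun j => \int[lebprod]_w (u0 w * (I j w.1 * J j w.2))) by apply/funext => j; rewrite int_approximant.
have -> : \int[lebprod]_(z in E) u z =
    \int[lebprod]_w (u0 w * ((a < w.1)%R%:R * (e < w.2)%R%:R)).
  rewrite Rintegral_indicM; apply: eq_Rintegral => -[x t] _.
  rewrite /u0 patchE indicE /E /A /B /D /slab/= !in_setX !in_setI/=.
  have -> : (x \in `]a, +oo[%classic) = (a < x) by apply/idP/idP; rewrite inE/= in_itv/= andbT.
  have -> : (t \in `]e, +oo[%classic) = (e < t) by apply/idP/idP; rewrite inE/= in_itv/= andbT.
  case: (x \in torus); case: (t \in `[0, T]%classic); case: (a < x); case: (e < t) => /=;
    by rewrite ?mul0r ?mul1r ?mulr0 ?mulr1.
apply: (@Rintegral_dominated_cvg _ _ _ lebprod setT measurableT _ _ (fun w => `|u0 w|)).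
- move=> j; have := @Rintegral_integrable_section _ _ RR RR R lebprod lebprod (g j) (ig j) (igw j).
  move=> /measurable_int/measurable_EFinP; apply: eq_measurable_fun => w _.
  by rewrite int_gw.
- apply: measurable_funM => //; apply: measurable_funM.
    by apply: measurable_natr_bool; apply: measurable_fun_ltr.
  by apply: measurable_natr_bool; apply: measurable_fun_ltr.
(* The excluded null lines are the edges of the slab, where the mass of a kernel splits or partly
   leaves the interval, and the endpoints of the rays. *)
- apply: filterS3 (filterI (ae_fst_neq 0) (ae_fst_neq a)) (filterI (ae_snd_neq 0) (ae_snd_neq T)) (ae_snd_neq e).
  move=> [x t]/= [/= x0 xa] [/= t0 tT] te _; rewrite /u0 patchE.
  case: ifPn => [|_]; last first.
    by under eq_cvg do rewrite mul0r; rewrite mul0r; exact: cvg_cst.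
  rewrite inE => -[/= ]; rewrite /torus/= !in_itv/= => /andP[x00 x1] /andP[t00 t1].
  apply: cvgM; first exact: cvg_cst.
  apply: cvgM.
    by apply: fejer_cvg_ray; [rewrite lt_neqAle eq_sym x0 x00|rewrite eq_sym].
  by apply: poisson_cvg_ray; [rewrite !lt_neqAle eq_sym t0 t00 tT|rewrite eq_sym].
- exact: integrable_norm iu0.
- move=> j w _; rewrite normrM ler_piMr//.
  have /andP[i0 i1] := I01 j w.1; have /andP[j0 j1] := J01 j w.2.
  by rewrite ger0_norm ?mulr_ge0// mulr_ile1.
Qed.

End rays.

Variable C : R.
Hypothesis mS : forall j, measurable_fun D (approximant u0 j).
Hypothesis SC : forall j, (\int[lebprod]_(z in D) (approximant u0 j z ^+ 4)%:E <= C%:E)%E.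

Let iS j : lebprod.-integrable D (EFin \o approximant u0 j).
Proof. exact: (integrable_l4 measurable_slab slab_fin mS SC j). Qed.

Let nu j (F : set RR) := \int[lebprod]_(z in D `&` F) (approximant u0 j z - u z).

Let iSu j : lebprod.-integrable D (EFin \o (fun z => approximant u0 j z - u z)).
Proof. exact: (integrableB measurable_slab (iS j) iu). Qed.

Let nuU j (F H : set RR) : measurable F -> measurable H -> F `&` H = set0 ->
  nu j (F `|` H) = nu j F + nu j H.
Proof.
move=> mF mH FH; rewrite /nu setIUr Rintegral_setU//.
- by apply: measurableI => //; exact: measurable_slab.
- by apply: measurableI => //; exact: measurable_slab.
- rewrite -setIUr; apply: integrableS (iSu j); [exact: measurable_slab| |exact: subIsetl].
  by apply: measurableI; [exact: measurable_slab|exact: measurableU].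
- apply/disj_setPS => x [[_ Fx] [_ Hx]]; by rewrite -FH.
Qed.

Let nu_tail (E : nat -> set RR) : (forall k, measurable (E k)) ->
  (forall k, E k.+1 `<=` E k) -> \bigcap_k E k = set0 ->
  forall e, 0 < e -> exists k, forall j, `|nu j (E k)| <= e.
Proof. exact: (l4_tail measurable_slab slab_fin iu mS SC). Qed.

Let nuE j (F : set RR) : measurable F -> nu j F =
  \int[lebprod]_(z in D `&` F) approximant u0 j z - \int[lebprod]_(z in D `&` F) u z.
Proof.
move=> mF; have mDF : measurable (D `&` F) by apply: measurableI => //; exact: measurable_slab.
rewrite /nu RintegralB//.
  by apply: integrableS (iS j); [exact: measurable_slab| |exact: subIsetl].
by apply: integrableS iu; [exact: measurable_slab| |exact: subIsetl].
Qed.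

Let ray_cvg (a e : R) : nu ^~ (`]a, +oo[ `*` `]e, +oo[) @ \oo --> 0.
Proof.
have mF : measurable (`]a, +oo[ `*` `]e, +oo[ : set RR) by exact: measurableX.
have -> : nu ^~ (`]a, +oo[ `*` `]e, +oo[) = (fun j =>
    \int[lebprod]_(z in D `&` (`]a, +oo[ `*` `]e, +oo[)) approximant u0 j z -
    \int[lebprod]_(z in D `&` (`]a, +oo[ `*` `]e, +oo[)) u z).
  by apply/funext => j; rewrite nuE.
rewrite /D /slab -setXI.
rewrite -[X in _ --> X](subrr
  (\int[lebprod]_(z in (torus `&` `]a, +oo[) `*` (`[0, T] `&` `]e, +oo[)) u z)).
by apply: cvgB; [exact: approximant_ray_cvg|exact: cvg_cst].
Qed.

Let gen_ray : @measurable _ (measurableTypeR R) = <<s @RGenOInfty.G R >>.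
Proof. exact: RGenOInfty.measurableE. Qed.

Let ray_setI : setI_closed (@RGenOInfty.G R).
Proof.
move=> _ _ [a ->] [c ->]; exists (Num.max a c); apply/seteqP; split => x /=.
  by rewrite !in_itv/= !andbT gt_max => -[-> ->].
by rewrite !in_itv/= !andbT gt_max => /andP[].
Qed.

Let nu_slab j (F H : set RR) : D `&` F = D `&` H -> nu j F = nu j H.
Proof. by rewrite /nu => ->. Qed.

(** Extends from rays to measurable sets in one coordinate [p], with the constraint [F] on the other
    coordinate held fixed. *)
Let ray_dynkin (p : RR -> R) (F : set RR) : measurable F ->
  measurable_fun [set: RR] (p : RR -> measurableTypeR R) ->
  (forall z, D z -> 0 <= p z) ->
  (forall a, nu ^~ (p @^-1` `]a, +oo[ `&` F) @ \oo --> 0) ->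
  forall A : set (measurableTypeR R), measurable A -> nu ^~ (p @^-1` A `&` F) @ \oo --> 0.
Proof.
move=> mF mp p0 H A.
have mpF E : measurable (E : set (measurableTypeR R)) -> measurable (p @^-1` E `&` F).
  by move=> mE; apply: measurableI => //; rewrite -[_ @^-1` _]setTI; exact: mp.
apply: (@dynkin_vanish _ (measurableTypeR R) R (fun j A => nu j (p @^-1` A `&` F)) (@RGenOInfty.G R)).
- move=> j E G mE mG EG; rewrite preimage_setU setIUl; apply: nuU; [exact: mpF|exact: mpF|].
  by rewrite setIACA -preimage_setI EG preimage_set0 set0I.
- move=> E mE ES E0; apply: (nu_tail (E := fun k => p @^-1` E k `&` F)).
  + by move=> k; exact: mpF.
  + by move=> k z [/ES].
  + apply/seteqP; split => // z Ez.
    have : (\bigcap_k E k) (p z) by move=> k _; have [] := Ez k Logic.I.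
    by rewrite E0.
- exact: gen_ray.
- exact: ray_setI.
(* Both coordinates are nonnegative on the slab, so the ray from -1 plays the part of the whole
   line. *)
- rewrite (_ : (fun j => _) = nu ^~ (p @^-1` `]-1, +oo[ `&` F)); first exact: H.
  apply/funext => j; apply: nu_slab; rewrite preimage_setT setTI !setIA; congr (_ `&` _).
  rewrite [LHS](_ : _ = D `&` setT) ?setIT//; apply/seteqP; split => [z Dz|z []//]; split => //=.
  by rewrite in_itv/= andbT (lt_le_trans _ (p0 _ Dz)).
- by move=> _ [a ->]; exact: H.
Qed.

Let setXE (A B : set (measurableTypeR R)) : A `*` B = fst @^-1` A `&` snd @^-1` B.
Proof. by []. Qed.

Let rect_cvg (A B : set (measurableTypeR R)) : measurable A -> measurable B ->
  nu ^~ (A `*` B) @ \oo --> 0.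
Proof.
move=> mA mB; have pos z : D z -> 0 <= z.1 /\ 0 <= z.2.
  by move=> [/=]; rewrite /torus/= !in_itv/= => /andP[? _] /andP[? _].
have mp (p : RR -> R) : measurable_fun [set: RR] (p : RR -> measurableTypeR R) ->
    forall E, measurable (E : set (measurableTypeR R)) -> measurable (p @^-1` E).
  by move=> mp E mE; rewrite -[_ @^-1` _]setTI; exact: mp.
have m1 : measurable_fun [set: RR] (fst : RR -> measurableTypeR R) by exact: measurable_fst.
have m2 : measurable_fun [set: RR] (snd : RR -> measurableTypeR R) by exact: measurable_snd.
rewrite setXE; apply: ray_dynkin mA => // [|z /pos[]//|a]; first exact: mp.
rewrite setIC; apply: ray_dynkin mB => // [|z /pos[]//|e]; first exact: mp.
by rewrite setIC -setXE; exact: ray_cvg.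
Qed.

Lemma approximant_weak_cvg (F : set RR) : measurable F ->
  \int[lebprod]_(z in D `&` F) approximant u0 j z @[j --> \oo] -->
  \int[lebprod]_(z in D `&` F) u z.
Proof.
move=> mF.
have H : nu ^~ F @ \oo --> 0.
  apply: (@dynkin_vanish _ RR R nu
    [set A `*` B | A in @measurable _ (measurableTypeR R)
      & B in @measurable _ (measurableTypeR R)]) => //.
  - exact: measurable_prod_measurableType.
  - move=> _ _ [A1 mA1 [B1 mB1 <-]] [A2 mA2 [B2 mB2 <-]].
    by exists (A1 `&` A2); [exact: measurableI|exists (B1 `&` B2); [exact: measurableI|rewrite setXI]].
  - by rewrite -setXTT; apply: rect_cvg.
  - by move=> _ [A mA [B mB <-]]; exact: rect_cvg.
have -> : (fun j => \int[lebprod]_(z in D `&` F) approximant u0 j z) =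
    (fun j => nu j F + \int[lebprod]_(z in D `&` F) u z).
  by apply/funext => j; rewrite nuE// subrK.
rewrite -[X in _ --> X]add0r; apply: cvgD => //; exact: cvg_cst.
Qed.

Lemma slab_l4_le : (\int[lebprod]_(z in D) (u z ^+ 4)%:E <= (2 * C)%:E)%E.
Proof. exact: (weak_l4 measurable_slab slab_fin iu mS SC approximant_weak_cvg). Qed.

End weak_limit.

(** * The bilinear estimate *)

Section bourgain_l4.
Context {R : realType}.
Local Notation mu := (@lebesgue_measure R).
Local Notation RR := (measurableTypeR R * measurableTypeR R)%type.
Variables (N : nat) (b : nat -> R) (T : R).
Hypotheses (hN : (1 <= N)%N) (T0 : 0 < T) (hbN : b N != 0).
Hypothesis hc : forall k : nat, (1 <= k <= N)%N -> symb_coef b k <= 0.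

Definition bourgain_energy (u : R * R -> R) : \bar R :=
  (\esum_(n in [set: int]) \int[mu]_l
     (modw N b n l `^ bexp N * normc (fourier (zero_ext T u) n l) ^+ 2)%:E)%E.

Lemma bourgain_energy_ge0 u : (0 <= bourgain_energy u)%E.
Proof.
apply: esum_ge0 => n _; apply: integral_ge0 => l _.
by rewrite lee_fin mulr_ge0 ?powR_ge0 ?sqr_ge0.
Qed.

Lemma XnormE u : Xnorm (symbol N b) 0 ((N%:R + 1) / (4 * N%:R + 2)) T u =
  (bourgain_energy u `^ 2^-1)%E.
Proof.
congr (_ `^ _)%E; apply: eq_esum => n _; apply: eq_integral => l _; congr EFin.
rewrite mulr0 powRr0 mulr1; congr (_ `^ _ * _).
have n0 : 0 <= N%:R :> R by [].
by rewrite /bexp; field; apply/andP; split; apply: lt0r_neq0; lra.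
Qed.

Lemma fourier_zero_ext u n l :
  fourier (zero_ext T u) n l = fourier_plane (u \_ (slab T)) n l.
Proof.
have E (z : R * R) (h : R -> R) : h 0 = 0 ->
    ((fun z => h (zero_ext T u z)) \_ (torus `*` setT)) z = h ((u \_ (slab T)) z).
  move=> h0; rewrite !patchE /zero_ext /slab !in_setX/= in_setT andbT.
  case: (z.1 \in torus) => /=; last by rewrite h0.
  rewrite (_ : (z.2 \in `[0, T]%classic) = (z.2 \in `[0, T])); first by case: ifP.
  by apply/idP/idP => [/set_mem|/mem_set].
rewrite /fourier /fourier_plane /cintegral /cint; congr Complex.
  rewrite Rintegral_mkcond; apply: eq_Rintegral => z _.
  set w := expi _.
  rewrite -(E z (fun y => complex.Re (y%:C%C * w)))//.
  by rewrite ReM !mul0r subr0.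
rewrite Rintegral_mkcond; apply: eq_Rintegral => z _.
set w := expi _.
rewrite -(E z (fun y => complex.Im (y%:C%C * w)))//.
by rewrite ImM !mul0r addr0.
Qed.

(** The bound is stated for any positive [h] above the energy, so that zero energy is reached by
    letting [h] tend to 0. *)
Lemma slab_l4_energy_le : exists2 C : R, 0 < C & forall (u : R * R -> R) (h : R),
  torus_fun T u -> 0 < h -> (bourgain_energy u <= h%:E)%E ->
  (\int[lebprod]_(z in slab T) (u z ^+ 4)%:E <= (C * h ^+ 2)%:E)%E.
Proof.
have [C C0 HC] := sconv_l2_le hN hbN hc.
(* The 2 comes from the weak limit, [expR T * (2 * pi)] from the local Plancherel inequality, [C]
   from the convolution estimate. *)
exists (2 * (expR T * (2 * pi) * C)); first by rewrite !mulr_gt0 ?expR_gt0 ?pi_gt0.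
move=> u h [_ iu] h0 uh.
have iu0 := integrable_slab_ext iu.
set u0 := u \_ (slab T) in iu0.
pose s j := fejer_freqs j.+1.
have us j : uniq (s j) by exact: undup_uniq.
have c0 j : 0 < j.+1%:R^-1 :> R by rewrite invr_gt0.
have da j n := damped_coef_dominated iu0 j n.
have d0 j n := @damped_coef0 R u0 j n.
have mt j := @measurable_trig_sum R _ _ (s j) _ (c0 j) (da j).
have aE j z : approximant u0 j z = complex.Re (trig_sum (s j) (damped_coef u0 j) z).
  by rewrite trig_sum_approximant.
have ma j : measurable_fun (slab T : set RR) (approximant u0 j).
  have [m1 _] := mt j; apply: measurable_funTS; apply: eq_measurable_fun m1 => z _.
  by rewrite aE.
rewrite -mulrA.
apply: (slab_l4_le T0 iu ma) => j.
pose f n l := normc (damped_coef u0 j n l).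
have mf n : measurable_fun [set: R] (f n) by exact: measurable_normc (da j n).1.
have mnorm : (modnorm2 N b (s j) f <= h%:E)%E.
  apply: le_trans uh; apply: esum_ge; exists [set` s j]; first by split => //; exact: finite_seq.
  rewrite -fsbig_seq//; apply: lee_sum => n _.
  have mw : measurable_fun [set: R] (fun l => modw N b n l `^ bexp N).
    by apply: measurable_fun_powR; exact: measurable_modw.
  apply: ge0_le_integral => //.
  - by move=> l _; rewrite lee_fin mulr_ge0 ?powR_ge0 ?sqr_ge0.
  - apply/measurable_EFinP; apply: measurable_funM; [exact: mw|exact: measurable_funX (mf n)].
  - apply/measurable_EFinP; apply: measurable_funM; first exact: mw.
    apply: measurable_funX; under eq_fun do rewrite fourier_zero_ext.
    exact: measurable_normc (cmeas_fourier_plane iu0 0 n).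
  - move=> l _; rewrite lee_fin ler_wpM2l ?powR_ge0// lerXn2r ?nnegrE ?normc_ge0//.
    by rewrite fourier_zero_ext; exact: normc_damped_coef_le.
have f0 n x : 0 <= f n x by exact: normc_ge0.
have fs n : n \notin s j -> forall x, f n x = 0.
  by move=> ns x; rewrite /f d0// normc0.
have step1 := trig_sum_l4_le (c0 j) (us j) (da j) (d0 j) T.
have step2 := HC (s j) _ f h (us j) (undup_uniq _) mf f0 fs h0 mnorm.
apply: (@le_trans _ _ (\int[lebprod]_(z in slab T)
    (normc (trig_sum (s j) (damped_coef u0 j) z) ^+ 4)%:E)%E).
  apply: ge0_le_integral => //.
  - exact: measurable_slab.
  - by move=> z _; rewrite lee_fin -[4%N]/(2 * 2)%N exprM sqr_ge0.
  - by apply/measurable_EFinP; exact: measurable_funX.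
  - apply/measurable_EFinP; apply: measurable_funX; apply: measurable_funTS.
    exact: measurable_normc (mt j).
  - move=> z _; rewrite lee_fin aE -[4%N]/(2 * 2)%N !exprM.
    rewrite lerXn2r ?nnegrE ?sqr_ge0// -[X in X <= _]real_normK ?num_real//.
    by rewrite lerXn2r ?nnegrE ?normc_ge0//; exact: ler_Re_normc.
apply: (le_trans step1); rewrite -mulrA [leRHS]EFinM.
by apply: lee_wpmul2l; rewrite ?lee_fin ?mulr_ge0 ?expR_ge0 ?pi_ge0.
Qed.

Let mslab : measurable (slab T : set RR) := measurable_slab T.

Let measurable_torus_fun (u : R * R -> R) : torus_fun T u ->
  measurable_fun (slab T : set RR) u.
Proof. by move=> [_ iu]; apply/measurable_EFinP; exact: measurable_int iu. Qed.

Let l4 (u : R * R -> R) := (\int[lebprod]_(z in slab T) (u z ^+ 4)%:E)%E.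

Let l2 (u : R * R -> R) := (\int[lebprod]_(z in slab T) (u z ^+ 2)%:E)%E.

Lemma L2normE (u : R * R -> R) : (L2norm T u = l2 u `^ 2^-1)%E.
Proof.
rewrite /L2norm unlock; congr (_ `^ _)%E; rewrite /l2 [RHS]integral_mkcond.
apply: eq_integral => z _; rewrite !patchE; case: ifPn => _ /=.
  by rewrite powR_mulrn// real_normK ?num_real.
by rewrite normr0 powR0.
Qed.

Lemma l4_product_le (u v : R * R -> R) (h k C : R) : torus_fun T u -> torus_fun T v ->
  0 < h -> 0 < k -> (l4 u <= (C * h ^+ 2)%:E)%E -> (l4 v <= (C * k ^+ 2)%:E)%E ->
  (l2 (u \* v)%R <= (C * h * k)%:E)%E.
Proof.
move=> hu hv h0 k0 uh vk.
have mu_ := measurable_torus_fun hu; have mv := measurable_torus_fun hv.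
have pow4 (y : R) : 0 <= y ^+ 4 by rewrite -[4%N]/(2 * 2)%N exprM sqr_ge0.
(* The weights that balance the two factors: [p * h^2 = q * k^2 = h * k / 2], while [p q = 1 / 4]
   makes the pointwise difference a perfect square. *)
pose p := k / h / 2; pose q := h / k / 2.
have p0 : 0 <= p by rewrite !divr_ge0// ltW.
have q0 : 0 <= q by rewrite !divr_ge0// ltW.
have := @ge0_integral_le_comb _ RR _ lebprod _ mslab 1 p q (fun z => (u z * v z) ^+ 2)
  (fun z => u z ^+ 4) (fun z => v z ^+ 4) ler01 p0 q0.
rewrite mul1e => H; apply: (le_trans (H _ _ _ _ _ _ _)) => //.
- by apply: measurable_funX; exact: measurable_funM.
- exact: measurable_funX.
- exact: measurable_funX.
- by move=> z; exact: sqr_ge0.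
- move=> z; rewrite mul1r.
  have : 0 <= (k * u z ^+ 2 - h * v z ^+ 2) ^+ 2 by exact: sqr_ge0.
  have -> : p * u z ^+ 4 + q * v z ^+ 4 = (u z * v z) ^+ 2 +
      (k * u z ^+ 2 - h * v z ^+ 2) ^+ 2 / (2 * h * k) by rewrite /p /q; field; rewrite !gt_eqF.
  by move=> H2; rewrite lerDl divr_ge0// !mulr_ge0// ltW.
apply: (@le_trans _ _ (p%:E * (C * h ^+ 2)%:E + q%:E * (C * k ^+ 2)%:E)%E).
  by apply: leeD; apply: lee_wpmul2l; rewrite ?lee_fin.
rewrite -!EFinM -EFinD lee_fin /p /q le_eqVlt; apply/orP; left; apply/eqP.
by field; rewrite !gt_eqF.
Qed.

(** Here [v] vanishes almost everywhere, so the product does as well, without any bound on [u]. This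
    covers zero energy of one factor against infinite energy of the other, where the right-hand side
    of the estimate is 0. *)
Lemma l4_eq0_product (u v : R * R -> R) : torus_fun T u -> torus_fun T v ->
  l4 v = 0%E -> l2 (u \* v)%R = 0%E.
Proof.
move=> hu hv v0.
have mu_ := measurable_torus_fun hu; have mv := measurable_torus_fun hv.
have mv4 : measurable_fun (slab T : set RR) (fun z => (v z ^+ 4)%:E).
  by apply/measurable_EFinP; exact: measurable_funX.
have muv : measurable_fun (slab T : set RR) (fun z => ((u z * v z) ^+ 2)%:E).
  by apply/measurable_EFinP; apply: measurable_funX; exact: measurable_funM.
have H : ae_eq lebprod (slab T) (fun z => (v z ^+ 4)%:E) (cst 0%E).
  apply/(ae_eq_integral_abs _ mslab mv4); rewrite -[RHS]v0.
  apply: eq_integral => z _; rewrite gee0_abs// lee_fin.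
  by rewrite -[4%N]/(2 * 2)%N exprM sqr_ge0.
have H2 : ae_eq lebprod (slab T) (fun z => ((u z * v z) ^+ 2)%:E) (cst 0%E).
  apply: filterS H => z Hz /Hz [] /eqP; rewrite expf_eq0/= => /eqP ->.
  by rewrite mulr0 expr0n.
have /(ae_eq_integral_abs _ mslab muv) := H2.
by move=> <-; apply: eq_integral => z _; rewrite gee0_abs// lee_fin sqr_ge0.
Qed.

Lemma bourgain_bilinear : exists2 C : R, 0 < C & forall u v, torus_fun T u -> torus_fun T v ->
  (l2 (u \* v)%R `^ 2^-1 <=
   C%:E * (bourgain_energy u `^ 2^-1) * (bourgain_energy v `^ 2^-1))%E.
Proof.
have [C C0 HC] := slab_l4_energy_le; exists (Num.sqrt C); first by rewrite sqrtr_gt0.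
have l2C u v : l2 (u \* v)%R = l2 (v \* u)%R.
  by apply: eq_integral => z _; rewrite /= mulrC.
have zero u v : torus_fun T u -> torus_fun T v -> bourgain_energy v = 0%E -> l2 (u \* v)%R = 0%E.
  move=> hu hv v0; apply: l4_eq0_product => //; apply/eqP; rewrite eq_le; apply/andP; split.
    apply/lee_addgt0Pr => e e0; rewrite add0e.
    (* Chosen so that [C * h^2 = e]. *)
    have h0 : 0 < Num.sqrt (e / C) by rewrite sqrtr_gt0 divr_gt0.
    have := HC v _ hv h0; rewrite v0 lee_fin (ltW h0) => /(_ isT).
    have eC : 0 <= e / C by rewrite divr_ge0 ?(ltW e0) ?(ltW C0).
    by rewrite sqr_sqrtr// mulrCA divff ?mulr1// gt_eqF.
  by apply: integral_ge0 => z _; rewrite lee_fin -[4%N]/(2 * 2)%N exprM sqr_ge0.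
move=> u v hu hv.
have half0 : 2^-1 != 0 :> R by [].
have rhs0 : (0 <= (Num.sqrt C)%:E * (bourgain_energy u `^ 2^-1) * (bourgain_energy v `^ 2^-1))%E.
  by rewrite !mule_ge0 ?poweR_ge0 ?lee_fin ?sqrtr_ge0.
have [u0|u0] := eqVneq (bourgain_energy u) 0%E.
  by rewrite l2C zero// poweR0r.
have [v0|v0] := eqVneq (bourgain_energy v) 0%E.
  by rewrite zero// poweR0r.
have up : (0 < bourgain_energy u)%E by rewrite lt_neqAle eq_sym u0 bourgain_energy_ge0.
have vp : (0 < bourgain_energy v)%E by rewrite lt_neqAle eq_sym v0 bourgain_energy_ge0.
have sC : (0 < (Num.sqrt C)%:E)%E by rewrite lte_fin sqrtr_gt0.
(* An infinite energy makes the right-hand side infinite, because the other energy is now known to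
   be positive. *)
case Eu : (bourgain_energy u) up => [h| |] //; last first.
  move=> _; rewrite poweRyr// gt0_muley// gt0_mulye ?leey//.
  exact: poweR_gt0.
rewrite lte_fin => h0.
case Ev : (bourgain_energy v) vp => [k| |] //; last first.
  move=> _; rewrite poweRyr// gt0_muley ?leey// mule_gt0//.
  by rewrite poweR_EFin lte_fin powR_gt0.
rewrite lte_fin => k0.
have Hu := HC u h hu h0; rewrite Eu lexx in Hu.
have Hv := HC v k hv k0; rewrite Ev lexx in Hv.
have := l4_product_le hu hv h0 k0 (Hu isT) (Hv isT).
move=> H.
have l20 : (0 <= l2 (u \* v)%R)%E by apply: integral_ge0 => z _; rewrite lee_fin sqr_ge0.
have chk : 0 <= C * h * k by rewrite !mulr_ge0// ltW.
apply: (@le_trans _ _ ((C * h * k)%:E `^ 2^-1)%E).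
  by apply: gt0_ler_poweR; rewrite ?in_itv/= ?leey ?andbT ?lee_fin.
have [C0' h0' k0'] : [/\ 0 <= C, 0 <= h & 0 <= k] by split; exact: ltW.
rewrite !poweR_EFin -!EFinM lee_fin -powR12_sqrt//.
by rewrite -!powRM// mulr_ge0.
Qed.

End bourgain_l4.

Theorem lemma0p1 (R : realType) (N : nat) (T : R) (b : nat -> R)
  (hN : (1 <= N)%N) (hT : 0 < T)
  (hbN : b N != 0)
  (hc : forall k : nat, (1 <= k <= N)%N -> symb_coef b k <= 0) :
  exists C : R, 0 < C /\
    forall u v : R * R -> R, torus_fun T u -> torus_fun T v ->
      (L2norm T (u \* v)%R
       <= C%:E
          * Xnorm (symbol N b) 0 ((N%:R + 1) / (4 * N%:R + 2)) T u
          * Xnorm (symbol N b) 0 ((N%:R + 1) / (4 * N%:R + 2)) T v)%E.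
Proof.
have [C C0 HC] := bourgain_bilinear hN hT hbN hc.
by exists C; split => // u v hu hv; rewrite !XnormE L2normE; exact: HC.
Qed.
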